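(* Let $m\in\mathbb N$, $\tau\ge1$, $a\in(0,1)$, and let $\gamma_1,\dots,\gamma_m\in(0,1]$ be distinct. Let $\{\vec k_n\}_{n=0}^\infty\subset\mathbb Z_{\ge 0}^m$ be a path such that $|\vec k_n|=n$, $\vec k_{n+1}=\vec k_n+\vec e_{j_n}$ for some $j_n\in\{1,\dots,m\}$, and $\vec k_n/n\to\vec\nu=(\nu_1,\dots,\nu_m)$ as $n\to\infty$ for some $\vec\nu\in[0,1]^m$ with $|\vec \nu|=1$. For each $n$ put $t=n\tau$ and let $x_1,\dots,x_n$ be random points distributed according to the multiple Meixner ensemble (of the first kind), i.e. the Multiple Orthogonal Polynomial Ensemble on $\{0,1,2,\dots\}$ with weights $w_j(x)=\gamma_j^x$, $j=1,\dots,m$, reference measure $$\mu_t(x)=\frac{(t-n+1)_x\,a^x}{x!}$$ and multiplicities $\vec k_n$. Put $\xi_j=x_j/n$ and $$a_j=\frac{\tau\nu_ja\gamma_j}{(1-a\gamma_j)^2},\qquad b_j=\frac{\tau a\gamma_j}{1-a\gamma_j}+\sum_{i=1}^m\frac{\nu_i}{1-a\gamma_i},\qquad j=1,\dots,m.$$ Then for any polynomial $f$ with real coefficients, $$\sum_{j=1}^n f(\xi_j)-\mathbb E\Big[\sum_{j=1}^n f(\xi_j)\Big]\longrightarrow N\Big(0,\sum_{\ell=1}^\infty \ell f_\ell f_{-\ell}\Big)$$ in distribution as $n\to\infty$, where for $\ell\in\mathbb Z$ $$f_\ell=\frac1{2\pi i}\oint_\Gamma f\Big(z+\sum_{j=1}^m\frac{a_j}{z-b_j}\Big)\frac{dz}{z^{\ell+1}}$$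 and $\Gamma$ is a simple closed contour with counter-clockwise orientation going around all the points $b_1,\dots,b_m$ and around the origin.
   Context: Notation: $|\vec k|=k_1+\dots+k_m$; $\vec e_1,\dots,\vec e_m$ is the standard basis of $\mathbb R^m$; $(q)_x=q(q+1)\cdots(q+x-1)$ is the Pochhammer symbol, $(q)_0=1$; $N(0,\sigma^2)$ is the normal law with mean $0$ and variance $\sigma^2$. Multiple Orthogonal Polynomial Ensemble on a discrete set $X$ with weights $w_1,\dots,w_m$, reference measure (mass function) $\mu$ and multiplicities $\vec k$, $|\vec k|=n$: the probability measure on $X^n$ with mass function $$\frac1{Z_{\vec k}}\det\big(x_i^{j-1}\big)_{i,j=1}^n\det\big(g_j(x_i)\big)_{i,j=1}^n\prod_{j=1}^n \mu(x_j),$$ where $g_1,\dots,g_n$ are the functions $w_1(x),xw_1(x),\dots,x^{k_1-1}w_1(x),\dots,w_m(x),xw_m(x),\dots,x^{k_m-1}w_m(x)$ and $Z_{\vec k}$ is the normalizing constant. *)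

(* Defs.v *)
From HB Require Import structures.
From mathcomp Require Import all_boot all_order all_algebra.
From mathcomp Require Import all_classical all_reals all_analysis.
From mathcomp Require Export complex.

Set Implicit Arguments.
Unset Strict Implicit.
Unset Printing Implicit Defensive.

Import Order.TTheory GRing.Theory Num.Theory numFieldNormedType.Exports.

Local Open Scope classical_set_scope.
Local Open Scope ring_scope.
Local Open Scope complex_scope.

Section Ensemble.
Context {R : realType}.

Definition pochhammer (q : R) (x : nat) : R := \prod_(i < x) (q + i%:R).

(* w_1, x w_1, ..., x^(k_1 - 1) w_1, ..., w_m, x w_m, ..., x^(k_m - 1) w_m *)
Definition mope_functions m (w : 'I_m -> nat -> R) (k : 'I_m -> nat) :
    seq (nat -> R) :=
  flatten [seq [seq (fun x : nat => x%:R ^+ l * w j x) | l <- iota 0 (k j)]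
          | j <- enum 'I_m].

Definition mope_weight m (w : 'I_m -> nat -> R) (mu : nat -> R)
    (k : 'I_m -> nat) n (x : n.-tuple nat) : R :=
  \det (\matrix_(i < n, j < n) ((tnth x i)%:R ^+ j : R))
  * \det (\matrix_(i < n, j < n)
            (nth (fun=> 0) (mope_functions w k) j) (tnth x i))
  * \prod_(j < n) mu (tnth x j).

(* Q is the multiple orthogonal polynomial ensemble on {0, 1, 2, ...}.  The
   constant Z is determined by Q having total mass 1; it need not be positive,
   as the sign of the product of determinants depends on the order of the
   weights. *)
Definition is_mope m (w : 'I_m -> nat -> R) (mu : nat -> R) (k : 'I_m -> nat)
    n (Q : set (n.-tuple nat) -> \bar R) : Prop :=
  (\sum_(j < m) k j)%N = n /\
  exists2 Z : R, Z != 0 &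
    forall x : n.-tuple nat, Q [set x] = (Z^-1 * mope_weight w mu k x)%:E.

Definition meixner_mass (n : nat) (t a : R) (x : nat) : R :=
  pochhammer (t - n%:R + 1) x * a ^+ x / x`!%:R.

(* the random variable \sum_j f(x_j / n) *)
Definition linear_statistic (f : {poly R}) n (x : n.-tuple nat) : R :=
  \sum_(j < n) f.[(tnth x j)%:R / n%:R].

End Ensemble.

Section Contours.
Context {R : realType}.
Implicit Type G : R -> R[i].

Definition C1_on (a b : R) (u : R -> R) : Prop :=
  exists2 du : R -> R, {within `[a, b], continuous du} &
    forall t : R, t \in `]a, b[ -> is_derive t 1 u (du t).

Definition piecewise_C1 (u : R -> R) : Prop :=
  {within `[0, 1], continuous u} /\
  exists (N : nat) (p : nat -> R),
    [/\ p 0%N = 0, p N = 1 &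
        forall i, (i < N)%N -> p i < p i.+1 /\ C1_on (p i) (p i.+1) u].

Definition simple_closed_contour G : Prop :=
  [/\ piecewise_C1 (fun t => complex.Re (G t)),
      piecewise_C1 (fun t => complex.Im (G t)),
      G 0 = G 1 &
      {in `[0, 1[ &, injective G}].

Definition contour_derivative G (t : R) : R[i] :=
  (derive1 (fun s => complex.Re (G s)) t)
  +i* (derive1 (fun s => complex.Im (G s)) t).

(* At the finitely many corners of G the value of contour_derivative is
   irrelevant to the integral. *)
Definition contour_integral G (F : R[i] -> R[i]) : R[i] :=
  let h t := F (G t) * contour_derivative G t in
  (\int[lebesgue_measure]_(t in `[0%R, 1%R]) complex.Re (h t))
  +i* (\int[lebesgue_measure]_(t in `[0%R, 1%R]) complex.Im (h t)).

Definition two_pi_i : R[i] := 0 +i* (2 * pi).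

(* G avoids p and has winding number 1 around it.  For a simple closed G this
   says that p is in the interior and that G is oriented counter-clockwise. *)
Definition winds_once_around G (p : R[i]) : Prop :=
  (forall t : R, t \in `[0, 1] -> G t != p) /\
  two_pi_i^-1 * contour_integral G (fun z => (z - p)^-1) = 1.

(* f_l for the map z |-> z + \sum_j a_j / (z - b_j) *)
Definition fourier_coef G m (a b : 'I_m -> R) (f : {poly R}) (l : int) : R[i] :=
  two_pi_i^-1 * contour_integral G (fun z =>
    (map_poly (fun r : R => r%:C) f).[z + \sum_(j < m) (a j)%:C / (z - (b j)%:C)]
    / z ^ (l + 1)).

End Contours.

Section Convergence.
Context {R : realType}.

(* N(0, s2).  The library's normal_prob is parametrized by the standard
   deviation and is not the point mass when the latter is 0. *)
Definition centered_normal (s2 : R) : probability (measurableTypeR R) R :=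
  if s2 == 0 then (\d_(0 : measurableTypeR R) : probability _ R)
  else (normal_prob 0 (Num.sqrt s2) : probability _ R).

Definition cvg_in_distribution (d : nat -> measure_display)
    (T : forall n, measurableType (d n)) (P : forall n, probability (T n) R)
    (Y : forall n, T n -> R) (L : probability (measurableTypeR R) R) : Prop :=
  forall g : R -> R, continuous g -> (exists M : R, forall x : R, `|g x| <= M) ->
    'E_(P n)[fun omega => g (Y n omega)]%E @[n --> \oo]
      --> (\int[L]_x (g x)%:E)%E.

End Convergence.

(* Main.v *)
Require Import Defs.
From HB Require Import structures.
From mathcomp Require Import all_boot all_order all_algebra all_fingroup.
From mathcomp Require Import all_classical all_reals all_analysis.
From mathcomp Require Import measurable_realfun ring lra zify.
Set Implicit Arguments.
Unset Strict Implicit.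
Unset Printing Implicit Defensive.
Import Order.TTheory GRing.Theory Num.Theory numFieldNormedType.Exports.
Local Open Scope classical_set_scope.
Local Open Scope ring_scope.

Section EqModX.
Context {R : comNzRingType}.
Implicit Types p q r : {poly R}.

Definition eqmodX (K : nat) p q := forall i, (i < K)%N -> p`_i = q`_i.

Lemma eqmodX_refl K p : eqmodX K p p. Proof. by []. Qed.

Lemma eqmodX_sym K p q : eqmodX K p q -> eqmodX K q p.
Proof. by move=> h i iK; rewrite h. Qed.

Lemma eqmodX_trans K q p r : eqmodX K p q -> eqmodX K q r -> eqmodX K p r.
Proof. by move=> h1 h2 i iK; rewrite h1// h2. Qed.

Lemma eqmodXD K p p' q q' :
  eqmodX K p p' -> eqmodX K q q' -> eqmodX K (p + q) (p' + q').
Proof. by move=> h1 h2 i iK; rewrite !coefD h1// h2. Qed.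

Lemma eqmodXZ K c p q : eqmodX K p q -> eqmodX K (c *: p) (c *: q).
Proof. by move=> h i iK; rewrite !coefZ h. Qed.

Lemma eqmodXM K p p' q q' :
  eqmodX K p p' -> eqmodX K q q' -> eqmodX K (p * q) (p' * q').
Proof.
move=> h1 h2 i iK; rewrite !coefM; apply: eq_bigr => j _.
by rewrite h1 ?h2 //; have := ltn_ord j; lia.
Qed.

Lemma eqmodX_exp K p q k : eqmodX K p q -> eqmodX K (p ^+ k) (q ^+ k).
Proof.
by move=> h; elim: k => [|k IH]; rewrite ?expr0 // !exprS; apply: eqmodXM.
Qed.

Lemma eqmodX_sum K I (s : seq I) (P : pred I) (F G : I -> {poly R}) :
  (forall i, P i -> eqmodX K (F i) (G i)) ->
  eqmodX K (\sum_(i <- s | P i) F i) (\sum_(i <- s | P i) G i).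
Proof.
move=> h; apply: (big_ind2 (eqmodX K)) => //.
by move=> *; apply: eqmodXD.
Qed.

Lemma eqmodXn K p : eqmodX K (p * 'X^K) 0.
Proof. by move=> i iK; rewrite coefMXn iK coef0. Qed.

End EqModX.

Section Jacobi.
Context {R : comNzRingType}.

Lemma deriv_prod (I : finType) (f : I -> {poly R}) :
  (\prod_i f i)^`() = \sum_i (f i)^`() * \prod_(j | j != i) f j.
Proof.
suff h (s : seq I) : uniq s -> (\prod_(i <- s) f i)^`()
    = \sum_(i <- s) (f i)^`() * \prod_(j <- s | j != i) f j.
  by rewrite h ?index_enum_uniq.
elim: s => [|a s IH] /=; first by rewrite !big_nil derivC.
case/andP=> nas us; rewrite !big_cons derivM IH// eqxx; congr (_ * _ + _).
  rewrite big_seq [RHS]big_seq_cond; apply: eq_bigl => i.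
  by case: (boolP (i \in s)) => //= hi; case: eqP nas => // <-; rewrite hi.
rewrite mulr_sumr big_seq [RHS]big_seq; apply: eq_bigr => i hi.
have nai : a != i by apply: contraNneq nas => ->.
by rewrite big_cons nai mulrCA.
Qed.

(** Jacobi's formula, from the Leibniz expansion: differentiating row [i] of
    the determinant and expanding along it gives the cofactors of that row. *)
Lemma deriv_det n (M : 'M[{poly R}]_n) :
  (\det M)^`() = \tr (\adj M *m map_mx (@deriv R) M).
Proof.
pose Mi i := \matrix_(k, l) (if k == i then (M k l)^`() else M k l).
have -> : (\det M)^`() = \sum_i \det (Mi i).
  rewrite /determinant exchange_big raddf_sum /=; apply: eq_bigr => s _.
  rewrite -mulr_sumr -signr_odd; case: (odd _); rewrite ?expr0 ?expr1;
    rewrite ?mul1r ?mulN1r ?derivN deriv_prod; [congr (- _)|];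
    apply: eq_bigr => i _; rewrite [RHS](bigD1 i)//= mxE eqxx; congr (_ * _);
    by apply: eq_bigr => j /negPf ji; rewrite mxE ji.
rewrite mxtrace_mulC; apply: eq_bigr => i _.
rewrite (expand_det_row _ i) mxE; apply: eq_bigr => j _.
rewrite !mxE eqxx; congr (_ * _); rewrite /cofactor; congr (_ * \det _).
apply/matrixP => k l; rewrite !mxE eq_sym (negPf (neq_lift _ _)) //.
Qed.

End Jacobi.

Section CumulantRecursion.
Context {R : comNzRingType}.

Lemma conv_solve n (M U : nat -> nat -> nat -> R) (K : nat) :
  exists W : nat -> nat -> nat -> R, forall k b p, (k < K)%N ->
    W k b p = U k b p - \sum_(t < k) \sum_(c < n) M t.+1 b c * W (k - t.+1)%N c p.
Proof.
elim: K => [|K [W IH]]; first by exists (fun _ _ _ => 0).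
exists (fun k b p => if k == K
  then U K b p - \sum_(t < K) \sum_(c < n) M t.+1 b c * W (K - t.+1)%N c p
  else W k b p) => k b p.
rewrite ltnS leq_eqVlt => /orP [/eqP ->|kK].
  rewrite eqxx; congr (_ - _); apply: eq_bigr => t _; apply: eq_bigr => c _.
  by rewrite ifN //; apply/eqP; have := ltn_ord t; lia.
rewrite ifN; last by apply/eqP; lia.
rewrite IH //; congr (_ - _); apply: eq_bigr => t _; apply: eq_bigr => c _.
by rewrite ifN //; apply/eqP; lia.
Qed.

Definition mxgen m n K (M : nat -> 'M[R]_(m, n)) : 'M[{poly R}]_(m, n) :=
  \matrix_(i, j) \poly_(k < K) M k i j.

Lemma coef_mxgen m n K (M : nat -> 'M[R]_(m, n)) i j k :
  (mxgen K M i j)`_k = if (k < K)%N then M k i j else 0.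
Proof. by rewrite mxE coef_poly. Qed.

Lemma coef_tr_mulmx m n (A : 'M[{poly R}]_(m, n)) (B : 'M[{poly R}]_(n, m))
    (C : 'M[{poly R}]_(m, n)) (D : 'M[{poly R}]_(n, m)) K :
  (forall i j, eqmodX K (A i j) (C i j)) -> (forall i j, eqmodX K (B i j) (D i j)) ->
  eqmodX K (\tr (A *m B)) (\tr (C *m D)).
Proof.
move=> hA hB; apply: eqmodX_sum => i _; rewrite !mxE.
by apply: eqmodX_sum => j _; apply: eqmodXM.
Qed.

Lemma coef_mul_mxgen m n p K (A : nat -> 'M[R]_(m, n)) (B : nat -> 'M[R]_(n, p)) i j k :
  (k < K)%N -> ((mxgen K A *m mxgen K B) i j)`_k =
  (\sum_(t < k.+1) A t *m B (k - t)%N) i j.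
Proof.
move=> kK; rewrite mxE coef_sum summxE.
under eq_bigr do rewrite coefM.
rewrite exchange_big; apply: eq_bigr => t _ /=; rewrite mxE; apply: eq_bigr => l _.
by rewrite !coef_mxgen !ifT //; have := ltn_ord t; lia.
Qed.

(** Logarithmic derivative of the determinant of a generating series [M] of
    compressions of the powers of an operator.  By Jacobi's formula it is the
    trace of [M^-1 M']; the relation between [M'] and [M M 1] has the defect
    [U H] of the excursions out of the range of the compression, and
    [W = M^-1 U]. *)
Lemma det_mxgen_rec n q K (M : nat -> 'M[R]_n) (U W : nat -> 'M[R]_(n, q))
    (H : 'M[R]_(q, n)) :
  (forall k, (k < K)%N -> M k.+1 *+ k.+1 = M k *m M 1%N + U k *m H) ->
  (forall k, (k < K)%N -> \sum_(t < k.+1) M t *m W (k - t)%N = U k) ->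
  let D := \det (mxgen K.+1 M) in
  forall k, (k < K)%N ->
  D`_k.+1 *+ k.+1 = D`_k * \tr (M 1%N)
                  + \sum_(i < k.+1) D`_i * \tr (W (k - i)%N *m H).
Proof.
move=> hM hW D k kK; rewrite -coef_deriv deriv_det.
pose P := mxgen K.+1 M.
pose cM1 : 'M[{poly R}]_n := map_mx (@polyC R) (M 1%N).
pose cH : 'M[{poly R}]_(q, n) := map_mx (@polyC R) H.
have e1 : eqmodX K (\tr (\adj P *m map_mx (@deriv R) P))
                   (\tr (\adj P *m (P *m (cM1 + mxgen K.+1 W *m cH)))).
  apply: coef_tr_mulmx => // i j l lK; rewrite mxE coef_deriv coef_mxgen ltnS lK.
  have := congr1 (fun A : 'M[R]_n => A i j) (hM _ lK); rewrite mulmxnE => ->.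
  rewrite mulmxDr mulmxA !mxE coefD !coef_sum; congr (_ + _).
    apply: eq_bigr => a _; rewrite /cM1 !mxE coefMC coef_poly ifT //.
    by rewrite ltnS ltnW.
  apply: eq_bigr => a _; rewrite [cH _ _]mxE coefMC coef_mul_mxgen ?hW //.
  by rewrite ltnS ltnW.
rewrite (e1 _ kK) mulmxA mul_adj_mx mul_scalar_mx mxtraceZ mxtraceD mulrDr coefD.
congr (_ + _).
  rewrite (_ : \tr cM1 = (\tr (M 1%N))%:P) ?coefMC //.
  by rewrite /mxtrace rmorph_sum /=; apply: eq_bigr => i _; rewrite mxE.
rewrite coefM; apply: eq_bigr => i _; congr (_ * _).
rewrite /mxtrace coef_sum; apply: eq_bigr => a _; rewrite !mxE coef_sum.
apply: eq_bigr => b _; rewrite /cH !mxE coefMC coef_poly ifT //.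
by have := ltn_ord i; lia.
Qed.

End CumulantRecursion.

Lemma cvg_sumr (R : realType) (I : Type) (s : seq I) (P : pred I)
    (F : I -> nat -> R) (l : I -> R) :
  (forall i, P i -> F i n @[n --> \oo] --> l i) ->
  \sum_(i <- s | P i) F i n @[n --> \oo] --> \sum_(i <- s | P i) l i.
Proof. by move=> h; apply: cvg_big => //; apply: add_continuous. Qed.

Lemma cvg_eq_near (R : realType) (u v : nat -> R) (l : R) (N : nat) :
  (forall n, (N <= n)%N -> v n = u n) -> u n @[n --> \oo] --> l ->
  v n @[n --> \oo] --> l.
Proof.
move=> h; apply: cvg_trans; apply: near_eq_cvg.
by exists N => // n /= /h.
Qed.

Section LocalLimits.
Context {R : realType}.
Implicit Types A B : nat -> nat -> nat -> R.

Definition banded (D : nat) (A : nat -> nat -> R) :=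
  forall b a, (b + D < a)%N -> A b a = 0.

Definition imul (D : nat) (A B : nat -> nat -> R) b a : R :=
  \sum_(c < (b + D).+1) A b c * B c a.

Definition loclim (L : nat) A (D : nat) (P : {poly R}) :=
  forall d, (d < L)%N -> forall J j, (d <= j + D)%N ->
    A n (n - J + j)%N (n - J + (j + D - d))%N @[n --> \oo] --> P`_d.

Lemma imul_banded D1 D2 (A B : nat -> nat -> R) : banded D1 A -> banded D2 B ->
  banded (D1 + D2) (imul D1 A B).
Proof.
move=> hA hB b a h; rewrite /imul big1 // => c _.
by rewrite (hB c) ?mulr0//; have := ltn_ord c; lia.
Qed.

Lemma loclim_mul L D1 D2 A B P Q : (forall n, banded D2 (B n)) ->
  loclim L A D1 P -> loclim L B D2 Q ->
  loclim L (fun n => imul D1 (A n) (B n)) (D1 + D2) (P * Q).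
Proof.
move=> bB hA hB d dL J j dj; rewrite coefM.
pose A' e n := A n (n - (J + d) + (j + d))%N (n - (J + d) + (j + d + D1 - e))%N.
pose B' e n := B n (n - (J + d) + (j + d + D1 - e))%N
                   (n - (J + d) + ((j + d + D1 - e) + D2 - (d - e)))%N.
apply: (@cvg_eq_near _ (fun n => \sum_(e < d.+1) A' e n * B' e n) _ _ (J + d)%N).
  move=> n hn; rewrite /imul.
  rewrite (reindex_inj rev_ord_inj) /=.
  have -> : \sum_(e < d.+1) A' e n * B' e n
     = \sum_(e < (n - J + j + D1).+1 | (e < d.+1)%N) A' e n * B' e n.
    by rewrite (big_ord_widen (n - J + j + D1).+1 (fun e => A' e n * B' e n)) //; lia.
  rewrite big_mkcond [RHS]big_mkcond /=; apply: eq_bigr => e _.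
  have := ltn_ord e => elt.
  case: ifP => ed; last by rewrite (bB n) ?mulr0 //; lia.
  rewrite /A' /B'; congr (A n _ _ * B n _ _); lia.
apply: cvg_sumr => e _; have elt := ltn_ord e.
apply: cvgM.
  by apply: hA; lia.
by apply: hB; lia.
Qed.

Lemma loclimD L D A B P Q : loclim L A D P -> loclim L B D Q ->
  loclim L (fun n b a => A n b a + B n b a) D (P + Q).
Proof.
move=> hA hB d dL J j dj; rewrite coefD.
by apply: cvgD; [apply: hA | apply: hB].
Qed.

Lemma loclimZ L D A P x : loclim L A D P ->
  loclim L (fun n b a => x * A n b a) D (x *: P).
Proof.
move=> hA d dL J j dj; rewrite coefZ.
by apply: cvgMr; apply: hA.
Qed.

Lemma loclim_shift L D k A P : (forall n, banded D (A n)) -> loclim L A D P ->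
  loclim L A (D + k) (P * 'X^k).
Proof.
move=> bA hA d dL J j dj; rewrite coefMXn; case: ifP => dk.
  apply: (@cvg_eq_near _ (fun=> 0) _ _ J) => [n hn|]; last exact: cvg_cst.
  by rewrite bA //; lia.
have -> : (j + (D + k) - d)%N = (j + D - (d - k))%N by lia.
by apply: hA; lia.
Qed.

Lemma loclim_sum L D I (s : seq I) (A : I -> nat -> nat -> nat -> R)
    (P : I -> {poly R}) : (forall i, loclim L (A i) D (P i)) ->
  loclim L (fun n b a => \sum_(i <- s) A i n b a) D (\sum_(i <- s) P i).
Proof.
move=> hA d dL J j dj; rewrite coef_sum; apply: cvg_sumr => i _.
exact: hA.
Qed.

Fixpoint ipow (D : nat) (A : nat -> nat -> R) k : nat -> nat -> R :=
  if k is k'.+1 then imul (k' * D) (ipow D A k') A else fun b a => (b == a)%:R.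

Lemma ipow_banded D (A : nat -> nat -> R) k : banded D A -> banded (k * D) (ipow D A k).
Proof.
move=> hA; elim: k => [|k IH] /=.
  by move=> b a h; case: eqP => //; lia.
by rewrite mulSn addnC; apply: imul_banded.
Qed.

Lemma loclim_id L : loclim L (fun n b a => (b == a)%:R) 0 1.
Proof.
move=> d dL J j dj; rewrite coef1.
apply: (@cvg_eq_near _ (fun=> (d == 0%N)%:R) _ _ J) => [n hn|]; last exact: cvg_cst.
by congr (_%:R); congr nat_of_bool; apply/eqP/eqP; lia.
Qed.

Lemma loclim_pow L D A P k : (forall n, banded D (A n)) -> loclim L A D P ->
  loclim L (fun n => ipow D (A n) k) (k * D) (P ^+ k).
Proof.
move=> bA hA; elim: k => [|k IH] /=; first by rewrite expr0; apply: loclim_id.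
by rewrite mulSn addnC exprSr; apply: loclim_mul.
Qed.

End LocalLimits.

Section TriangularSums.
Context {V : nmodType}.

Lemma sum_triangle X (g : nat -> nat -> V) :
  (forall l y, (X <= l + y)%N -> g l y = 0) ->
  \sum_(x < X) \sum_(l < x.+1) g l (x - l)%N = \sum_(l < X) \sum_(y < X) g l y.
Proof.
move=> h.
have -> : \sum_(x < X) \sum_(l < x.+1) g l (x - l)%N
        = \sum_(x < X) \sum_(l < X | (l < x.+1)%N) g l (x - l)%N.
  by apply: eq_bigr => x _; rewrite (big_ord_widen X (fun l => g l (x - l)%N)).
rewrite (exchange_big_dep xpredT) //=; apply: eq_bigr => l _.
rewrite -(big_mkord (fun x => (l < x.+1)%N) (fun x => g l (x - l)%N)).
rewrite -(big_mkord xpredT (g l)) (@big_cat_nat _ _ _ l 0 X) //=; last exact: ltnW.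
rewrite big_nat_cond big1 ?add0r => [|x]; last by lia.
rewrite -{1}[val l]add0n big_addn (@big_cat_nat _ _ _ (X - l) 0 X) //=; last by lia.
rewrite [X in _ + X]big_nat_cond [X in _ + X]big1 ?addr0; last first.
  by move=> y hy; rewrite h //; lia.
by rewrite big_mkcond /=; apply: eq_bigr => y _; rewrite addnK ifT //; lia.
Qed.

Lemma sum_antidiagonals k (h : nat -> nat -> nat -> V) :
  \sum_(t < k.+1) \sum_(j < (k - t).+1) h t j (k - t - j)%N
  = \sum_(r < k.+1) \sum_(t < (k - r).+1) h t (k - r - t)%N r.
Proof.
have e (t : 'I_k.+1) : \sum_(j < (k - t).+1) h t j (k - t - j)%N
    = \sum_(r < k.+1 | (r < (k - t).+1)%N) h t (k - r - t)%N r.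
  rewrite (reindex_inj rev_ord_inj) /=.
  rewrite -(big_ord_widen k.+1 (fun r => h t (k - r - t)%N r)); last by lia.
  by apply: eq_bigr => j _; have := ltn_ord j => ?; congr h; lia.
under eq_bigr do rewrite e.
rewrite (exchange_big_dep xpredT) //=; apply: eq_bigr => r _.
rewrite (big_ord_widen k.+1 (fun t => h t (k - r - t)%N r)); last by lia.
by apply: eq_bigl => t; have := ltn_ord t; have := ltn_ord r; lia.
Qed.

End TriangularSums.

Section ReversedCoefficients.
Context {R : comNzRingType}.
Implicit Types P Q : {poly R}.

(** The coefficient of [z ^ i] in [z ^ m * Q (1 / z)]. *)
Definition lcoef Q m i : R := if (i <= m)%N then Q`_(m - i) else 0.

Lemma lcoefD P Q m i : lcoef (P + Q) m i = lcoef P m i + lcoef Q m i.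
Proof. by rewrite /lcoef; case: ifP; rewrite ?coefD ?addr0. Qed.

Lemma lcoefZ c P m i : lcoef (c *: P) m i = c * lcoef P m i.
Proof. by rewrite /lcoef; case: ifP; rewrite ?coefZ ?mulr0. Qed.

Lemma lcoef0 m i : lcoef 0 m i = 0.
Proof. by rewrite /lcoef coef0 if_same. Qed.

Lemma lcoef_sum I (s : seq I) (F : I -> {poly R}) m i :
  lcoef (\sum_(j <- s) F j) m i = \sum_(j <- s) lcoef (F j) m i.
Proof.
by elim: s => [|a s IH]; rewrite ?big_nil ?lcoef0// !big_cons lcoefD IH.
Qed.

Lemma lcoefMXn Q a m i : lcoef (Q * 'X^a) (m + a) i = lcoef Q m i.
Proof.
rewrite /lcoef; case: leqP => h; last by rewrite ifN //; lia.
rewrite coefMXn; case: ifP => h2; first by rewrite ifN //; lia.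
by rewrite ifT; [congr (Q`_ _); lia | lia].
Qed.

Lemma lcoef_conv P Q N Z c i : (size P <= N.+1)%N -> (N < Z)%N ->
  \sum_(l < Z) lcoef P N l * lcoef Q (l + c) i = lcoef (P * Q) (N + c) i.
Proof.
move=> sP NZ.
have -> : \sum_(l < Z) lcoef P N l * lcoef Q (l + c) i
    = \sum_(e < N.+1) P`_e * lcoef Q (N - e + c) i.
  transitivity (\sum_(l < N.+1) lcoef P N l * lcoef Q (l + c) i).
    rewrite [RHS](big_ord_widen Z (fun l => lcoef P N l * lcoef Q (l + c) i)) //.
    rewrite [RHS]big_mkcond /=; apply: eq_bigr => l _.
    by rewrite /lcoef ltnS; case: ifP; rewrite ?mul0r.
  rewrite [RHS](reindex_inj rev_ord_inj) /=; apply: eq_bigr => l _.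
  have lN := ltn_ord l; rewrite [lcoef P N l]/lcoef -ltnS lN.
  by congr (P`_ _ * lcoef _ _ _); lia.
rewrite [RHS]/lcoef; case: ifP => hi; last first.
  rewrite big1 // => e _; have := ltn_ord e => eN.
  by rewrite /lcoef ifN ?mulr0 //; lia.
rewrite coefM.
have -> : \sum_(e < N.+1) P`_e * lcoef Q (N - e + c) i
        = \sum_(e < (N + c).+1) P`_e * lcoef Q (N + c - e) i.
  rewrite (big_ord_widen (N + c).+1 (fun e => P`_e * lcoef Q (N - e + c) i)); last by lia.
  rewrite big_mkcond /=; apply: eq_bigr => e _; case: ifP => eN.
    by congr (_ * lcoef _ _ _); lia.
  by rewrite nth_default ?mul0r // (leq_trans sP) //; lia.
have -> : \sum_(e < (N + c).+1) P`_e * lcoef Q (N + c - e) i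
  = \sum_(e < (N + c).+1 | (e < (N + c - i).+1)%N) P`_e * Q`_(N + c - i - e).
  rewrite [RHS]big_mkcond /=; apply: eq_bigr => e _; have := ltn_ord e => eN.
  rewrite /lcoef; case: ifP => h; last by rewrite ifN ?mulr0 //; lia.
  by rewrite ifT; [congr (_ * _`_ _); lia | lia].
by rewrite -(big_ord_widen _ (fun e => P`_e * Q`_(N + c - i - e))) //; lia.
Qed.

Definition polyrev N P := \poly_(m < N.+1) lcoef P N m.

Lemma coef_polyrev N P m : (polyrev N P)`_m = lcoef P N m.
Proof.
by rewrite coef_poly /lcoef ltnS; case: (m <= N)%N.
Qed.

Lemma polyrevM N M P Q : (size P <= N.+1)%N -> (size Q <= M.+1)%N ->
  polyrev (N + M) (P * Q) = polyrev N P * polyrev M Q.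
Proof.
move=> sP sQ; apply/polyP => i; rewrite coef_polyrev coefM.
rewrite -(@lcoef_conv P Q N (N + i).+1) //; last by lia.
transitivity (\sum_(l < i.+1) lcoef P N l * lcoef Q (l + M) i); last first.
  apply: eq_bigr => l _; rewrite !coef_polyrev; congr (_ * _); rewrite /lcoef; have := ltn_ord l => li.
  case: leqP => h; first by rewrite ifT; [congr (Q`_ _); lia | lia].
  by rewrite ifN //; lia.
rewrite [RHS](big_ord_widen (N + i).+1 (fun l => lcoef P N l * lcoef Q (l + M) i)); last by lia.
rewrite [RHS]big_mkcond /=; apply: eq_bigr => l _; case: ifP => li //.
rewrite [X in _ * X]/lcoef; case: ifP => h; last by rewrite mulr0.
by rewrite [X in _ * X]nth_default ?mulr0 // (leq_trans sQ) //; lia.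
Qed.

Lemma polyrev1 : polyrev 0 1 = 1.
Proof.
apply/polyP => i; rewrite coef_polyrev /lcoef leqn0 !coef1.
by case: eqP => [->|].
Qed.

Lemma size_exp_le P N k : (size P <= N.+1)%N -> (size (P ^+ k) <= (k * N).+1)%N.
Proof.
move=> h; elim: k => [|k IH]; first by rewrite expr0 size_poly1.
rewrite exprS (leq_trans (size_polyMleq _ _)) //.
have : (size P + size (P ^+ k) <= N.+1 + (k * N).+1)%N by rewrite leq_add.
by rewrite mulSn; lia.
Qed.

Lemma polyrevX N P k : (size P <= N.+1)%N ->
  polyrev (k * N) (P ^+ k) = polyrev N P ^+ k.
Proof.
move=> h; elim: k => [|k IH]; first by rewrite !expr0 mul0n polyrev1.
by rewrite !exprS mulSn polyrevM ?IH // size_exp_le.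
Qed.

End ReversedCoefficients.

Section SymbolCumulants.
Context {R : numFieldType} (Phi : {poly R}) (D : nat).

Definition pos_part := take_poly D Phi.
Definition neg_part := drop_poly D Phi.

Definition th k x i : R := lcoef (Phi ^+ k) (x + k * D) i / k`!%:R.
Definition ep j m : R := lcoef (pos_part ^+ j) (j * D) m / j`!%:R.
Definition wl k x p : R :=
  \sum_(j < k.+1) \sum_(l < x.+1)
    (-1) ^+ j * ep j l * ep (k - j) (p + (x - l).+1).

Lemma size_pos_part : (size pos_part <= D)%N.
Proof. exact: size_take_poly. Qed.

Lemma ep_eq0 j m : (j * D < m)%N -> ep j m = 0.
Proof. by move=> h; rewrite /ep /lcoef ifN ?mul0r // -ltnNge. Qed.

Lemma fact_neq0 k : k`!%:R != 0 :> R.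
Proof. by rewrite pnatr_eq0 -lt0n fact_gt0. Qed.

Lemma invf_fact_bin k j : (j <= k)%N ->
  'C(k, j)%:R / k`!%:R = (j`!%:R)^-1 * ((k - j)`!%:R)^-1 :> R.
Proof.
move=> jk; rewrite -(bin_fact jk) !natrM.
have h : 'C(k, j)%:R != 0 :> R by rewrite pnatr_eq0 -lt0n bin_gt0.
by field; rewrite h !fact_neq0.
Qed.

Lemma pos_neg_part : Phi = pos_part + neg_part * 'X^D.
Proof. by rewrite poly_take_drop. Qed.

Lemma exp_neg_conv q y i Z : (q * D < Z)%N ->
  \sum_(t < q.+1) \sum_(l < Z) (-1) ^+ (q - t) * ep (q - t) l * th t (l + y) i
  = lcoef (neg_part ^+ q) y i / q`!%:R.
Proof.
move=> hZ.
have e (t : 'I_q.+1) :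
   \sum_(l < Z) (-1) ^+ (q - t) * ep (q - t) l * th t (l + y) i =
   lcoef (((- pos_part) ^+ (q - t) * Phi ^+ t) *+ 'C(q, t)) (y + q * D) i / q`!%:R.
  have tq : (t <= q)%N by have := ltn_ord t; lia.
  rewrite -[_ *+ 'C(_, _)]scaler_nat lcoefZ mulrAC invf_fact_bin // (exprNn pos_part) -!mulrA.
  rewrite (_ : (-1 : {poly R}) ^+ (q - t) = ((-1) ^+ (q - t))%:P); last by rewrite polyC_exp polyCN.
  rewrite mul_polyC lcoefZ.
  have -> : (y + q * D = (q - t) * D + (y + t * D))%N.
    by rewrite mulnBl; have := leq_mul tq (leqnn D); lia.
  rewrite -(@lcoef_conv _ _ _ _ Z); last 2 first.
  - by apply: size_exp_le; rewrite (leq_trans size_pos_part).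
  - rewrite (leq_ltn_trans _ hZ) // leq_mul2r leq_subr orbT //.
  rewrite !mulr_sumr; apply: eq_bigr => l _; rewrite /ep /th addnA; ring.
under eq_bigr do rewrite e.
rewrite -mulr_suml -lcoef_sum -exprDn pos_neg_part addKr exprMn -exprM.
by rewrite (mulnC D) lcoefMXn.
Qed.

Lemma wl_conv k i p X : (k * D < X)%N ->
  \sum_(t < k.+1) \sum_(x < X) th t x i * wl (k - t) x p = th k 0 (p + i.+1).
Proof.
move=> hX.
pose h y l t j r := (-1) ^+ j * ep j l * th t (l + y) i * ep r (p + y.+1).
have e1 (t : 'I_k.+1) : \sum_(x < X) th t x i * wl (k - t) x p
    = \sum_(j < (k - t).+1) \sum_(y < X) \sum_(l < X) h y l t j (k - t - j)%N.
  under eq_bigr do rewrite mulr_sumr.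
  rewrite exchange_big; apply: eq_bigr => j _ /=.
  rewrite exchange_big /= -(@sum_triangle _ X (fun l y => h y l t j (k - t - j)%N)).
    apply: eq_bigr => x _; rewrite mulr_sumr; apply: eq_bigr => l _.
    by rewrite /h subnKC; [ring | have := ltn_ord l; lia].
  move=> l y hly; rewrite /h.
  case: (ltnP (j * D) l) => h1; first by rewrite (ep_eq0 h1) mulr0 !mul0r.
  rewrite [X in _ * X]ep_eq0 ?mulr0 //.
  have := ltn_ord j; have := ltn_ord t => h2 h3.
  have : (j * D + (k - t - j) * D <= k * D)%N.
    by rewrite -mulnDl leq_mul2r; apply/orP; right; lia.
  by lia.
under eq_bigr do rewrite e1.
rewrite (sum_antidiagonals k (fun t j r => \sum_(y < X) \sum_(l < X) h y l t j r)).
have e2 (r : 'I_k.+1) :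
   \sum_(t < (k - r).+1) \sum_(y < X) \sum_(l < X) h y l t (k - r - t)%N r
   = \sum_(y < X) ep r (p + y.+1) * (lcoef (neg_part ^+ (k - r)) y i / (k - r)`!%:R).
  rewrite exchange_big; apply: eq_bigr => y _ /=.
  rewrite -(@exp_neg_conv (k - r) y i X); last first.
    by rewrite (leq_ltn_trans _ hX) // leq_mul2r leq_subr orbT.
  rewrite mulr_sumr; apply: eq_bigr => t _.
  by rewrite mulr_sumr; apply: eq_bigr => l _; rewrite /h; ring.
under eq_bigr do rewrite e2.
rewrite /th [in RHS]pos_neg_part exprDn lcoef_sum mulr_suml.
rewrite [RHS](reindex_inj rev_ord_inj) /=; apply: eq_bigr => r _.
have rk : (r <= k)%N by have := ltn_ord r; lia.
have -> : (k - (k.+1 - r.+1) = r)%N by lia.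
have -> : (k.+1 - r.+1 = k - r)%N by lia.
rewrite -[_ *+ 'C(_, _)]scaler_nat lcoefZ mulrAC invf_fact_bin ?leq_subr // subKn //.
rewrite exprMn -exprM (mulnC D) mulrA add0n.
have -> : (k * D = r * D + (k - r) * D)%N by rewrite -mulnDl subnKC.
rewrite lcoefMXn -[(r * D)%N in RHS]addn0 -(@lcoef_conv _ _ _ _ (p.+1 + X)); last 2 first.
- by apply: size_exp_le; rewrite (leq_trans size_pos_part).
- rewrite (leq_trans (leq_ltn_trans _ hX)) ?leq_addl // leq_mul2r rk orbT //.
rewrite big_split_ord /= [X in _ = _ * (X + _)]big1 ?add0r => [|l _]; last first.
  by rewrite [X in _ * X]/lcoef ifN ?mulr0 //; have := ltn_ord l; lia.
rewrite mulr_sumr; apply: eq_bigr => y _; rewrite /ep addn0 addSnnS.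
have -> : lcoef (neg_part ^+ (k - r)) (p + y.+1) (p + i.+1)
        = lcoef (neg_part ^+ (k - r)) y i.
  rewrite /lcoef; case: leqP => h1; last by rewrite ifN //; lia.
  by rewrite ifT; [congr (_`_ _); lia | lia].
ring.
Qed.

Lemma signed_binomial_sum k :
  \sum_(j < k.+1) (-1) ^+ j * (j`!%:R)^-1 * ((k - j)`!%:R)^-1 = (k == 0%N)%:R :> R.
Proof.
have := exprDn (1 : R) (-1) k; rewrite subrr expr0n => /(congr1 (fun z => z / k`!%:R)).
rewrite mulr_suml => e; transitivity ((k == 0%N)%:R / k`!%:R : R); last first.
  by case: k {e} => [|k] /=; rewrite ?mul0r // fact0 invr1 mulr1.
rewrite e; apply: eq_bigr => j _; rewrite expr1n mul1r -[_ *+ 'C(k, j)]mulr_natl [RHS]mulrAC.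
by rewrite invf_fact_bin ?mulrA; [ring | have := ltn_ord j; lia].
Qed.

Lemma sum_diagonals X (G : nat -> R) : (forall m, (X <= m)%N -> G m = 0) ->
  \sum_(p < X) \sum_(y < X) G (p + y.+1)%N = \sum_(m < X) m%:R * G m.
Proof.
move=> h; rewrite -(@sum_triangle _ X (fun l y => G (l + y.+1)%N)); last first.
  by move=> l y hly; apply: h; lia.
case: X h => [|X] h; first by rewrite !big_ord0.
rewrite [RHS]big_ord_recl mul0r add0r [LHS]big_ord_recr /=.
rewrite [X in _ + X]big1 ?addr0 => [|l _]; last by rewrite h //; have := ltn_ord l; lia.
apply: eq_bigr => x _; rewrite (eq_bigr (fun=> G x.+1)) => [|l _].
  by rewrite sumr_const card_ord mulr_natl.
by congr G; have := ltn_ord l; lia.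
Qed.

(** The exponential series of the positive part only enters through its
    logarithmic derivative, which is linear in the series variable: this is
    why all cumulants but the second one vanish. *)
Lemma trace_wl k X : (k * D < X)%N -> (D < X)%N ->
  \sum_(x < X) \sum_(p < X) Phi`_(D + (p + x).+1) * wl k x p
  = (k == 1%N)%:R * \sum_(s < D.+1) s%:R * Phi`_(D - s) * Phi`_(D + s).
Proof.
move=> kX DX; pose psi := polyrev D pos_part.
have spp := leq_trans size_pos_part (leqnSn D).
have epE j m : ep j m = (psi ^+ j)`_m / j`!%:R.
  by rewrite /ep /psi -polyrevX // coef_polyrev.
pose g s := Phi`_(D + s).
have step1 : \sum_(x < X) \sum_(p < X) Phi`_(D + (p + x).+1) * wl k x p
  = \sum_(j < k.+1) (-1) ^+ j *
      \sum_(l < X) \sum_(m < X) ep j l * (m%:R * ep (k - j) m) * g (l + m)%N.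
  transitivity (\sum_(j < k.+1) \sum_(x < X) \sum_(l < x.+1) \sum_(p < X)
     (-1) ^+ j * ep j l * ep (k - j) (p + (x - l).+1) * g (l + (p + (x - l).+1))%N).
    rewrite [RHS]exchange_big /=; apply: eq_bigr => x _.
    under eq_bigr do rewrite /wl mulr_sumr.
    rewrite exchange_big /=; apply: eq_bigr => j _.
    under eq_bigr do rewrite mulr_sumr.
    rewrite exchange_big /=; apply: eq_bigr => l _; apply: eq_bigr => p _.
    rewrite mulrC; congr (_ * Phi`_ _); have := ltn_ord l; lia.
  apply: eq_bigr => j _.
  rewrite (@sum_triangle _ X (fun l y => \sum_(p < X)
     (-1) ^+ j * ep j l * ep (k - j) (p + y.+1) * g (l + (p + y.+1))%N)); last first.
    move=> l y hly; rewrite big1 // => p _.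
    case: (ltnP (j * D) l) => h1; first by rewrite (ep_eq0 h1) mulr0 !mul0r.
    rewrite [ep (k - j) _]ep_eq0 ?mulr0 ?mul0r //; have := ltn_ord j => jk.
    have : (j * D + (k - j) * D <= k * D)%N.
    by rewrite -mulnDl leq_mul2r; apply/orP; right; lia.
    by lia.
  rewrite mulr_sumr; apply: eq_bigr => l _; rewrite exchange_big /=.
  rewrite (@sum_diagonals X (fun m => (-1) ^+ j * ep j l * ep (k - j) m * g (l + m)%N)).
    by rewrite mulr_sumr; apply: eq_bigr => m _; ring.
  move=> m hm; rewrite [ep (k - j) _]ep_eq0 ?mulr0 ?mul0r //.
  by rewrite (leq_trans _ hm) // (leq_ltn_trans _ kX) // leq_mul2r leq_subr orbT.
have step2 (j : 'I_k.+1) :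
    \sum_(l < X) \sum_(m < X) ep j l * (m%:R * ep (k - j) m) * g (l + m)%N
  = \sum_(s < X) ((psi ^+ j * ('X * (psi ^+ (k - j))^`()))`_s
       / (j`!%:R * (k - j)`!%:R)) * g s.
  rewrite -(@sum_triangle _ X (fun l m => ep j l * (m%:R * ep (k - j) m) * g (l + m)%N)).
    apply: eq_bigr => s _; rewrite coefM !mulr_suml; apply: eq_bigr => l _.
    have -> : ('X * (psi ^+ (k - j))^`())`_(s - l) = (s - l)%:R * (psi ^+ (k - j))`_(s - l).
      by rewrite coefXM; case: (s - l)%N => [|m] /=; rewrite ?mul0r // coef_deriv mulr_natl.
    rewrite !epE subnKC; last by have := ltn_ord l; lia.
    by field; rewrite !fact_neq0.
  move=> l m hlm; case: (ltnP (j * D) l) => h1; first by rewrite (ep_eq0 h1) !mul0r.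
  rewrite [ep (k - j) _]ep_eq0 ?mulr0 ?mul0r //; have := ltn_ord j => jk.
  have : (j * D + (k - j) * D <= k * D)%N.
    by rewrite -mulnDl leq_mul2r; apply/orP; right; lia.
  by lia.
rewrite step1; under eq_bigr do rewrite step2 mulr_sumr.
rewrite exchange_big /= (eq_bigr (fun s : 'I_X => (k == 1%N)%:R * (s%:R * psi`_s * g s))).
  rewrite -mulr_sumr; congr (_ * _).
  rewrite (big_ord_widen X (fun s => s%:R * Phi`_(D - s) * Phi`_(D + s))) //.
  rewrite [RHS]big_mkcond /=; apply: eq_bigr => s _; rewrite coef_polyrev /lcoef ltnS.
  case: ifP => sD; last by rewrite mulr0 mul0r.
  rewrite /pos_part coef_take_poly; case: (posnP s) => [->|s0]; first by rewrite !mul0r.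
  by rewrite ifT //; lia.
move=> s _; case: k {step1 kX} step2 => [|k] step2.
  by rewrite big_ord_recl big_ord0 /= expr0 derivC mulr0 mulr0 coef0 !mul0r mulr0 addr0.
rewrite big_ord_recr /= subnn expr0 derivC mulr0 mulr0 coef0 !mul0r mulr0 addr0.
have e (j : 'I_k.+1) : (-1) ^+ j *
   (((psi ^+ j * ('X * (psi ^+ (k.+1 - j))^`()))`_s / (j`!%:R * (k.+1 - j)`!%:R)) * g s)
   = (-1) ^+ j * (j`!%:R)^-1 * ((k - j)`!%:R)^-1 * (('X * psi^`() * psi ^+ k)`_s * g s).
  have jk : (j <= k)%N by have := ltn_ord j; lia.
  rewrite subSn // deriv_exp factS natrM.
  have -> : psi ^+ j * ('X * (psi^`() * psi ^+ (k - j).+1.-1 *+ (k - j).+1))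
    = ('X * psi^`() * psi ^+ k) *+ (k - j).+1.
    have -> : psi ^+ k = psi ^+ j * psi ^+ (k - j) by rewrite -exprD subnKC.
    by rewrite /= -!mulrnAr; ring.
  rewrite coefMn -mulr_natl; field.
  by rewrite !fact_neq0 nat1r pnatr_eq0.
under eq_bigr do rewrite e.
rewrite -mulr_suml signed_binomial_sum eqSS; case: eqP => [->|]; last by rewrite !mul0r.
rewrite expr0 mulr1 mul1r mul1r coefXM.
case: (nat_of_ord s) => [|s'] /=; first by rewrite !mul0r.
by rewrite coef_deriv mulr_natl.
Qed.

End SymbolCumulants.

Section CumulantLimit.
Context {R : realType}.

Lemma ipow1 D (A : nat -> nat -> R) b a : ipow D A 1 b a = A b a.
Proof.
rewrite /= /imul addn0 big_ord_recr /= eqxx mul1r big1 ?add0r // => c _.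
by rewrite (_ : (b == c) = false) ?mul0r //; apply/eqP; have := ltn_ord c; lia.
Qed.

Definition gauss_coef (s2 : R) k : R :=
  if odd k then 0 else (s2 / 2) ^+ k./2 / (k./2)`!%:R.

Lemma gauss_coefSS s2 k :
  gauss_coef s2 k.+2 = s2 * gauss_coef s2 k / k.+2%:R.
Proof.
rewrite /gauss_coef /= negbK; case: ifP => ok; first by rewrite mulr0 mul0r.
have ek : k = (k./2 * 2)%N by have := odd_double_half k; rewrite ok; lia.
rewrite factS exprS natrM.
have -> : k.+2%:R = (k./2).+1%:R * 2 :> R by rewrite -natrM; congr (_%:R); lia.
by field; rewrite nat1r !pnatr_eq0 -!lt0n !fact_gt0.
Qed.

Definition power_mx n D (A : nat -> nat -> R) k : 'M[R]_n :=
  \matrix_(b, a) (ipow D A k b a / k`!%:R).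

Definition centered_coef (P : {poly R}) k : R :=
  \sum_(i < k.+1) P`_i * ((- P`_1) ^+ (k - i) / (k - i)`!%:R).

Lemma fps_centered_rec (P T : {poly R}) K : P`_0 = 1 ->
  (forall k, (k < K)%N ->
     P`_k.+1 *+ k.+1 = P`_k * P`_1 + \sum_(i < k.+1) P`_i * T`_(k - i)) ->
  forall k, (k < K)%N ->
  centered_coef P k.+1 *+ k.+1 = \sum_(i < k.+1) centered_coef P i * T`_(k - i).
Proof.
move=> P0 h k kK; pose e := P`_1.
pose E := \poly_(i < K.+1) ((- e) ^+ i / i`!%:R).
have cE i : (i <= K)%N -> centered_coef P i = (P * E)`_i.
  move=> iK; rewrite coefM; apply: eq_bigr => j _.
  by rewrite coef_poly ifT //; lia.
have hP : eqmodX K P^`() (P * (e%:P + T)).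
  move=> i iK; rewrite coef_deriv h // mulrDr coefD coefMC; congr (_ + _).
  by rewrite coefM.
have hE : eqmodX K E^`() (- e%:P * E).
  move=> i iK; rewrite coef_deriv -polyCN coefCM !coef_poly ltnS iK ltnS (ltnW iK).
  rewrite -mulr_natr factS natrM exprS; field.
  by rewrite nat1r !pnatr_eq0 -!lt0n !fact_gt0.
rewrite cE // -coef_deriv derivM.
have -> : (P^`() * E + P * E^`())`_k = (P * E * T)`_k.
  rewrite (eqmodXD (eqmodXM hP (eqmodX_refl E)) (eqmodXM (eqmodX_refl P) hE)) //.
  by congr (nth 0 (polyseq _) _); ring.
by rewrite coefM; apply: eq_bigr => i _; rewrite cE //; have := ltn_ord i; lia.
Qed.

Section FixedRank.
Variables (n D K X : nat) (A : nat -> nat -> R).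
Hypothesis bA : banded D A.
Hypothesis KX : (K * D < X)%N.

Definition excursion k b p : R := ipow D A k b (n + p)%N / k`!%:R.

Lemma power_mxS k : (k < K)%N ->
  power_mx n D A k.+1 *+ k.+1 = power_mx n D A k *m power_mx n D A 1
    + (\matrix_(b < n, p < X) excursion k b p) *m (\matrix_(p < X, a < n) A (n + p)%N a).
Proof.
move=> kK; apply/matrixP => b a; rewrite mulmxnE !mxE /=.
rewrite factS natrM -mulr_natr.
transitivity (imul (k * D) (ipow D A k) A b a / k`!%:R).
  by field; rewrite nat1r !pnatr_eq0 -!lt0n !fact_gt0.
have bn := ltn_ord b.
have kX : (k * D < X)%N by rewrite (leq_ltn_trans _ KX) // leq_mul2r (ltnW kK) orbT.
have -> : imul (k * D) (ipow D A k) A b a = \sum_(c < n + X) ipow D A k b c * A c a.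
  rewrite /imul (big_ord_widen (n + X) (fun c => ipow D A k b c * A c a)); last by lia.
  rewrite big_mkcond /=; apply: eq_bigr => c _; case: ifP => // h.
  by rewrite ipow_banded ?mul0r //; lia.
rewrite big_split_ord /= mulrDl !mulr_suml; congr (_ + _); apply: eq_bigr => c _.
  by rewrite !mxE ipow1 (_ : 1`! = 1)%N ?divr1 //; ring.
by rewrite !mxE /excursion; ring.
Qed.

Lemma excursion_banded k b p : (b + k * D < n + p)%N -> excursion k b p = 0.
Proof. by move=> h; rewrite /excursion ipow_banded ?mul0r. Qed.

Variable W : nat -> nat -> nat -> R.
Hypothesis hW : forall k b p, (k < K)%N ->
  W k b p = excursion k b p
    - \sum_(t < k) \sum_(c < n) ipow D A t.+1 b c / t.+1`!%:R * W (k - t.+1)%N c p.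

Lemma resolvent_banded k b p : (k < K)%N -> (b + k * D < n + p)%N -> W k b p = 0.
Proof.
clear KX; elim/ltn_ind: k b p => k IH b p kK h.
rewrite hW // excursion_banded // big1 ?subrr // => t _; rewrite big1 // => c _.
have tk := ltn_ord t.
case: (ltnP (b + t.+1 * D) c) => h1; first by rewrite ipow_banded ?mul0r ?mul0r.
rewrite (IH (k - t.+1)%N) ?mulr0 //; try lia.
have : (t.+1 * D + (k - t.+1) * D <= k * D)%N.
  by rewrite -mulnDl leq_mul2r; apply/orP; right; lia.
by lia.
Qed.

Definition cumulant_series k : R :=
  \sum_(b < n) \sum_(p < X) W k b p * A (n + p)%N b.

Lemma det_power_mx_rec k : (k < K)%N ->
  let P := \det (mxgen K.+1 (power_mx n D A)) in
  P`_k.+1 *+ k.+1 = P`_k * \tr (power_mx n D A 1)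
                  + \sum_(i < k.+1) P`_i * cumulant_series (k - i).
Proof.
move=> kK /=.
rewrite (@det_mxgen_rec _ n X K (power_mx n D A)
  (fun k => \matrix_(b < n, p < X) excursion k b p)
  (fun k => \matrix_(b < n, p < X) W k b p) (\matrix_(p < X, a < n) A (n + p)%N a)) //.
- congr (_ + _); apply: eq_bigr => i _; congr (_ * _).
  rewrite /mxtrace /cumulant_series; apply: eq_bigr => b _.
  by rewrite mxE; apply: eq_bigr => p _; rewrite !mxE.
- exact: power_mxS.
move=> l lK; apply/matrixP => b p; rewrite summxE big_ord_recl !mxE /=.
rewrite (bigD1 b) //= !mxE /= eqxx mul1r fact0 invr1 mul1r subn0 big1 ?addr0; last first.
  move=> c cb; rewrite !mxE /= (_ : (nat_of_ord b == nat_of_ord c) = false) ?mul0r //.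
  by apply/negbTE; rewrite eq_sym.
rewrite [W l b p]hW // -addrA [X in _ + X](_ : _ = 0) ?addr0 //.
apply/eqP; rewrite addrC subr_eq0; apply/eqP; apply: eq_bigr => t _.
by rewrite !mxE; apply: eq_bigr => c _; rewrite !mxE.
Qed.

End FixedRank.

End CumulantLimit.

Section CumulantLimit.
Context {R : realType}.
Variables (F : nat -> nat -> nat -> R) (D K L : nat) (Phi : {poly R}).
Hypothesis bF : forall n, banded D (F n).
Hypothesis limF : loclim L F D Phi.
Let X := (K * D + D).+1.
Hypothesis LX : (D + 2 * X + K * D < L)%N.

Lemma cvg_power t i x : (x + t * D < L)%N ->
  ipow D (F n) t (n - i.+1) (n - x.+1) / t`!%:R @[n --> \oo] --> th Phi D t x i.
Proof.
move=> h; apply: cvgM; last exact: cvg_cst.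
rewrite /lcoef; case: ifP => hi.
  apply: (@cvg_eq_near _ (fun n => ipow D (F n) t (n - (i + x).+1 + x)
     (n - (i + x).+1 + (x + t * D - (x + t * D - i)))) _ _ (i + x).+1).
    by move=> n hn; congr ipow; lia.
  by apply: (loclim_pow bF limF); lia.
apply: (@cvg_eq_near _ (fun=> 0) _ _ (i + x).+1) => [n hn|]; last exact: cvg_cst.
by rewrite ipow_banded //; lia.
Qed.

Lemma cvg_excursion k i p : (k * D < L)%N ->
  excursion n D (F n) k (n - i.+1) p @[n --> \oo] --> th Phi D k 0 (p + i.+1).
Proof.
move=> h; apply: cvgM; last exact: cvg_cst.
rewrite /lcoef add0n; case: ifP => hi.
  apply: (@cvg_eq_near _ (fun n => ipow D (F n) k (n - i.+1 + 0)
     (n - i.+1 + (0 + k * D - (k * D - (p + i.+1))))) _ _ i.+1).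
    by move=> n hn; congr ipow; lia.
  by apply: (loclim_pow bF limF); lia.
apply: (@cvg_eq_near _ (fun=> 0) _ _ i.+1) => [n hn|]; last exact: cvg_cst.
by rewrite ipow_banded //; lia.
Qed.

Lemma cvg_reentry p x : (D + (p + x).+1 < L)%N ->
  F n (n + p)%N (n - x.+1)%N @[n --> \oo] --> Phi`_(D + (p + x).+1).
Proof.
move=> h; apply: (@cvg_eq_near _ (fun n => F n (n - x.+1 + (x + p).+1)
     (n - x.+1 + ((x + p).+1 + D - (D + (p + x).+1)))) _ _ x.+1).
  by move=> n hn; congr (F n); lia.
by apply: limF; lia.
Qed.

Lemma wl_eq0 k x p : (k * D < x + p.+1)%N -> wl Phi D k x p = 0.
Proof.
move=> h; rewrite /wl big1 // => j _; rewrite big1 // => l _.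
case: (ltnP (j * D) l) => h1; first by rewrite (ep_eq0 _ h1) mulr0 mul0r.
rewrite [X in _ * X]ep_eq0 ?mulr0 //.
have := ltn_ord j; have := ltn_ord l => h2 h3.
have : (j * D + (k - j) * D <= k * D)%N.
  by rewrite -mulnDl leq_mul2r; apply/orP; right; lia.
by lia.
Qed.

Variable W : nat -> nat -> nat -> nat -> R.
Hypothesis hW : forall n k b p, (k < K)%N ->
  W n k b p = excursion n D (F n) k b p
    - \sum_(t < k) \sum_(c < n) ipow D (F n) t.+1 b c / t.+1`!%:R * W n (k - t.+1)%N c p.

Lemma kDX k : (k < K)%N -> (k * D < X)%N.
Proof.
move=> kK; rewrite /X ltnS (leq_trans _ (leq_addr _ _)) // leq_mul2r.
by rewrite (ltnW kK) orbT.
Qed.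

Lemma cvg_resolvent k i p : (k < K)%N -> (i < X)%N ->
  W n k (n - i.+1)%N p @[n --> \oo] --> wl Phi D k i p.
Proof.
elim/ltn_ind: k i => k IH i kK iX.
pose S n : R := \sum_(t < k) \sum_(x < X)
  ipow D (F n) t.+1 (n - i.+1)%N (n - x.+1)%N / t.+1`!%:R * W n (k - t.+1)%N (n - x.+1)%N p.
apply: (@cvg_eq_near _ (fun n => excursion n D (F n) k (n - i.+1)%N p - S n) _ _ (X + i.+1)%N).
  move=> n hn; rewrite hW // /S; congr (_ - _); apply: eq_bigr => t _.
  rewrite (reindex_inj rev_ord_inj) /=.
  rewrite [RHS](big_ord_widen n (fun x => ipow D (F n) t.+1 (n - i.+1)%N (n - x.+1)%N / t.+1`!%:R
     * W n (k - t.+1)%N (n - x.+1)%N p)); last by lia.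
  rewrite [RHS]big_mkcond /=; apply: eq_bigr => x _; case: ifP => // hx.
  rewrite (resolvent_banded (bF n) (hW n)) ?mulr0 //; try lia.
  have : (k - t.+1 < K)%N by lia.
  by move=> /kDX; have := ltn_ord x; lia.
have -> : wl Phi D k i p = th Phi D k 0 (p + i.+1) -
    \sum_(t < k) \sum_(x < X) th Phi D t.+1 x i * wl Phi D (k - t.+1) x p.
  rewrite -(@wl_conv _ Phi D k i p X (kDX kK)) big_ord_recl /= addrK subn0.
  rewrite (bigD1 (Ordinal iX)) //= big1 ?addr0 => [|x xi].
    by rewrite /th /lcoef mul0n addn0 leqnn subnn expr0 coef1 eqxx fact0 divr1 mul1r.
  have {}xi : (nat_of_ord x == i) = false by apply/negbTE.
  rewrite /th /lcoef mul0n addn0 expr0 coef1 subn_eq0.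
  case: leqP => h1; last by rewrite !mul0r.
  by rewrite leqNgt ltn_neqAle h1 eq_sym xi /= !mul0r.
apply: cvgB; first by apply: cvg_excursion; have := kDX kK; lia.
apply: cvg_sumr => t _; apply: cvg_sumr => x _; have tk := ltn_ord t; have xX := ltn_ord x.
apply: cvgM; last by apply: IH => //; lia.
apply: cvg_power; have : (t.+1 * D <= K * D)%N by rewrite leq_mul2r; apply/orP; right; lia.
by lia.
Qed.

Let sigma2 := \sum_(s < D.+1) s%:R * Phi`_(D - s) * Phi`_(D + s).

Lemma cvg_cumulant_series k : (k < K)%N ->
  cumulant_series n X (F n) (W n) k @[n --> \oo] --> (k == 1%N)%:R * sigma2.
Proof.
move=> kK; have kX := kDX kK.
rewrite -(@trace_wl _ Phi D k X kX); last by rewrite /X ltnS leq_addl.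
pose S n : R := \sum_(x < X) \sum_(p < X) F n (n + p)%N (n - x.+1)%N * W n k (n - x.+1)%N p.
apply: (@cvg_eq_near _ S _ _ X).
  move=> n hn; rewrite /S /cumulant_series (reindex_inj rev_ord_inj) /=.
  rewrite [RHS](big_ord_widen n (fun x => \sum_(p < X) F n (n + p)%N (n - x.+1)%N
     * W n k (n - x.+1)%N p)) //.
  rewrite [RHS]big_mkcond /=; apply: eq_bigr => x _; case: ifP => hx.
    by apply: eq_bigr => p _; rewrite mulrC.
  rewrite big1 // => p _; rewrite (resolvent_banded (bF n) (hW n)) ?mul0r //.
  by have := ltn_ord x; lia.
apply: cvg_sumr => x _; apply: cvg_sumr => p _.
have xX := ltn_ord x; have pX := ltn_ord p.
by apply: cvgM; [apply: cvg_reentry; lia | apply: cvg_resolvent].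
Qed.

End CumulantLimit.

(** The normalized moments about the mean of the linear statistic converge to
    those of a Gaussian, since only the second cumulant survives. *)
Theorem cvg_centered_coef (R : realType) (F : nat -> nat -> nat -> R) (D K L : nat)
    (Phi : {poly R}) (P : nat -> {poly R}) :
  (forall n, banded D (F n)) -> loclim L F D Phi ->
  (D + 2 * (K * D + D).+1 + K * D < L)%N ->
  (forall n, (P n)`_0 = 1) ->
  (forall n k, (k <= K)%N -> (P n)`_k = (\det (mxgen K.+1 (power_mx n D (F n))))`_k) ->
  forall k, (k <= K)%N ->
  centered_coef (P n) k @[n --> \oo] -->
    gauss_coef (\sum_(s < D.+1) s%:R * Phi`_(D - s) * Phi`_(D + s)) k.
Proof.
move=> bF limF LX P0 PE; set s2 := \sum_(_ < _) _.
have /choice [W hW] : forall n, exists W : nat -> nat -> nat -> R, forall k b p, (k < K)%N ->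
  W k b p = excursion n D (F n) k b p
    - \sum_(t < k) \sum_(c < n) ipow D (F n) t.+1 b c / t.+1`!%:R * W (k - t.+1)%N c p.
  move=> n; exact: (conv_solve n (fun k b a => ipow D (F n) k b a / k`!%:R)
    (excursion n D (F n)) K).
set X := (K * D + D).+1 in LX.
have KX : (K * D < X)%N by rewrite /X ltnS leq_addr.
pose T n := \poly_(k < K) cumulant_series n X (F n) (W n) k.
have rec n k : (k < K)%N ->
     (P n)`_k.+1 *+ k.+1 = (P n)`_k * (P n)`_1 + \sum_(i < k.+1) (P n)`_i * (T n)`_(k - i).
  have h j : (j < K)%N -> (P n)`_j.+1 *+ j.+1 = (P n)`_j * \tr (power_mx n D (F n) 1)
                  + \sum_(i < j.+1) (P n)`_i * (T n)`_(j - i).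
    move=> jK; rewrite (PE n j.+1) //.
    rewrite (det_power_mx_rec (bF n) KX (hW n)) // -!PE ?(ltnW jK) //.
    congr (_ + _); apply: eq_bigr => i _; have ij := ltn_ord i.
    by rewrite PE ?coef_poly ?ifT //; lia.
  move=> kK; rewrite h //; congr (_ * _ + _).
  have := h 0%N (leq_ltn_trans (leq0n _) kK); rewrite mulr1n => ->.
  rewrite P0 mul1r big_ord_recl big_ord0 addr0 P0 mul1r coef_poly ifT; last by lia.
  rewrite /cumulant_series big1 ?addr0 // => b _; rewrite big1 // => p _.
  rewrite hW; last by lia.
  rewrite big_ord0 subr0 excursion_banded ?mul0r //.
  by have := ltn_ord b; lia.
elim/ltn_ind => -[|[|k]] IH kK.
- rewrite (_ : gauss_coef _ _ = 1); last by rewrite /gauss_coef /= expr0 fact0 divr1.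
  apply: (@cvg_eq_near _ (fun=> 1) _ _ 0) => [n _|]; last exact: cvg_cst.
  by rewrite /centered_coef big_ord_recl big_ord0 P0 expr0 fact0 divr1 mulr1 addr0.
- rewrite (_ : gauss_coef _ _ = 0) //.
  apply: (@cvg_eq_near _ (fun=> 0) _ _ 0) => [n _|]; last exact: cvg_cst.
  rewrite /centered_coef !big_ord_recl big_ord0 /= P0 !fact0 /bump /=.
  by rewrite (_ : 1`! = 1)%N // !divr1 expr1 expr0 !mul1r mulr1 addr0 addNr.
rewrite gauss_coefSS mulrAC.
apply: (@cvg_eq_near _ (fun n => k.+2%:R^-1 *
   \sum_(i < k.+2) centered_coef (P n) i * (T n)`_(k.+1 - i)) _ _ 0%N).
  move=> n _; rewrite -(fps_centered_rec (P0 n) (rec n)) //.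
  by rewrite -[X in _ = _ * X]mulr_natl mulrA mulVf ?mul1r // pnatr_eq0.
rewrite mulrAC mulrC; apply: cvgMr.
have -> : s2 * gauss_coef s2 k = \sum_(i < k.+2) gauss_coef s2 i * ((k.+1 - i == 1)%N%:R * s2).
  rewrite big_ord_recr big_ord_recr /= subnn !mul0r !mulr0 addr0 subSnn eqxx mul1r.
  rewrite big1 ?add0r 1?mulrC // => i _.
  by rewrite (_ : (k.+1 - i == 1)%N = false) ?mul0r ?mulr0 //; apply/eqP; have := ltn_ord i; lia.
apply: cvg_sumr => i _; have ik := ltn_ord i.
apply: cvgM; first by apply: IH; lia.
apply: (@cvg_eq_near _ (fun n => cumulant_series n X (F n) (W n) (k.+1 - i)) _ _ 0%N).
  by move=> n _; rewrite coef_poly ifT //; lia.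
by apply: (cvg_cumulant_series bF limF LX hW); lia.
Qed.

Section Coordinates.
Context {R : realType} (n : nat) (q : {poly R}).
Hypothesis q_monic : q \is monic.
Hypothesis size_q : size q = n.+1.

Definition adapted b : {poly R} := drop_poly n (q * 'X^b).
Definition coord a (C : {poly R}) : R := (('X^n * C) %/ q)`_a.

Lemma coord_is_linear a : linear (coord a : {poly R} -> R^o).
Proof.
move=> c C C'; rewrite /coord mulrDr divpD coefD; congr (_ + _).
by rewrite -scalerAr divpZl coefZ.
Qed.
HB.instance Definition _ a := GRing.isLinear.Build R {poly R} R^o _ _ (coord_is_linear a).

Lemma q_neq0 : q != 0. Proof. exact: monic_neq0. Qed.

Lemma adapted_coord a b : coord a (adapted b) = (b == a)%:R.
Proof.
have e : 'X^n * adapted b = 'X^b * q - take_poly n (q * 'X^b).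
  rewrite ['X^b * q]mulrC -[X in _ = X - _](poly_take_drop n).
  by rewrite addrAC subrr add0r /adapted ['X^n * _]mulrC.
rewrite /coord e divpD mulpK ?q_neq0 // coefD divp_small ?coef0 ?addr0 ?coefXn 1?eq_sym //.
by rewrite size_polyN size_q ltnS size_take_poly.
Qed.

Lemma size_adapted b : size (adapted b) = b.+1.
Proof.
rewrite size_drop_poly size_Mmonic ?monicXn ?q_neq0 // size_q size_polyXn; lia.
Qed.

Lemma coord_small a N (C : {poly R}) : (size C <= N)%N -> (N <= a)%N -> coord a C = 0.
Proof.
move=> sC Na; rewrite /coord nth_default // size_divp ?q_neq0 // size_q /=.
have := size_polyMleq 'X^n C; rewrite size_polyXn /=.
by move=> h; rewrite (leq_trans (leq_sub2r n h)) // addKn (leq_trans sC).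
Qed.

Lemma coord_lead (C : {poly R}) : coord (size C).-1 C = lead_coef C.
Proof.
have [->|C0] := eqVneq C 0; first by rewrite /coord mulr0 div0p coef0 lead_coef0.
have sXC : size ('X^n * C) = (n + size C)%N.
  by rewrite size_monicM ?monicXn // size_polyXn.
have sQ : size (('X^n * C) %/ q) = size C.
  by rewrite size_divp ?q_neq0 // sXC size_q addKn.
have sC : (0 < size C)%N by rewrite size_poly_gt0.
have Q0 : ('X^n * C) %/ q != 0 by rewrite -size_poly_gt0 sQ.
have : lead_coef ('X^n * C) = lead_coef (('X^n * C) %/ q * q).
  rewrite {1}(divp_eq ('X^n * C) q) lead_coefDl // (leq_trans (ltn_modpN0 _ q_neq0)) //.
  rewrite size_Mmonic // sQ size_q; move: sC; case: (size C) => // s _.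
  by rewrite addSn /= leq_addl.
rewrite !lead_coefM (monicP q_monic) lead_coefXn mul1r !mulr1 => ->.
by rewrite lead_coefE sQ.
Qed.

(** The coordinates determine a polynomial, the leading ones first: [coord]
    is the coordinate system of the basis [adapted]. *)
Lemma coord_sum (C : {poly R}) N : (size C <= N)%N -> C = \sum_(a < N) coord a C *: adapted a.
Proof.
move=> sC; apply/eqP; rewrite -subr_eq0; set C' := _ - _.
rewrite -lead_coef_eq0 -coord_lead.
have sC' : (size C' <= N)%N.
  rewrite (leq_trans (size_polyD _ _)) // geq_max sC size_polyN.
  rewrite (leq_trans (size_sum _ _ _)) //; apply/bigmax_leqP => a _.
  by rewrite (leq_trans (size_scale_leq _ _)) // size_adapted.
have cC' a : (a < N)%N -> coord a C' = 0.
  move=> aN; rewrite /C' linearB linear_sum /= (bigD1 (Ordinal aN)) //=.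
  rewrite linearZ /= adapted_coord eqxx big1 ?addr0 => [|c ca].
    by rewrite /GRing.scale /= mulr1 subrr.
  rewrite linearZ /= adapted_coord (_ : (nat_of_ord c == a) = false) ?scaler0 //.
  by apply/negbTE.
case: (posnP N) => [N0|N0]; last first.
  by rewrite cC' //; move: sC'; case: (size C').
move: sC'; rewrite N0 leqn0 size_poly_eq0 => /eqP ->.
by rewrite linear0.
Qed.

Lemma coordJ J a (C : {poly R}) : (J <= n)%N ->
  coord (n - J + a) C = (('X^J * C) %/ q)`_a.
Proof.
move=> Jn; rewrite /coord -{1}(subnK Jn) exprD -mulrA.
rewrite {1}(divp_eq ('X^J * C) q) mulrDr mulrA divpD mulpK ?q_neq0 // coefD.
rewrite ['X^(n-J) * (_ %/ _)]mulrC coefMXn ltnNge leq_addr /= addKn.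
rewrite [X in _ + X]nth_default ?addr0 // size_divp ?q_neq0 // size_q /=.
have := ltn_modp ('X^J * C) q; rewrite q_neq0 size_q ltnS => h.
have := size_polyMleq 'X^(n - J) (('X^J * C) %% q); rewrite size_polyXn.
move=> h2; rewrite (leq_trans (leq_sub2r n h2)) // addSn /= leq_subLR.
by rewrite (leq_trans (leq_add (leqnn (n - J)) h)) //; lia.
Qed.

Lemma adaptedJ J j : (J <= n)%N -> adapted (n - J + j) = drop_poly J (q * 'X^j).
Proof.
move=> Jn; apply/polyP => i; rewrite /adapted !coef_drop_poly !coefMXn.
have -> : (i + n < n - J + j)%N = (i + J < j)%N by lia.
by case: ifP => // _; congr (q`_ _); lia.
Qed.

Section Operators.
Variables (T : {linear {poly R} -> {poly R}}) (D : nat).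
Hypothesis sT : forall C, (size (T C) <= size C + D)%N.

Lemma coord_banded : banded D (fun b a => coord a (T (adapted b)) : R).
Proof.
move=> b a h; apply: (@coord_small _ (b + D).+1) => //.
by rewrite (leq_trans (sT _)) // size_adapted addSn.
Qed.

Lemma coord_iter k b a : coord a (iter k T (adapted b))
  = ipow D (fun b a => coord a (T (adapted b))) k b a.
Proof.
elim: k a => [|k IH] a /=; first by rewrite adapted_coord.
have sk : (size (iter k T (adapted b)) <= (b + k * D).+1)%N.
  elim: k {IH} => [|k IH] /=; first by rewrite size_adapted addn0.
  by rewrite (leq_trans (sT _)) // (leq_trans (leq_add IH (leqnn D))) // mulSn; lia.
rewrite {1}(coord_sum sk) linear_sum linear_sum /imul; apply: eq_bigr => c _.
by rewrite linearZ linearZ /= IH.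
Qed.

End Operators.

End Coordinates.

Section FirstOrderOperator.
Context {R : realType}.
Implicit Types p C : {poly R}.

Definition diffop (p1 p2 : {poly R}) C := p1 * C + p2 * C^`().

Lemma diffop_is_linear p1 p2 : linear (diffop p1 p2).
Proof.
move=> c C C'; rewrite /diffop derivD derivZ !mulrDr -!scalerAr scalerDr.
by rewrite !addrA; congr (_ + _); rewrite -!addrA; congr (_ + _); rewrite addrC.
Qed.
HB.instance Definition _ p1 p2 :=
  GRing.isLinear.Build R {poly R} {poly R} _ (diffop p1 p2) (diffop_is_linear p1 p2).

Lemma size_diffop (p1 p2 C : {poly R}) : (size p1 <= 2)%N -> (size p2 <= 3)%N ->
  (size (diffop p1 p2 C) <= size C + 1)%N.
Proof.
move=> s1 s2; have [->|C0] := eqVneq C 0; first by rewrite linear0 size_poly0.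
have sC : (0 < size C)%N by rewrite size_poly_gt0.
rewrite (leq_trans (size_polyD _ _)) // geq_max; apply/andP; split.
  rewrite (leq_trans (size_polyMleq _ _)) // addn1 -ltnS prednK; last by rewrite addn_gt0 sC orbT.
  by rewrite (leq_trans (leq_add s1 (leqnn _))).
have sd : (size C^`() <= (size C).-1)%N by rewrite -ltnS prednK // lt_size_deriv.
rewrite (leq_trans (size_polyMleq _ _)) //.
rewrite (@leq_trans (3 + (size C).-1).-1) //; last by move: sC; case: (size C) => // s _; lia.
by have := leq_add s2 sd; rewrite addSn; case: (size p2 + _)%N.
Qed.

Definition geom_poly (b : R) j := \poly_(i < j) b ^+ (j.-1 - i).

Lemma geom_polyP b j : 'X^j = ('X - b%:P) * geom_poly b j + (b ^+ j)%:P.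
Proof.
apply/eqP; rewrite -subr_eq polyC_exp subrXX; apply/eqP; congr (_ * _).
rewrite (reindex_inj rev_ord_inj) /= /geom_poly poly_def; apply: eq_bigr => i _.
rewrite -polyC_exp mulrC mul_polyC; have ij := ltn_ord i.
by congr (_ ^+ _ *: 'X^_); lia.
Qed.

Variables (n m : nat) (q : {poly R}) (p1 p2 : {poly R}).
Variables (al be : 'I_m -> R) (qs : 'I_m -> {poly R}).
Hypotheses (q_monic : q \is monic) (size_q : size q = n.+1).
Hypotheses (s1 : (size p1 <= 2)%N) (s2 : (size p2 <= 3)%N).
Hypothesis size_qs : forall s, (size (qs s) <= n)%N.
Hypothesis qsE : forall s, al s *: q = al s *: (('X - (be s)%:P) * qs s).
Hypothesis logder : p1 * q + p2 * q^`() = 'X * q + \sum_s al s *: qs s.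

(** Conjugated by [q], the operator acts on Laurent series at infinity as the
    multiplication by [X + \sum_s al s / (X - be s)], up to a derivation whose
    coefficients are those of [p2]. *)
Lemma coord_diffop J j i : (J.+1 < n)%N ->
  coord n q (n - J.+1 + i) (diffop p1 p2 (adapted n q (n - J.+1 + j))) =
  ('X^(j.+1) + \sum_s al s *: geom_poly (be s) j + j%:R *: (p2 * 'X^(j.-1))
   - J.+1%:R *: (p2`_2 *: 'X^(j.+1) + p2`_1 *: 'X^j + (p2`_0 * (0 < j)%:R) *: 'X^(j.-1)))`_i.
Proof.
move=> Jn; rewrite coordJ // ?adaptedJ //; try exact: ltnW.
set A := drop_poly _ _; set Q := _ - _; congr (nth 0 (polyseq _) i).
pose rho := take_poly J.+1 (q * 'X^j).
have srho : (size rho <= J.+1)%N by apply: size_take_poly.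
have hA : 'X^(J.+1) * A = q * 'X^j - rho.
  rewrite -[X in _ = X - _](poly_take_drop J.+1) addrAC subrr add0r.
  by rewrite ['X^_ * _]mulrC.
pose W := 'X^J * A.
have hW : exists2 r : {poly R}, (size r <= n)%N & W = q * ((0 < j)%:R *: 'X^(j.-1)) + r.
  have XW : 'X * W = q * 'X^j - rho by rewrite /W mulrA -exprS.
  case: (posnP j) => [j0|j0] /=.
    exists W; last by rewrite scale0r mulr0 add0r.
    have [->|W0] := eqVneq W 0; first by rewrite size_poly0.
    rewrite -ltnS -(size_mulX W0) mulrC XW j0 expr0 mulr1.
    rewrite (leq_trans (size_polyD _ _)) // geq_max size_q leqnn size_polyN.
    by rewrite (leq_trans srho) //; lia.
  exists (W - q * 'X^(j.-1)); last by rewrite scale1r addrC subrK.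
  set r := _ - _; have Xr : r * 'X = - rho.
    by rewrite mulrC mulrBr XW mulrCA -exprS prednK // addrAC subrr add0r.
  have [->|r0] := eqVneq r 0; first by rewrite size_poly0.
  rewrite -ltnS -(size_mulX r0) Xr size_polyN (leq_trans srho) //.
  by rewrite ltnW // ltnW.
have [r sr WE] := hW.
have p2E : p2 = p2`_2 *: 'X^2 + p2`_1 *: 'X + p2`_0 *: 1.
  apply/polyP => k; rewrite !coefD !coefZ coefXn coefX coef1.
  case: k => [|[|[|k]]] /=; rewrite ?mulr0 ?mulr1 ?addr0 ?add0r //.
  by rewrite nth_default // (leq_trans s2).
pose rem := \sum_s (al s * be s ^+ j) *: qs s - (diffop p1 p2 rho)
   - J.+1%:R *: (p2`_0 *: r - p2`_2 *: (rho * 'X) - p2`_1 *: rho).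
have srem : (size rem <= n)%N.
  have srho' : (size rho <= n)%N by rewrite (leq_trans srho) // ltnW.
  rewrite (leq_trans (size_polyD _ _)) // geq_max; apply/andP; split.
    rewrite (leq_trans (size_polyD _ _)) // geq_max; apply/andP; split.
      rewrite (leq_trans (size_sum _ _ _)) //; apply/bigmax_leqP => s _.
      by rewrite (leq_trans (size_scale_leq _ _)).
    rewrite size_polyN (leq_trans (size_diffop _ s1 s2)) // addn1.
    by rewrite (leq_ltn_trans srho).
  rewrite size_polyN (leq_trans (size_scale_leq _ _)) //.
  rewrite (leq_trans (size_polyD _ _)) // geq_max; apply/andP; split; last first.
    by rewrite size_polyN (leq_trans (size_scale_leq _ _)).
  rewrite (leq_trans (size_polyD _ _)) // geq_max; apply/andP; split.
    by rewrite (leq_trans (size_scale_leq _ _)).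
  rewrite size_polyN (leq_trans (size_scale_leq _ _)) //.
  rewrite (leq_trans (size_polyMleq _ _)) // size_polyX addn2 /=.
  by rewrite (leq_ltn_trans srho).
suff -> : 'X^(J.+1) * diffop p1 p2 A = Q * q + rem.
  by rewrite divp_addl_mul_small // size_q ltnS.
have dA : 'X^(J.+1) * A^`() = (q * 'X^j - rho)^`() - J.+1%:R *: W.
  rewrite -hA derivM derivXn /= /W scaler_nat -mulrnAl addrAC subrr add0r.
  by [].
have jX : ('X^j : {poly R})^`() = j%:R *: 'X^(j.-1) by rewrite derivXn scaler_nat.
have geo : \sum_s al s *: (qs s * 'X^j) =
  q * (\sum_s al s *: geom_poly (be s) j) + \sum_s (al s * be s ^+ j) *: qs s.
  rewrite mulr_sumr -big_split /=; apply: eq_bigr => s _.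
  rewrite {1}(geom_polyP (be s) j) mulrDr scalerDr mulrA [qs s * _]mulrC.
  rewrite scalerAl -qsE -scalerAl scalerAr; congr (_ + _).
  by rewrite mulrC mul_polyC scalerA.
have -> : 'X^(J.+1) * diffop p1 p2 A
    = (p1 * q + p2 * q^`()) * 'X^j + p2 * (q * (j%:R *: 'X^(j.-1)))
      - diffop p1 p2 rho - p2 * (J.+1%:R *: W).
  rewrite /diffop mulrDr ['X^_ * (p1 * _)]mulrCA hA ['X^_ * (p2 * _)]mulrCA dA.
  by rewrite derivB derivM jX; ring.
rewrite logder mulrDl mulr_suml.
under eq_bigr do rewrite -scalerAl.
rewrite geo /Q /rem.
have -> : p2 * (J.+1%:R *: W) = J.+1%:R *: (p2`_2 *: ('X * (q * 'X^j - rho))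
   + p2`_1 *: (q * 'X^j - rho) + p2`_0 *: (q * ((0 < j)%:R *: 'X^(j.-1)) + r)).
  have XW : 'X * W = q * 'X^j - rho by rewrite /W mulrA -exprS.
  by rewrite -WE -XW {1}p2E -!mul_polyC; ring.
rewrite -!mul_polyC !exprS; ring.
Qed.

End FirstOrderOperator.

Section HornerOperator.
Context {R : realType}.
Variables (f : {poly R}) (T : {linear {poly R} -> {poly R}}).

Definition hornerop (C : {poly R}) : {poly R} :=
  \sum_(k < size f) f`_k *: iter k T C.

Lemma hornerop_is_linear : linear hornerop.
Proof.
have it k c C C' : iter k T (c *: C + C') = c *: iter k T C + iter k T C'.
  by elim: k => //= k ->; rewrite linearP.
move=> c C C'; rewrite /hornerop scaler_sumr -big_split /=; apply: eq_bigr => k _.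
by rewrite it scalerDr !scalerA mulrC.
Qed.
HB.instance Definition _ :=
  GRing.isLinear.Build R {poly R} {poly R} _ hornerop hornerop_is_linear.

Lemma size_hornerop C : (forall C, (size (T C) <= size C + 1)%N) ->
  (size (hornerop C) <= size C + (size f).-1)%N.
Proof.
move=> sT; have it k : (size (iter k T C) <= size C + k)%N.
  elim: k => [|k IH] /=; first by rewrite addn0.
  by rewrite (leq_trans (sT _)) // addn1 addnS ltnS.
rewrite (leq_trans (size_sum _ _ _)) //; apply/bigmax_leqP => k _.
rewrite (leq_trans (size_scale_leq _ _)) // (leq_trans (it _)) // leq_add2l.
by rewrite -ltnS (ltn_predK (ltn_ord k)).
Qed.

End HornerOperator.

Lemma cvg_exprn (R : realType) (u : nat -> R) (l : R) k :
  u n @[n --> \oo] --> l -> u n ^+ k @[n --> \oo] --> l ^+ k.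
Proof.
move=> ul; elim: k => [|k IH]; first by rewrite expr0; exact: cvg_cst.
rewrite exprS; apply: (@cvg_eq_near _ (fun n => u n * u n ^+ k) _ _ 0%N).
  by move=> n _; rewrite exprS.
exact: cvgM.
Qed.

Section SymbolLimit.
Context {R : realType} (m : nat).

(** The truncation of [sum_d sigma_d X^d], where
    [z * sigma (1 / z) = z + \sum_s a s / (z - b s)]. *)
Definition symbol_series L (a b : 'I_m -> R) : {poly R} :=
  \poly_(d < L) (if d is d'.+1 then if d' is e.+1 then \sum_s a s * b s ^+ e else 0 else 1).

Definition symbol_poly L (a b : 'I_m -> R) (f : {poly R}) : {poly R} :=
  \sum_(k < size f) f`_k *: (symbol_series L a b ^+ k * 'X^((size f).-1 - k)).

Variables (q p1 p2 : nat -> {poly R}) (al be : nat -> 'I_m -> R).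
Variables (qs : nat -> 'I_m -> {poly R}) (a b : 'I_m -> R).
Hypotheses (q_monic : forall n, q n \is monic) (size_q : forall n, size (q n) = n.+1).
Hypotheses (s1 : forall n, (size (p1 n) <= 2)%N) (s2 : forall n, (size (p2 n) <= 3)%N).
Hypothesis size_qs : forall n s, (size (qs n.+1 s) <= n.+1)%N.
Hypothesis qsE : forall n s, (0 < n)%N ->
  al n s *: q n = al n s *: (('X - (be n s)%:P) * qs n s).
Hypothesis logder : forall n, (0 < n)%N ->
  p1 n * q n + p2 n * (q n)^`() = 'X * q n + \sum_s al n s *: qs n s.
Hypothesis cvg_al : forall s, al n s @[n --> \oo] --> a s.
Hypothesis cvg_be : forall s, be n s @[n --> \oo] --> b s.
Hypothesis cvg_p2 : forall i, (p2 n)`_i @[n --> \oo] --> (0 : R).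

Definition entry n c d : R := coord n (q n) d (diffop (p1 n) (p2 n) (adapted n (q n) c)).

Lemma cvg_entry J j i :
  entry n (n - J.+1 + j) (n - J.+1 + i) @[n --> \oo] -->
   (i == j.+1)%:R + \sum_s a s * (if (i < j)%N then b s ^+ (j.-1 - i) else 0).
Proof.
pose u n := (i == j.+1)%:R
   + \sum_s al n s * (if (i < j)%N then be n s ^+ (j.-1 - i) else 0)
   + j%:R * (if (i < j.-1)%N then 0 else (p2 n)`_(i - j.-1))
   - J.+1%:R * ((p2 n)`_2 * (i == j.+1)%:R + (p2 n)`_1 * (i == j)%:R
               + (p2 n)`_0 * (0 < j)%:R * (i == j.-1)%:R).
apply: (@cvg_eq_near _ u _ _ J.+2) => [n hn|].
  have n0 : (0 < n)%N by case: (n) hn.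
  have sqs s : (size (qs n s) <= n)%N by case: (n) n0 => // n' _; exact: size_qs.
  rewrite /entry (coord_diffop (q_monic n) (size_q n) (s1 n) (s2 n) sqs
    (fun s => qsE s n0) (logder n0)) //.
  rewrite !(coefD, coefN, coefZ) !coefXn coefMXn coef_sum /u.
  congr (_ + _ + _ - _); apply: eq_bigr => s _.
  by rewrite coefZ coef_poly.
have -> : (i == j.+1)%:R + \sum_s a s * (if (i < j)%N then b s ^+ (j.-1 - i) else 0)
  = (i == j.+1)%:R + \sum_s a s * (if (i < j)%N then b s ^+ (j.-1 - i) else 0)
   + j%:R * 0 - J.+1%:R * (0 * (i == j.+1)%:R + 0 * (i == j)%:R
               + 0 * (0 < j)%:R * (i == j.-1)%:R) :> R.
  by rewrite !mul0r !mulr0 !addr0 mulr0 subr0.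
apply: cvgB; last first.
  have z l (x : R) : (p2 n)`_l * x @[n --> \oo] --> 0 * x.
    by apply: cvgM; [exact: cvg_p2 | exact: cvg_cst].
  apply: cvgMr; apply: cvgD; first by apply: cvgD; exact: z.
  rewrite -mulrA; apply: (@cvg_eq_near _ _ _ _ 0%N) (z _ _) => n _.
  by rewrite mulrA.
apply: cvgD; last first.
  apply: cvgM; first exact: cvg_cst.
  by case: (i < j.-1)%N; [exact: cvg_cst | exact: cvg_p2].
apply: cvgD; first exact: cvg_cst.
apply: cvg_sumr => s _; apply: cvgM; first exact: cvg_al.
by case: (i < j)%N; [apply: cvg_exprn; exact: cvg_be | exact: cvg_cst].
Qed.

Lemma loclim_entry L : loclim L entry 1 (symbol_series L a b).
Proof.
move=> d dL J j dj.
apply: (@cvg_eq_near _ (fun n => entry n (n - J.+1 + j.+1) (n - J.+1 + (j.+2 - d))) _ _ J.+1).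
  by move=> n hn; congr (entry n); lia.
rewrite coef_poly dL.
have := @cvg_entry J j.+1 (j.+2 - d).
case: d dL dj => [|[|d]] dL dj.
- by rewrite subn0 eqxx ltnNge leqnSn /= big1 ?addr0 // => s _; rewrite mulr0.
- rewrite subn1 /= ltnn big1 => [|s _]; last by rewrite mulr0.
  by rewrite (_ : (j.+1 == j.+2) = false) ?add0r //; apply/eqP; lia.
rewrite (_ : (j.+2 - d.+2 == j.+2)%N = false); last by apply/eqP; lia.
rewrite add0r (_ : (j.+2 - d.+2 < j.+1)%N = true); last by lia.
by rewrite (_ : (j.+1.-1 - (j.+2 - d.+2))%N = d) //; lia.
Qed.

Definition statistic_entry (f : {poly R}) n c d : R :=
  coord n (q n) d (hornerop f (diffop (p1 n) (p2 n)) (adapted n (q n) c)).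

Lemma size_entry n C : (size (diffop (p1 n) (p2 n) C) <= size C + 1)%N.
Proof. exact: size_diffop. Qed.

Lemma loclim_statistic L (f : {poly R}) :
  loclim L (statistic_entry f) (size f).-1 (symbol_poly L a b f).
Proof.
pose A (k : 'I_(size f)) n c d : R := f`_k * ipow 1 (entry n) k c d.
have bE n : banded 1 (entry n).
  exact: (coord_banded (q_monic n) (size_q n) (@size_entry n)).
have h : loclim L (fun n c d => \sum_k A k n c d) (size f).-1 (symbol_poly L a b f).
  rewrite /symbol_poly; apply: loclim_sum => k; apply: loclimZ.
  have {1}-> : (size f).-1 = (k * 1 + ((size f).-1 - k))%N.
    by have := ltn_ord k; lia.
  apply: loclim_shift; first by move=> n; apply: ipow_banded.
  by apply: loclim_pow => //; apply: loclim_entry.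
move=> d dL J j dj; apply: cvg_eq_near (h d dL J j dj) => n hn.
rewrite /statistic_entry /hornerop linear_sum /=; apply: eq_bigr => k _.
rewrite linearZ /= (coord_iter (q_monic n) (size_q n) (@size_entry n)).
by [].
Unshelve. exact: 0%N.
Qed.

Lemma statistic_entry_banded (f : {poly R}) n : banded (size f).-1 (statistic_entry f n).
Proof.
apply: (coord_banded (q_monic n) (size_q n)) => C.
exact: (size_hornerop _ _ (@size_entry n)).
Qed.

End SymbolLimit.

Section HasSum.
Context {R : realType}.

Definition has_sum (g : nat -> R) (l : R) := \sum_(x < M) g x @[M --> \oo] --> l.

Lemma has_sumD g h k l : has_sum g k -> has_sum h l -> has_sum (fun x => g x + h x) (k + l).
Proof.
move=> hg hh; rewrite /has_sum.
apply: (@cvg_eq_near _ (fun M => \sum_(x < M) g x + \sum_(x < M) h x) _ _ 0%N).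
  by move=> M _; rewrite big_split.
exact: cvgD.
Qed.

Lemma has_sumZ c g l : has_sum g l -> has_sum (fun x => c * g x) (c * l).
Proof.
move=> hg; rewrite /has_sum.
apply: (@cvg_eq_near _ (fun M => c * \sum_(x < M) g x) _ _ 0%N).
  by move=> M _; rewrite mulr_sumr.
exact: cvgMr.
Qed.

Lemma has_sum_sum I (s : seq I) (g : I -> nat -> R) l :
  (forall i, has_sum (g i) (l i)) ->
  has_sum (fun x => \sum_(i <- s) g i x) (\sum_(i <- s) l i).
Proof.
move=> h; rewrite /has_sum.
apply: (@cvg_eq_near _ (fun M => \sum_(i <- s) \sum_(x < M) g i x) _ _ 0%N).
  by move=> M _; rewrite exchange_big.
by apply: cvg_sumr => i _; exact: h.
Qed.

Lemma has_sum_ext g h l : g =1 h -> has_sum g l -> has_sum h l.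
Proof.
move=> gh; rewrite /has_sum; apply: cvg_eq_near => M _.
by apply: eq_bigr => x _; rewrite gh.
Unshelve. exact: 0%N.
Qed.

Lemma has_sum_unique g k l : has_sum g k -> has_sum g l -> k = l.
Proof. by move=> h1 h2; apply: (cvg_unique _ h1 h2). Qed.

Lemma has_sum_recl g l : has_sum (fun x => g x.+1) l -> has_sum g (g 0%N + l).
Proof.
move=> h; rewrite /has_sum -cvg_shiftS.
apply: (@cvg_eq_near _ (fun M => g 0%N + \sum_(x < M) g x.+1) _ _ 0%N).
  by move=> M _; rewrite big_ord_recl.
by apply: cvgD; [exact: cvg_cst | exact: h].
Qed.

Lemma has_sum_ge0_bounded (g : nat -> R) (C : R) : (forall x, 0 <= g x) ->
  (forall M, \sum_(x < M) g x <= C) -> exists l, has_sum g l.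
Proof.
move=> g0 gC; exists (limn (fun M => \sum_(x < M) g x)).
apply: nondecreasing_is_cvgn.
  apply/nondecreasing_seqP => M; rewrite big_ord_recr /= lerDl; exact: g0.
by exists C => _ [M _ <-]; exact: gC.
Qed.

End HasSum.

Section NegativeBinomial.
Context {R : realType}.
Implicit Types be q : R.

Definition nb_mass be q x : R := pochhammer be x * q ^+ x / x`!%:R.

Lemma pochhammer0 be : pochhammer be 0 = 1.
Proof. by rewrite /pochhammer big_ord0. Qed.

Lemma pochhammerS be x : pochhammer be x.+1 = be * pochhammer (be + 1) x.
Proof.
rewrite /pochhammer big_ord_recl addr0; congr (_ * _); apply: eq_bigr => i _.
by rewrite -addrA nat1r.
Qed.

Lemma pochhammerSr be x : pochhammer be x.+1 = pochhammer be x * (be + x%:R).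
Proof. by rewrite /pochhammer big_ord_recr. Qed.

Lemma pochhammer_gt0 be x : 0 < be -> 0 < pochhammer be x.
Proof.
by move=> b0; rewrite /pochhammer; apply: prodr_gt0 => i _; rewrite ltr_wpDr ?ler0n.
Qed.

Lemma factS_neq0 x : x.+1%:R != 0 :> R. Proof. by rewrite pnatr_eq0. Qed.

Lemma natfact_neq0 x : x`!%:R != 0 :> R.
Proof. by rewrite pnatr_eq0 -lt0n fact_gt0. Qed.

Lemma nb_mass0 be q : nb_mass be q 0 = 1.
Proof. by rewrite /nb_mass pochhammer0 expr0 fact0 divr1 mulr1. Qed.

Lemma nb_massS be q x :
  nb_mass (be + 1) q x.+1 = nb_mass be q x.+1 + q * nb_mass (be + 1) q x.
Proof.
rewrite /nb_mass pochhammerSr (pochhammerS be) factS natrM exprS.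
by field; rewrite nat1r factS_neq0 natfact_neq0.
Qed.

Lemma nb_massX be q x : x.+1%:R * nb_mass be q x.+1 = be * q * nb_mass (be + 1) q x.
Proof.
rewrite /nb_mass pochhammerS factS natrM exprS.
by field; rewrite nat1r factS_neq0 natfact_neq0.
Qed.

Lemma nb_mass_ge0 be q x : 0 < be -> 0 <= q -> 0 <= nb_mass be q x.
Proof.
move=> b0 q0; rewrite /nb_mass divr_ge0 // mulr_ge0 ?exprn_ge0 //.
exact/ltW/pochhammer_gt0.
Qed.

Lemma nb_mass_le be be' q x : 0 < be -> be <= be' -> 0 <= q ->
  nb_mass be q x <= nb_mass be' q x.
Proof.
move=> b0 bb q0; rewrite /nb_mass ler_pM2r ?invr_gt0 ?ltr0n ?fact_gt0 //.
rewrite ler_wpM2r ?exprn_ge0 // /pochhammer; apply: ler_prod => i _.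
by rewrite lerD2r bb andbT addr_ge0 // ltW.
Qed.

Lemma nb_mass_summable be q : 0 < be -> 0 < q < 1 -> exists l, has_sum (nb_mass be q) l.
Proof.
move=> b0 /andP[q0 q1].
have q1' : 0 < 1 - q by rewrite subr_gt0.
have bnd (N : nat) : exists C, forall M, \sum_(x < M) nb_mass N.+1%:R q x <= C.
  elim: N => [|N [C IH]].
    exists (1 - q)^-1 => M.
    have -> : \sum_(x < M) nb_mass 1%:R q x = \sum_(x < M) q ^+ x.
      apply: eq_bigr => x _; rewrite /nb_mass (_ : pochhammer _ _ = x`!%:R).
        by rewrite mulrAC divff ?mul1r ?natfact_neq0.
      elim: (nat_of_ord x) => [|y IH]; first by rewrite pochhammer0 fact0.
      by rewrite pochhammerSr IH factS natrM mulrC nat1r.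
    rewrite -[leRHS]mul1r ler_pdivlMr //.
    have -> : (\sum_(x < M) q ^+ x) * (1 - q) = 1 - q ^+ M.
      by rewrite -[1 - q]opprB mulrN mulrC -subrX1 opprB.
    by rewrite gerBl exprn_ge0 // ltW.
  exists (C / (1 - q)) => M; rewrite ler_pdivlMr //.
  case: M => [|M].
    rewrite big_ord0 mul0r (le_trans _ (IH 0%N)) // big_ord0 //.
  rewrite mulrBr mulr1 lerBlDr.
  have e : \sum_(x < M.+1) nb_mass N.+2%:R q x =
     \sum_(x < M.+1) nb_mass N.+1%:R q x + q * \sum_(x < M) nb_mass N.+2%:R q x.
    rewrite !big_ord_recl !nb_mass0 -addrA; congr (_ + _).
    rewrite mulr_sumr -big_split /=; apply: eq_bigr => x _.
    by rewrite -[N.+2]addn1 natrD nb_massS.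
  rewrite {1}e lerD // mulrC ler_pM2r // big_ord_recr /= lerDl.
  by rewrite nb_mass_ge0 // ?ltr0n // ltW.
have [C hC] := bnd (Num.bound be).
apply: (@has_sum_ge0_bounded _ _ C) => [x|M]; first by rewrite nb_mass_ge0 // ltW.
apply: le_trans (hC M); apply: ler_sum => x _; apply: nb_mass_le => //; last exact: ltW.
rewrite (le_trans (ltW (archi_boundP (ltW b0)))) // ler_nat //.
Qed.

Definition nb_total be q := limn (fun M => \sum_(x < M) nb_mass be q x).

Lemma nb_totalP be q : 0 < be -> 0 < q < 1 -> has_sum (nb_mass be q) (nb_total be q).
Proof.
move=> b0 q01; have [l hl] := nb_mass_summable b0 q01.
by apply/cvg_ex; exists l.
Qed.

Lemma nb_totalS be q : 0 < be -> 0 < q < 1 ->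
  nb_total (be + 1) q * (1 - q) = nb_total be q.
Proof.
move=> b0 q01; have b1 : 0 < be + 1 by rewrite addr_gt0.
have hS : has_sum (fun x => q * nb_mass (be + 1) q x) (q * nb_total (be + 1) q).
  by apply: has_sumZ; apply: nb_totalP.
have h0 : has_sum (fun x => if x is y.+1 then q * nb_mass (be + 1) q y else 0)
                  (0 + q * nb_total (be + 1) q).
  by apply: has_sum_recl.
have h : has_sum (nb_mass (be + 1) q) (nb_total be q + q * nb_total (be + 1) q).
  rewrite -[q * _]add0r; apply: has_sum_ext (has_sumD (nb_totalP b0 q01) h0) => -[|x].
    by rewrite !nb_mass0 addr0.
  by rewrite nb_massS.
rewrite mulrBr mulr1 {1}(has_sum_unique (nb_totalP b1 q01) h) [_ * q]mulrC.
by rewrite addrK.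
Qed.

Lemma has_sum_ffact k be q : 0 < be -> 0 < q < 1 ->
  has_sum (fun x => (x ^_ k)%:R * nb_mass be q x)
          (pochhammer be k * (q / (1 - q)) ^+ k * nb_total be q).
Proof.
move=> b0 q01; have q1 : 1 - q != 0 by case/andP: q01 => _ h; rewrite subr_eq0 eq_sym lt_eqF.
elim: k be b0 => [|k IH] be b0.
  rewrite pochhammer0 expr0 !mul1r; apply: has_sum_ext (nb_totalP b0 q01) => x.
  by rewrite ffactn0 mul1r.
have b1 : 0 < be + 1 by rewrite addr_gt0.
have -> : pochhammer be k.+1 * (q / (1 - q)) ^+ k.+1 * nb_total be q =
  (0 ^_ k.+1)%:R * nb_mass be q 0 + be * q *
   (pochhammer (be + 1) k * (q / (1 - q)) ^+ k * nb_total (be + 1) q).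
  rewrite -(nb_totalS b0 q01) ffact_small // mul0r add0r pochhammerS exprS.
  by field.
apply: (@has_sum_recl _ (fun x => (x ^_ k.+1)%:R * nb_mass be q x)).
apply: has_sum_ext (has_sumZ (c := be * q) (IH _ b1)) => x.
by rewrite ffactSS natrM [RHS]mulrAC nb_massX; ring.
Qed.

End NegativeBinomial.

Section FactorialTransform.
Context {R : realType} (be : R).
Hypothesis be_gt0 : 0 < be.

Definition ffact_poly k : {poly R} := \prod_(i < k) ('X - i%:R%:P).

Lemma size_ffact_poly k : size (ffact_poly k) = k.+1.
Proof.
rewrite /ffact_poly -(big_mkord xpredT (fun i => 'X - i%:R%:P)).
by rewrite size_prod_XsubC size_iota subn0.
Qed.

Lemma ffact_poly_monic k : ffact_poly k \is monic.
Proof. by apply: monic_prod => i _; apply: monicXsubC. Qed.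

Lemma horner_ffact_poly k x : (ffact_poly k).[x%:R] = (x ^_ k)%:R.
Proof.
elim: k => [|k IH]; first by rewrite /ffact_poly big_ord0 hornerC ffactn0.
rewrite /ffact_poly big_ord_recr /= hornerM -/(ffact_poly k) IH ffactnSr hornerXsubC.
case: (leqP k x) => h; first by rewrite natrM natrB.
by rewrite ffact_small // !mul0r.
Qed.

Definition npoly k : {poly R} := (pochhammer be k)^-1 *: ffact_poly k.

Lemma poch_neq0 k : pochhammer be k != 0.
Proof. by rewrite gt_eqF // pochhammer_gt0. Qed.

(** The moment functional of the negative binomial mass function with
    parameter [q] becomes the evaluation at [q / (1 - q)] when the polynomial
    [\sum_k c_k x (x - 1) ... (x - k + 1) / (be)_k] is replaced by
    [\sum_k c_k u ^ k]. *)
Definition Psi (C : {poly R}) : {poly R} := \sum_(k < size C) C`_k *: npoly k.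

Lemma Psi_wide (C : {poly R}) N : (size C <= N)%N -> Psi C = \sum_(k < N) C`_k *: npoly k.
Proof.
move=> sC; rewrite /Psi (big_ord_widen N (fun k => C`_k *: npoly k)) // big_mkcond /=.
apply: eq_bigr => k _; case: ltnP => // h.
by rewrite nth_default // scale0r.
Qed.

Lemma Psi_is_linear : linear Psi.
Proof.
move=> c C C'; pose N := maxn (size C) (size C').
have sC : (size C <= N)%N by rewrite leq_maxl.
have sC' : (size C' <= N)%N by rewrite leq_maxr.
have sS : (size (c *: C + C')%R <= N)%N.
  rewrite (leq_trans (size_polyD _ _)) // geq_max sC' andbT.
  exact: leq_trans (size_scale_leq _ _) sC.
rewrite (Psi_wide sC) (Psi_wide sC') (Psi_wide sS) scaler_sumr -big_split /=.
by apply: eq_bigr => k _; rewrite coefD coefZ scalerDl scalerA.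
Qed.
HB.instance Definition _ :=
  GRing.isLinear.Build R {poly R} {poly R} _ Psi Psi_is_linear.

Lemma PsiXn k : Psi 'X^k = npoly k.
Proof.
rewrite /Psi size_polyXn big_ord_recr /= coefXn eqxx scale1r big1 ?add0r // => i _.
by rewrite coefXn ltn_eqF ?scale0r // ltn_ord.
Qed.

Lemma X_npoly k : 'X * npoly k = (be + k%:R) *: npoly k.+1 + k%:R *: npoly k.
Proof.
have bk : be + k%:R != 0 by rewrite gt_eqF // ltr_wpDr ?ler0n.
rewrite /npoly pochhammerSr /ffact_poly big_ord_recr /= -/(ffact_poly k) !scalerA.
have -> : (be + k%:R) / (pochhammer be k * (be + k%:R)) = (pochhammer be k)^-1.
  by field; rewrite bk poch_neq0.
rewrite -!mul_polyC polyCM; ring.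
Qed.

Lemma mulX_Psi C : 'X * Psi C = Psi (diffop (be *: 'X) ('X^2 + 'X) C).
Proof.
have base k : 'X * Psi 'X^k = Psi (diffop (be *: 'X) ('X^2 + 'X) 'X^k).
  have -> : diffop (be *: 'X) ('X^2 + 'X) 'X^k
          = (be + k%:R) *: 'X^(k.+1) + k%:R *: 'X^k.
    rewrite /diffop derivXn; case: k => [|j] /=.
      by rewrite mulr0n mulr0 scale0r !addr0 expr0 mulr1 expr1.
    rewrite -scaler_nat -!mul_polyC polyCD !exprS; ring.
  by rewrite linearP /= linearZ /= !PsiXn X_npoly.
rewrite -[C]coefK poly_def !linear_sum /= mulr_sumr; apply: eq_bigr => k _.
by rewrite !linearZ /= -scalerAr base.
Qed.

Lemma has_sum_Psi (C : {poly R}) q : 0 < q < 1 ->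
  has_sum (fun x => (Psi C).[x%:R] * nb_mass be q x)
          (C.[q / (1 - q)] * nb_total be q).
Proof.
move=> q01; rewrite horner_coef mulr_suml.
apply: (@has_sum_ext _ (fun x => \sum_(k < size C)
   C`_k / pochhammer be k * ((x ^_ k)%:R * nb_mass be q x))).
  move=> x; rewrite /Psi horner_sum mulr_suml; apply: eq_bigr => k _.
  by rewrite !hornerZ horner_ffact_poly; ring.
apply: has_sum_sum => k.
have -> : C`_k * (q / (1 - q)) ^+ k * nb_total be q = C`_k / pochhammer be k *
   (pochhammer be k * (q / (1 - q)) ^+ k * nb_total be q).
  have h := poch_neq0 k; set v := _ ^+ k; by field.
by apply: has_sumZ; apply: has_sum_ffact.
Qed.

Lemma coef_Psi_lead (C : {poly R}) b : size C = b.+1 -> (Psi C)`_b = C`_b / pochhammer be b.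
Proof.
move=> sC; rewrite /Psi sC coef_sum big_ord_recr /= big1 ?add0r => [|k _].
  have := monicP (ffact_poly_monic b); rewrite lead_coefE size_ffact_poly /= => h.
  by rewrite !coefZ h mulr1.
by rewrite !coefZ [(ffact_poly k)`_b]nth_default ?mulr0 // size_ffact_poly.
Qed.

Lemma size_Psi C : (size (Psi C) <= size C)%N.
Proof.
rewrite (leq_trans (size_sum _ _ _)) //; apply/bigmax_leqP => k _.
rewrite (leq_trans (size_scale_leq _ _)) // (leq_trans (size_scale_leq _ _)) //.
by rewrite size_ffact_poly.
Qed.

Section Affine.
Variables (n : nat) (tau c : R).
Hypotheses (tau0 : tau != 0) (n0 : (0 < n)%N).

Definition aff : {poly R} := tau *: 'X + c%:P.
Definition affinv : {poly R} := tau^-1 *: ('X - c%:P).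
Definition Psi_aff C := Psi (C \Po aff).

Lemma Psi_aff_is_linear : linear Psi_aff.
Proof. by move=> x C C'; rewrite /Psi_aff linearP linearP. Qed.
HB.instance Definition _ :=
  GRing.isLinear.Build R {poly R} {poly R} _ Psi_aff Psi_aff_is_linear.

Definition meix_p1 := (be / n%:R) *: affinv.
Definition meix_p2 := (tau / n%:R) *: (affinv * (affinv + 1)).

Lemma affinvK : affinv \Po aff = 'X.
Proof.
rewrite /affinv comp_polyZ comp_polyB comp_polyX comp_polyC /aff addrK scalerA.
by rewrite mulVf // scale1r.
Qed.

Lemma size_affinv : (size affinv <= 2)%N.
Proof. by rewrite (leq_trans (size_scale_leq _ _)) // size_XsubC. Qed.

Lemma size_meix_p1 : (size meix_p1 <= 2)%N.
Proof. exact: leq_trans (size_scale_leq _ _) size_affinv. Qed.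

Lemma size_meix_p2 : (size meix_p2 <= 3)%N.
Proof.
rewrite (leq_trans (size_scale_leq _ _)) // (leq_trans (size_polyMleq _ _)) //.
have s1 : (size (affinv + 1)%R <= 2)%N.
  by rewrite (leq_trans (size_polyD _ _)) // geq_max size_affinv size_poly1.
by have := leq_add size_affinv s1; case: (size affinv + _)%N.
Qed.

Lemma size_comp_aff (C : {poly R}) : size (C \Po aff) = size C.
Proof.
apply: size_comp_poly2; rewrite /aff size_polyDl size_scale // size_polyX //.
by rewrite (leq_ltn_trans (size_polyC_leq1 _)).
Qed.

Lemma mulX_Psi_aff C :
  (n%:R^-1 *: 'X) * Psi_aff C = Psi_aff (diffop meix_p1 meix_p2 C).
Proof.
rewrite -scalerAl mulX_Psi /Psi_aff -linearZ /=; congr (Psi _).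
have e1 : meix_p1 \Po aff = (be / n%:R) *: 'X by rewrite /meix_p1 comp_polyZ affinvK.
have e2 : meix_p2 \Po aff = (tau / n%:R) *: ('X * ('X + 1)).
  rewrite /meix_p2 comp_polyZ comp_polyM [(affinv + 1) \Po _]comp_polyD affinvK.
  by rewrite -polyC1 comp_polyC.
rewrite /diffop scalerDr comp_polyD [(_ * C) \Po _]comp_polyM e1.
rewrite [(_ * C^`()) \Po _]comp_polyM e2 deriv_comp /aff derivD derivZ derivX derivC.
rewrite addr0 -!mul_polyC !polyCM; ring.
Qed.

Lemma has_sum_Psi_aff C q : 0 < q < 1 ->
  has_sum (fun x => (Psi_aff C).[x%:R] * nb_mass be q x)
          (C.[tau * (q / (1 - q)) + c] * nb_total be q).
Proof.
by move=> /(has_sum_Psi (C := C \Po aff)); rewrite horner_comp /aff !hornerE.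
Qed.

Lemma horner_hornerop (f C : {poly R}) :
  (f \Po (n%:R^-1 *: 'X)) * Psi_aff C
  = Psi_aff (hornerop f (diffop meix_p1 meix_p2) C).
Proof.
rewrite comp_polyE mulr_suml /hornerop linear_sum /=; apply: eq_bigr => k _.
rewrite linearZ /= -scalerAl; congr (_ *: _).
elim: (nat_of_ord k) => [|j IH]; first by rewrite expr0 mul1r.
by rewrite exprS -mulrA IH mulX_Psi_aff.
Qed.

End Affine.

End FactorialTransform.

Section NodePolynomial.
Context {R : realType} (m : nat) (b : 'I_m -> R) (k : 'I_m -> nat).

Definition node_poly : {poly R} := \prod_j ('X - (b j)%:P) ^+ k j.
Definition node_quot (i : 'I_m) : {poly R} := if k i is k'.+1 then
  ('X - (b i)%:P) ^+ k' * \prod_(j | j != i) ('X - (b j)%:P) ^+ k j else 0.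

Lemma node_poly_monic : node_poly \is monic.
Proof. by apply: monic_prod => j _; apply: monic_exp; apply: monicXsubC. Qed.

Lemma size_node_poly : size node_poly = (\sum_j k j).+1.
Proof.
rewrite /node_poly size_prod => [|j _]; last by rewrite expf_neq0 // polyXsubC_eq0.
rewrite (eq_bigr (fun j => k j + 1)%N) => [|j _].
  by rewrite big_split /= sum_nat_const muln1 -addSn addnK.
by rewrite size_exp_XsubC addn1.
Qed.

Lemma node_quotP i : (0 < k i)%N -> node_poly = ('X - (b i)%:P) * node_quot i.
Proof.
rewrite /node_quot /node_poly (bigD1 i) //=; case: (k i) => // k' _.
by rewrite exprS mulrA.
Qed.

Lemma size_node_quot i : (size (node_quot i) <= \sum_j k j)%N.
Proof.
case: (posnP (k i)) => [h|h]; first by rewrite /node_quot h size_poly0.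
have [->|q0] := eqVneq (node_quot i) 0; first by rewrite size_poly0.
by rewrite -ltnS -size_node_poly (node_quotP h) mulrC size_Mmonic ?monicXsubC // size_XsubC addn2.
Qed.

Lemma deriv_node_poly : node_poly^`() = \sum_i (k i)%:R *: node_quot i.
Proof.
rewrite /node_poly deriv_prod; apply: eq_bigr => i _; rewrite /node_quot.
rewrite deriv_exp derivXsubC mul1r; case: (k i) => [|k'] /=.
  by rewrite mulr0n mul0r scale0r.
by rewrite -scaler_nat scalerAl.
Qed.

End NodePolynomial.

Section Meixner.
Context {R : realType} (m n : nat) (be tau : R) (u : 'I_m -> R) (k : 'I_m -> nat).
Hypotheses (be_gt0 : 0 < be) (n_gt0 : (0 < n)%N) (sum_k : (\sum_j k j)%N = n).
Hypothesis tauE : tau * n%:R = be + n%:R.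

Definition shift_const : R := \sum_i (k i)%:R / n%:R * (1 + u i).
Definition pole j : R := tau * u j + shift_const.
Definition residue j : R := tau * ((k j)%:R / n%:R) * (u j * (1 + u j)).

Lemma n_neq0 : n%:R != 0 :> R. Proof. by rewrite pnatr_eq0 -lt0n. Qed.

Lemma tau_neq0 : tau != 0.
Proof.
apply/eqP => t0; have := tauE; rewrite t0 mul0r => /esym/eqP.
by rewrite gt_eqF // ltr_wpDr ?ler0n.
Qed.

Let c := shift_const.
Let p1 : {poly R} := meix_p1 be n tau c.
Let p2 : {poly R} := meix_p2 n tau c.

Lemma meixner_logder :
  p1 * node_poly pole k + p2 * (node_poly pole k)^`()
  = 'X * node_poly pole k + \sum_i residue i *: node_quot pole k i.
Proof.
rewrite deriv_node_poly; set q := node_poly _ _; set mu := affinv tau c.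
have tau0 := tau_neq0; have n0 := n_neq0.
have e i : p2 * ((k i)%:R *: node_quot pole k i) =
    residue i *: node_quot pole k i
    + ((k i)%:R / n%:R) *: (mu * q) + ((k i)%:R / n%:R * (1 + u i)) *: q.
  case: (posnP (k i)) => [ki0|ki].
    by rewrite /residue ki0 !(mul0r, mulr0) !scale0r mulr0 !addr0.
  rewrite /q (node_quotP pole ki); set Q := node_quot _ _ _.
  have hmu : 'X - (pole i)%:P = tau *: (mu - (u i)%:P).
    rewrite /mu /affinv /pole -/c scalerBr scalerA divff // scale1r -mul_polyC.
    by rewrite polyCD polyCM; ring.
  rewrite hmu /p2 /meix_p2 -/mu /residue -!mul_polyC !polyCM !polyCD polyC1.
  have -> : ((k i)%:R : R)%:P = (tau%:P * (tau^-1)%:P) * ((k i)%:R : R)%:P :> {poly R}.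
    by rewrite -polyCM divff // mul1r.
  have ht : tau%:P * (tau^-1)%:P = 1 :> {poly R} by rewrite -polyCM divff.
  rewrite !ht !mul1r; ring.
rewrite mulr_sumr; under eq_bigr do rewrite e.
have sk : \sum_i (k i)%:R / n%:R = 1 :> R.
  by rewrite -mulr_suml -natr_sum sum_k divff.
rewrite !big_split /= -scaler_suml sk scale1r -scaler_suml -/shift_const -/c.
have -> : p1 * q + (\sum_i residue i *: node_quot pole k i + mu * q + c *: q)
  = (p1 + mu + c%:P) * q + \sum_i residue i *: node_quot pole k i.
  by rewrite -mul_polyC; ring.
congr (_ * _ + _).
have -> : p1 + mu = tau *: mu.
  rewrite /p1 /meix_p1 -/mu -{2}[mu]scale1r -scalerDl; congr (_ *: _).
  by apply: (mulIf n0); rewrite tauE mulrDl divfK ?mul1r.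
by rewrite /mu /affinv scalerA divff // scale1r subrK.
Qed.

Lemma meixner_residueE i :
  residue i *: node_poly pole k = residue i *: (('X - (pole i)%:P) * node_quot pole k i).
Proof.
case: (posnP (k i)) => [ki0|ki]; last by rewrite (node_quotP pole ki).
by rewrite /residue ki0 mul0r mulr0 mul0r !scale0r.
Qed.

Let T := diffop p1 p2.

Lemma root_iter_diffop s l H : (l < k s)%N ->
  root (iter l T (node_poly pole k * H)) (pole s).
Proof.
move=> lk; set C := _ * H.
have h0 : ('X - (pole s)%:P) ^+ k s %| C.
  by rewrite /C /node_poly (bigD1 s) //= -mulrA dvdp_mulIl.
have h j : (j <= k s)%N -> ('X - (pole s)%:P) ^+ (k s - j) %| iter j T C.
  elim: j => [|j IH] jk; first by rewrite subn0.
  have /dvdpP [Q /= ->] := IH (ltnW jk).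
  have -> : (k s - j = (k s - j.+1).+1)%N by lia.
  set e := (k s - j.+1)%N; rewrite /T /diffop dvdp_add //.
    by rewrite dvdp_mull // dvdp_mull // exprS dvdp_mull.
  rewrite dvdp_mull // derivM dvdp_add //.
    by rewrite dvdp_mull // exprS dvdp_mull.
  by rewrite dvdp_mull // deriv_exp /= derivXsubC mul1r -scaler_nat dvdpZr ?pnatr_eq0.
rewrite root_factor_theorem; apply: dvdp_trans (h l (ltnW lk)).
by rewrite -(subnSK lk) exprS dvdp_mulr.
Qed.

(** Multiples of the node polynomial correspond to the polynomials
    orthogonal to all the functions of the ensemble. *)
Lemma meixner_orthogonal s q l H : 0 < q < 1 -> u s = q / (1 - q) -> (l < k s)%N ->
  has_sum (fun x => (Psi_aff be tau c (node_poly pole k * H)).[x%:R]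
                    * (x%:R ^+ l * nb_mass be q x)) 0.
Proof.
move=> q01 us lk; set C := _ * H.
have e : 'X^l * Psi_aff be tau c C = n%:R ^+ l *: Psi_aff be tau c (iter l T C).
  elim: l {lk} => [|l IH]; first by rewrite !expr0 mul1r scale1r.
  have -> : iter l.+1 T C = diffop p1 p2 (iter l T C) by [].
  rewrite exprS -mulrA IH -scalerAr -(mulX_Psi_aff be_gt0 n c tau_neq0) //.
  by rewrite -scalerAl scalerA exprSr -mulrA divff ?mulr1 // n_neq0.
have := has_sum_Psi_aff be_gt0 (tau := tau) (c := c) (C := iter l T C) q01.
rewrite -us -/(pole s) (rootP (root_iter_diffop H lk)) mul0r => /(has_sumZ (c := n%:R ^+ l)).
rewrite mulr0; apply: has_sum_ext => x.
by rewrite mulrA -hornerZ -e hornerM hornerXn; ring.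
Qed.

End Meixner.

(** Andreief's identity, the integral form of the Cauchy-Binet formula. *)
Lemma andreief (R : comNzRingType) (n M : nat) (phi psi : 'I_n -> 'I_M -> R) :
  \sum_(x : {ffun 'I_n -> 'I_M}) \det (\matrix_(i, j) phi j (x i))
                                * \det (\matrix_(i, j) psi j (x i))
  = n`!%:R * \det (\matrix_(i, j) \sum_y phi i y * psi j y).
Proof.
pose dpsi (x : 'I_n -> 'I_M) := \det (\matrix_(i, j) psi j (x i)).
have step1 : \sum_(x : {ffun 'I_n -> 'I_M}) \det (\matrix_(i, j) phi j (x i)) * dpsi x
   = n`!%:R * \sum_(x : {ffun 'I_n -> 'I_M}) (\prod_i phi i (x i)) * dpsi x.
  under eq_bigr do rewrite {1}/determinant mulr_suml.
  rewrite exchange_big /=.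
  transitivity (\sum_(s : 'S_n) \sum_(x : {ffun 'I_n -> 'I_M}) (\prod_i phi i (x i)) * dpsi x).
    apply: eq_bigr => s _.
    pose h (x : {ffun 'I_n -> 'I_M}) : {ffun 'I_n -> 'I_M} := [ffun i => x (s i)].
    have hi : injective h.
      move=> x y /ffunP e; apply/ffunP => i.
      by have := e ((s^-1)%g i); rewrite !ffunE permKV.
    rewrite (reindex_inj hi) /=; apply: eq_bigr => x _.
    have -> : dpsi (h x) = (-1) ^+ s * dpsi x.
      rewrite -det_perm -det_mulmx -row_permE; congr (\det _).
      by apply/matrixP => i j; rewrite !mxE ffunE.
    have -> : \prod_i (\matrix_(i0, j) phi j (h x i0)) i (s i) = \prod_i phi i (x i).
      rewrite [RHS](reindex_inj (@perm_inj _ s)) /=.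
      by apply: eq_bigr => i _; rewrite mxE ffunE.
    rewrite mulrACA -exprD addnn -mul2n exprM sqrrN expr1n expr1n mul1r.
    by [].
  by rewrite sumr_const card_Sn mulr_natl.
rewrite step1; congr (_ * _).
rewrite [RHS]/determinant; under eq_bigr do rewrite {1}/dpsi /determinant mulr_sumr.
rewrite exchange_big /=; apply: eq_bigr => s _.
have -> : \prod_i (\matrix_(i0, j) \sum_y phi i0 y * psi j y) i (s i)
  = \prod_i \sum_y phi i y * psi (s i) y by apply: eq_bigr => i _; rewrite mxE.
rewrite bigA_distr_bigA mulr_sumr; apply: eq_bigr => x _ /=.
rewrite big_split /= mulrCA; congr (_ * (_ * _)).
by apply: eq_bigr => i _; rewrite mxE.
Qed.

(** A linear map of the space of polynomials of degree less than [n] has the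
    same determinant in every basis and against every family of functionals. *)
Lemma det_functionals (R : fieldType) n (ell : 'I_n -> {poly R} -> R)
    (P : nat -> {poly R}) (G : {poly R}) (Mx : 'M[R]_n) :
  (forall j c p p', ell j (c *: p + p') = c * ell j p + ell j p') ->
  (forall b, (b < n)%N -> size (P b) = b.+1) ->
  (forall (b : 'I_n) j, ell j (G * P b) = \sum_a Mx b a * ell j (P a)) ->
  \det (\matrix_(i, j) ell j (G * 'X^i)) = \det Mx * \det (\matrix_(i, j) ell j 'X^i).
Proof.
move=> lin sP hM.
have ell0 j : ell j 0 = 0.
  by have := lin j (-1) 0 0; rewrite scaler0 addr0 mulN1r addNr.
have lin_sum j (F : 'I_n -> R) (Q : 'I_n -> {poly R}) :
    ell j (\sum_i F i *: Q i) = \sum_i F i * ell j (Q i).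
  elim: (index_enum _) => [|i s IH]; first by rewrite !big_nil ell0.
  by rewrite !big_cons lin IH.
pose T : 'M[R]_n := \matrix_(b, i) (P b)`_i.
have PE (b : 'I_n) : P b = \sum_(i < n) T b i *: 'X^i.
  rewrite -{1}[P b]coefK poly_def sP // (big_ord_widen n (fun i => (P b)`_i *: 'X^i)) //.
  rewrite big_mkcond /=; apply: eq_bigr => i _; rewrite mxE; case: ifP => // h.
  by rewrite nth_default ?scale0r // sP // leqNgt h.
have dT : \det T != 0.
  rewrite det_trig; last first.
    apply/is_trig_mxP => b i bi; rewrite mxE nth_default // sP //.
  rewrite prodf_seq_neq0; apply/allP => b _ /=; rewrite mxE.
  have -> : (P b)`_b = lead_coef (P b) by rewrite lead_coefE sP.
  by rewrite lead_coef_eq0 -size_poly_eq0 sP.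
have e : T *m (\matrix_(i, j) ell j (G * 'X^i)) = Mx *m (T *m (\matrix_(i, j) ell j 'X^i)).
  apply/matrixP => b j; rewrite !mxE.
  transitivity (ell j (G * P b)).
    rewrite (PE b) mulr_sumr.
    under [in RHS]eq_bigr do rewrite -scalerAr.
    by rewrite lin_sum; apply: eq_bigr => i _; congr (_ * _); rewrite mxE.
  rewrite hM; apply: eq_bigr => a _; congr (_ * _); rewrite mxE (PE a) lin_sum.
  by apply: eq_bigr => i _; congr (_ * _); rewrite mxE.
have := congr1 determinant e; rewrite !det_mulmx mulrCA => h.
exact: (mulfI dT h).
Qed.

Section PsiBasis.
Context {R : realType} (be tau c : R).
Hypotheses (be_gt0 : 0 < be) (tau0 : tau != 0).

Lemma size_Psi_aff (C : {poly R}) b : size C = b.+1 -> size (Psi_aff be tau c C) = b.+1.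
Proof.
move=> sC; have sC' : size (C \Po aff tau c) = b.+1 by rewrite size_comp_aff.
apply/eqP; rewrite eqn_leq -{1}sC' size_Psi //= ltnNge; apply/negP => h.
have := coef_Psi_lead be sC'; rewrite nth_default // => /esym/eqP.
rewrite mulf_eq0 invr_eq0 (negPf (poch_neq0 be_gt0 b)) orbF.
have -> : (C \Po aff tau c)`_b = lead_coef (C \Po aff tau c) by rewrite lead_coefE sC'.
by rewrite lead_coef_eq0 -size_poly_eq0 sC'.
Qed.

Lemma Psi_aff_onto (p : {poly R}) : exists C, p = Psi_aff be tau c C.
Proof.
elim/poly_ind: p => [|p x [C ->]]; first by exists 0; rewrite linear0.
exists (diffop (be *: affinv tau c) (tau *: (affinv tau c * (affinv tau c + 1))) C + x%:P).
have P1 : Psi_aff be tau c x%:P = x%:P.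
  have -> : x%:P = x *: 'X^0 :> {poly R} by rewrite expr0 alg_polyC.
  rewrite /Psi_aff comp_polyZ expr0 -polyC1 comp_polyC linearZ /= polyC1 -(expr0 'X) PsiXn.
  by rewrite /npoly pochhammer0 invr1 scale1r /ffact_poly big_ord0 expr0.
rewrite linearD /= P1 mulrC; congr (_ + _).
have := mulX_Psi_aff be_gt0 1 c tau0 C.
by rewrite /meix_p1 /meix_p2 !divr1 invr1 scale1r.
Qed.

End PsiBasis.

Section TupleMeasurability.
Context {n : nat}.

Lemma measurable_tuple_set1 (t : n.-tuple nat) : measurable [set t].
Proof.
have -> : [set t] = \bigcap_(i in [set: 'I_n]) ((@tnth n nat)^~ i @^-1` [set tnth t i]).
  apply/seteqP; split => [s -> i _ //|s /= h].
  by apply: eq_from_tnth => i; apply: h.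
apply: fin_bigcap_measurable => [|i _]; first exact: finite_finset.
rewrite -[X in measurable X]setTI; apply: measurable_tnth => //.
Qed.

Lemma measurable_tuple_set (A : set (n.-tuple nat)) : measurable A.
Proof.
have -> : A = \bigcup_k (if (unpickle k : option (n.-tuple nat)) is Some t
                         then [set s | s = t /\ A t] else set0).
  apply/seteqP; split => [t At|t [k _]].
    by exists (pickle t) => //; rewrite pickleK.
  by case: (unpickle k) => // s [-> //].
apply: bigcupT_measurable => k; case: (unpickle k) => [t|//].
have [At|nAt] := pselect (A t).
  rewrite (_ : [set s | _] = [set t]); first exact: measurable_tuple_set1.
  by apply/seteqP; split => [s []|s ->].
by rewrite (_ : [set s | _] = set0) //; apply/seteqP; split => [s []|].
Qed.

Lemma measurable_tuple_fun d (T : measurableType d) (H : n.-tuple nat -> T) :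
  measurable_fun setT H.
Proof. by move=> _ Y _; apply: measurable_tuple_set. Qed.

End TupleMeasurability.

Section BoxSums.
Context {R : realType} d (T : measurableType d) (P : probability T R) (n : nat).
Variable x : {RV P >-> n.-tuple nat}.
Implicit Type H : n.-tuple nat -> R.

Definition mass (t : n.-tuple nat) : R := fine (distribution P x [set t]).

Lemma massE t : distribution P x [set t] = (mass t)%:E.
Proof. by rewrite /mass fineK //; apply: fin_num_measure; apply: measurable_tuple_set1. Qed.

Lemma mass_ge0 t : 0 <= mass t.
Proof. by rewrite -lee_fin -massE. Qed.

Definition box M (y : {ffun 'I_n -> 'I_M}) : n.-tuple nat := [tuple (y i : nat) | i < n].
Definition in_box M (t : n.-tuple nat) := [forall i, (tnth t i < M)%N].

Lemma box_inj M : injective (@box M).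
Proof.
move=> y z e; apply/ffunP => i; apply/val_inj.
by have := congr1 (fun t => tnth t i) e; rewrite !tnth_mktuple.
Qed.

Lemma in_boxP M t : in_box M t -> exists y : {ffun 'I_n -> 'I_M}, t = box y.
Proof.
move/forallP => h; exists [ffun i => Ordinal (h i)].
by apply: eq_from_tnth => i; rewrite tnth_mktuple ffunE.
Qed.

Lemma box_in_box M (y : {ffun 'I_n -> 'I_M}) : in_box M (box y).
Proof. by apply/forallP => i; rewrite tnth_mktuple ltn_ord. Qed.

Definition box_sum H M := \sum_(y : {ffun 'I_n -> 'I_M}) H (box y) * mass (box y).

Lemma measurable_comp_tupleR H : measurable_fun setT (H \o x).
Proof. exact: (measurableT_comp (@measurable_tuple_fun n _ _ H)). Qed.

Lemma integral_box H M : (forall t, 0 <= H t) ->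
  (\int[P]_w (H (x w) * (in_box M (x w))%:R)%:E = (box_sum H M)%:E)%E.
Proof.
move=> H0.
transitivity (\int[P]_w (\sum_(y : {ffun 'I_n -> 'I_M})
    (H (box y))%:E * (\1_(x @^-1` [set box y]) w)%:E))%E.
  apply: eq_integral => w _; case: (boolP (in_box M (x w))) => [/in_boxP [y e]|h].
    rewrite mulr1 e (bigD1 y) //= indicE (_ : (w \in _) = true); last exact: mem_set.
    rewrite mule1 big1 ?adde0 // => z zy; rewrite indicE (_ : (w \in _) = false) ?mule0 //.
    apply/negbTE; rewrite notin_setE /= e => ez.
    by move: zy; rewrite (box_inj ez) eqxx.
  rewrite mulr0 big1 // => y _; rewrite indicE (_ : (w \in _) = false) ?mule0 //.
  by apply/negbTE; rewrite notin_setE /= => e; rewrite e box_in_box in h.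
have mx y : measurable (x @^-1` [set box y] : set T).
  exact: (measurable_funPTI x (measurable_tuple_set _)).
rewrite ge0_integral_sum //; last 2 first.
- by move=> y; apply: measurable_funeM; apply/measurable_EFinP; apply: measurable_indic.
- by move=> y w _; rewrite mule_ge0 // lee_fin.
rewrite /box_sum -sumEFin; apply: eq_bigr => y _.
rewrite ge0_integralZl_EFin //; last first.
  by apply/measurable_EFinP; apply: measurable_indic.
rewrite integral_indic // setIT EFinM; congr (_ * _)%E.
by rewrite -massE.
Qed.

Definition tmean H : R := fine (\int[P]_w (H (x w))%:E)%E.

Lemma ge0_box_limit H C : (forall t, 0 <= H t) -> (forall M, box_sum H M <= C) ->
  P.-integrable setT (fun w => (H (x w))%:E) /\ box_sum H M @[M --> \oo] --> tmean H.
Proof.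
move=> H0 HC.
pose g M w : \bar R := (H (x w) * (in_box M (x w))%:R)%:E.
have gE w M : (\sum_(i < n) tnth (x w) i < M)%N -> g M w = (H (x w))%:E.
  move=> h; rewrite /g (_ : in_box M (x w) = true) ?mulr1 //; apply/forallP => i.
  by apply: leq_ltn_trans h; rewrite (bigD1 i) //= leq_addr.
have limg w : limn (g ^~ w) = (H (x w))%:E.
  apply: lim_near_cst => //; near=> M; apply: gE.
  by near: M; exists (\sum_(i < n) tnth (x w) i).+1.
have mg M : measurable_fun setT (g M).
  apply/measurable_EFinP; exact: (measurable_comp_tupleR (fun t => H t * (in_box M t)%:R)).
have g0 M w : setT w -> (0 <= g M w)%E by move=> _; rewrite lee_fin mulr_ge0.
have gm w : setT w -> {homo g^~ w : M N / (M <= N)%N >-> (M <= N)%E}.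
  move=> _ M N MN; rewrite lee_fin ler_wpM2l // ler_nat.
  case: (boolP (in_box M (x w))) => // /forallP h.
  by rewrite (_ : in_box N (x w) = true) //; apply/forallP => i; apply: leq_trans MN.
have cv := cvg_monotone_convergence measurableT mg g0 gm.
have {cv} cv : ((box_sum H M)%:E @[M --> \oo] --> \int[P]_w (H (x w))%:E)%E.
  rewrite (_ : (fun M => (box_sum H M)%:E) = fun M => (\int[P]_w g M w)%E).
    by rewrite (eq_integral (fun w => limn (g ^~ w))) // => w _; rewrite limg.
  by apply/funext => M; rewrite integral_box.
have mH : measurable_fun setT (fun w => (H (x w))%:E).
  by apply/measurable_EFinP; exact: (measurable_comp_tupleR H).
have Hfin : (\int[P]_w (H (x w))%:E \is a fin_num)%E.
  rewrite ge0_fin_numE; last by apply: integral_ge0 => w _; rewrite lee_fin.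
  apply: le_lt_trans (ltry C); rewrite -(cvg_lim _ cv) //.
  by apply: lime_le; [apply/cvg_ex; eexists; exact: cv | near=> M; rewrite lee_fin].
split.
  apply/integrableP; split => //.
  rewrite (eq_integral (fun w => (H (x w))%:E)); last by move=> w _; rewrite gee0_abs // lee_fin.
  by move: Hfin; rewrite fin_num_abs gee0_abs //; apply: integral_ge0 => w _; rewrite lee_fin.
rewrite /tmean; move: cv; rewrite -(fineK Hfin) => /fine_cvgP [_].
by [].
Unshelve. all: by end_near.
Qed.

Lemma box_sumD H1 H2 M : box_sum (fun t => H1 t + H2 t) M = box_sum H1 M + box_sum H2 M.
Proof. by rewrite /box_sum -big_split; apply: eq_bigr => y _; rewrite mulrDl. Qed.

Lemma box_limit H W C : (forall t, `|H t| <= W t) -> (forall M, box_sum W M <= C) ->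
  P.-integrable setT (fun w => (H (x w))%:E) /\ box_sum H M @[M --> \oo] --> tmean H.
Proof.
move=> HW WC.
have W0 t : 0 <= W t by apply: le_trans (HW t).
have [iW cW] := ge0_box_limit W0 WC.
have HW0 t : 0 <= H t + W t.
  by have := HW t; rewrite ler_norml => /andP[h _]; rewrite -lerBlDr sub0r.
have HWC M : box_sum (fun t => H t + W t) M <= C + C.
  rewrite (le_trans _ (lerD (WC M) (WC M))) // -box_sumD; apply: ler_sum => y _.
  rewrite ler_wpM2r ?mass_ge0 // lerD2r; exact: le_trans (ler_norm _) (HW _).
have [iHW cHW] := ge0_box_limit HW0 HWC.
have iH : P.-integrable setT (fun w => (H (x w))%:E).
  apply: (le_integrable measurableT _ _ iW).
    by apply/measurable_EFinP; exact: (measurable_comp_tupleR H).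
  by move=> w _; rewrite !abse_EFin lee_fin (le_trans (HW _)) // ler_norm.
split => //.
have -> : tmean H = tmean (fun t => H t + W t) - tmean W.
  have fH := integrable_fin_num measurableT iH; have fW := integrable_fin_num measurableT iW.
  have e : (\int[P]_w (H (x w) + W (x w))%:E
          = \int[P]_w (H (x w))%:E + \int[P]_w (W (x w))%:E)%E.
    by rewrite -integralD.
  rewrite /tmean e (fineD fH fW); by apply/esym/addrK.
apply: (@cvg_eq_near _ (fun M => box_sum (fun t => H t + W t) M - box_sum W M) _ _ 0%N).
  by move=> M _; rewrite box_sumD addrK.
exact: cvgB.
Qed.

End BoxSums.

Lemma cvg_prodr (R : realType) (I : Type) (s : seq I) (F : I -> nat -> R) (l : I -> R) :
  (forall i, F i n @[n --> \oo] --> l i) ->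
  \prod_(i <- s) F i n @[n --> \oo] --> \prod_(i <- s) l i.
Proof. by move=> h; apply: cvg_big => //; apply: mul_continuous. Qed.

Lemma cvg_det (R : realType) n (A : nat -> 'M[R]_n) (B : 'M[R]_n) :
  (forall i j, A M i j @[M --> \oo] --> B i j) ->
  \det (A M) @[M --> \oo] --> \det B.
Proof.
move=> h; apply: cvg_sumr => s _; apply: cvgM; first exact: cvg_cst.
by apply: cvg_prodr => i; apply: h.
Qed.

Lemma det_le (R : realType) n (A : 'M[R]_n) :
  `|\det A| <= n`!%:R * \prod_i \sum_j `|A i j|.
Proof.
rewrite /determinant (le_trans (ler_norm_sum _ _ _)) //.
have -> : n`!%:R * \prod_i \sum_j `|A i j| = \sum_(s : 'S_n) \prod_i \sum_j `|A i j|.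
  by rewrite sumr_const card_Sn mulr_natl.
apply: ler_sum => s _; rewrite normrM normrX normrN1 expr1n mul1r normr_prod.
apply: ler_prod => i _; rewrite normr_ge0 /= (bigD1 (s i)) //= lerDl.
by apply: sumr_ge0.
Qed.

Lemma det_row_scale (R : comNzRingType) n (A : 'M[R]_n) (d : 'I_n -> R) :
  \det (\matrix_(i, j) (d i * A i j)) = (\prod_i d i) * \det A.
Proof.
have -> : \matrix_(i, j) (d i * A i j) = diag_mx (\row_i d i) *m A.
  by apply/matrixP => i j; rewrite mul_diag_mx !mxE.
by rewrite det_mulmx det_diag; congr (_ * _); apply: eq_bigr => i _; rewrite mxE.
Qed.

Section Ensemble.
Context {R : realType} d (T : measurableType d) (P : probability T R) (n : nat).
Variable x : {RV P >-> n.-tuple nat}.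
Variables (g : 'I_n -> nat -> R) (mu : nat -> R) (Z : R).
Variable ell : 'I_n -> {poly R} -> R.
Hypothesis g_ge0 : forall j y, 0 <= g j y.
Hypothesis mu_ge0 : forall y, 0 <= mu y.
Hypothesis massP : forall t, mass x t =
  Z^-1 * (\det (\matrix_(i < n, j < n) ((tnth t i)%:R ^+ j : R))
          * \det (\matrix_(i < n, j < n) g j (tnth t i)) * \prod_(j < n) mu (tnth t j)).
Hypothesis ellP : forall j (p : {poly R}), has_sum (fun y => p.[y%:R] * (g j y * mu y)) (ell j p).

Definition tprod (G : {poly R}) (t : n.-tuple nat) : R := \prod_i G.[(tnth t i)%:R].

Lemma box_sum_tprod G M : box_sum x (tprod G) M = Z^-1 * (n`!%:R *
  \det (\matrix_(i, j) \sum_(y < M) (G * 'X^i).[y%:R] * (g j y * mu y))).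
Proof.
pose phi (j : 'I_n) (y : 'I_M) : R := y%:R ^+ j.
pose psi (j : 'I_n) (y : 'I_M) : R := (G.[y%:R] * mu y) * g j y.
have -> : \matrix_(i, j) \sum_(y < M) (G * 'X^i).[y%:R] * (g j y * mu y)
        = \matrix_(i, j) \sum_y phi i y * psi j y.
  apply/matrixP => i j; rewrite !mxE; apply: eq_bigr => y _.
  by rewrite hornerM hornerXn /phi /psi; ring.
rewrite -andreief mulr_sumr; apply: eq_bigr => y _.
have -> : \det (\matrix_(i, j) psi j (y i)) =
    (\prod_i (G.[(y i : nat)%:R] * mu (y i))) * \det (\matrix_(i, j) g j (y i)).
  rewrite -det_row_scale; congr (\det _); apply/matrixP => i j.
  by rewrite !mxE.
rewrite massP big_split /= /tprod.
have -> : \prod_i G.[(tnth (box y) i)%:R] = \prod_i G.[(y i : nat)%:R].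
  by apply: eq_bigr => i _; rewrite tnth_mktuple.
have -> : \prod_(j < n) mu (tnth (box y) j) = \prod_i mu (y i).
  by apply: eq_bigr => i _; rewrite tnth_mktuple.
have -> : \matrix_(i < n, j < n) g j (tnth (box y) i) = \matrix_(i, j) g j (y i).
  by apply/matrixP => i j; rewrite !mxE tnth_mktuple.
have -> : \matrix_(i < n, j < n) ((tnth (box y) i)%:R ^+ j : R) = \matrix_(i, j) phi j (y i).
  by apply/matrixP => i j; rewrite !mxE tnth_mktuple.
by rewrite -!mulrA mulrCA; congr (_ * _); ring.
Qed.

Lemma has_sum_ge0_le (f : nat -> R) l : (forall y, 0 <= f y) -> has_sum f l ->
  forall M, \sum_(y < M) f y <= l.
Proof.
move=> f0 h M; rewrite -(cvg_lim _ h) //; apply: nondecreasing_cvgn_le.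
  by apply/nondecreasing_seqP => N; rewrite big_ord_recr /= lerDl.
by apply/cvg_ex; exists l.
Qed.

Lemma box_sum_bounded (w : {poly R}) : (forall y : nat, 0 <= w.[y%:R]) ->
  exists C, forall M, box_sum x (tprod w) M <= C.
Proof.
move=> w0; pose V : {poly R} := \sum_(l < n) 'X^l.
have VE (y : nat) : V.[y%:R] = \sum_(l < n) y%:R ^+ l.
  by rewrite horner_sum; apply: eq_bigr => l _; rewrite hornerXn.
have V0 (y : nat) : 0 <= V.[y%:R] by rewrite VE sumr_ge0.
pose c y := \sum_j (w * V).[y%:R] * (g j y * mu y).
have c0 y : 0 <= c y by apply: sumr_ge0 => j _; rewrite hornerM !mulr_ge0.
have hc : has_sum c (\sum_j ell j (w * V)) by apply: has_sum_sum => j; apply: ellP.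
exists (`|Z^-1| * n`!%:R * n`!%:R * (\sum_j ell j (w * V)) ^+ n) => M.
have mt (t : n.-tuple nat) : tprod w t * mass x t
   <= `|Z^-1| * n`!%:R * n`!%:R * \prod_i c (tnth t i).
  have e : mass x t = `|Z^-1| * (`|\det (\matrix_(i < n, j < n) ((tnth t i)%:R ^+ j : R))|
     * `|\det (\matrix_(i < n, j < n) (mu (tnth t i) * g j (tnth t i)))|).
    have -> : \matrix_(i < n, j < n) (mu (tnth t i) * g j (tnth t i)) = \matrix_(i, j)
      (mu (tnth t i) * (\matrix_(i < n, j < n) g j (tnth t i)) i j).
      by apply/matrixP => i j; rewrite !mxE.
    rewrite det_row_scale -[LHS]ger0_norm ?mass_ge0 // massP !normrM; ring.
  rewrite e; have tw0 : 0 <= tprod w t by apply: prodr_ge0 => i _; exact: w0.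
  have -> : `|Z^-1| * n`!%:R * n`!%:R * \prod_i c (tnth t i)
    = tprod w t * (`|Z^-1| * ((n`!%:R * \prod_i V.[(tnth t i)%:R]) *
        (n`!%:R * \prod_i \sum_j (mu (tnth t i) * g j (tnth t i))))).
    have -> : \prod_i c (tnth t i) = tprod w t * ((\prod_i V.[(tnth t i)%:R]) *
         \prod_i \sum_j (mu (tnth t i) * g j (tnth t i))).
      rewrite /tprod -!big_split /=; apply: eq_bigr => i _; rewrite /c -mulr_sumr hornerM -mulrA.
      by congr (_ * (_ * _)); apply: eq_bigr => j _; rewrite mulrC.
    ring.
  rewrite ler_wpM2l // ler_wpM2l //; apply: ler_pM => //.
    apply: le_trans (det_le _) _; rewrite ler_wpM2l // ler_prod // => i _.
    rewrite sumr_ge0 //= VE; apply: ler_sum => j _.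
    by rewrite mxE ger0_norm ?exprn_ge0.
  apply: le_trans (det_le _) _; rewrite ler_wpM2l // ler_prod // => i _.
  rewrite sumr_ge0 //=; apply: ler_sum => j _.
  by rewrite mxE ger0_norm ?mulr_ge0.
apply: (@le_trans _ _ (\sum_(y : {ffun 'I_n -> 'I_M})
   `|Z^-1| * n`!%:R * n`!%:R * \prod_i c (y i))).
  apply: ler_sum => y _; apply: le_trans (mt _) _.
  by rewrite ler_wpM2l ?mulr_ge0 // ler_prod // => i _; rewrite c0 tnth_mktuple /=.
rewrite -mulr_sumr ler_wpM2l ?mulr_ge0 //.
rewrite -(bigA_distr_bigA (fun (i : 'I_n) (y : 'I_M) => c y)) /= prodr_const card_ord.
have l0 : 0 <= \sum_j ell j (w * V).
  by have := has_sum_ge0_le c0 hc 0%N; rewrite big_ord0.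
rewrite lerXn2r // ?nnegrE ?sumr_ge0 //.
exact: (has_sum_ge0_le c0 hc M).
Qed.

Lemma mean_tprod G : tmean x (tprod G) =
  Z^-1 * (n`!%:R * \det (\matrix_(i, j) ell j (G * 'X^i))).
Proof.
pose w := \poly_(l < size G) `|G`_l|.
have wE (y : nat) : w.[y%:R] = \sum_(l < size G) `|G`_l| * y%:R ^+ l by rewrite horner_poly.
have [C hC] : exists C, forall M, box_sum x (tprod w) M <= C.
  by apply: box_sum_bounded => y; rewrite wE sumr_ge0 // => l _; rewrite mulr_ge0.
have [_ h] : P.-integrable setT (fun v => (tprod G (x v))%:E)
    /\ box_sum x (tprod G) M @[M --> \oo] --> tmean x (tprod G).
  apply: box_limit hC => t; rewrite /tprod normr_prod; apply: ler_prod => i _.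
  rewrite normr_ge0 /= wE horner_coef (le_trans (ler_norm_sum _ _ _)) //.
  by apply: ler_sum => l _; rewrite normrM normrX normr_nat.
apply: (cvg_unique _ h) => //.
apply: (@cvg_eq_near _ _ _ _ 0%N) => [M _|]; first exact: box_sum_tprod.
apply: cvgMr; apply: cvgMr; apply: cvg_det => i j.
have h2 : \sum_(y < M) (G * 'X^i).[y%:R] * (g j y * mu y) @[M --> \oo] --> ell j (G * 'X^i).
  exact: ellP.
rewrite [X in _ --> X]mxE; apply: cvg_eq_near h2 => M _.
by rewrite mxE.
Unshelve. exact: 0%N.
Qed.

End Ensemble.

Section TruncatedExponential.
Context {R : realType} (K : nat).

Definition exp_trunc (a : R) : {poly R} := \poly_(k < K.+1) (a ^+ k / k`!%:R).

Lemma exp_truncD a b : eqmodX K.+1 (exp_trunc a * exp_trunc b) (exp_trunc (a + b)).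
Proof.
move=> k kK; rewrite coefM coef_poly kK [a + b]addrC exprDn mulr_suml.
apply: eq_bigr => j _; have jk := ltn_ord j.
rewrite !coef_poly !ifT; try lia.
rewrite -[_ *+ 'C(k, j)]mulr_natl [RHS]mulrAC invf_fact_bin; last by lia.
by ring.
Qed.

Lemma exp_trunc_sum n (a : 'I_n -> R) :
  eqmodX K.+1 (\prod_i exp_trunc (a i)) (exp_trunc (\sum_i a i)).
Proof.
elim: n a => [|n IH] a.
  rewrite !big_ord0 => k kK; rewrite coef1 coef_poly kK expr0n.
  by case: k kK => [|k] _ /=; rewrite ?fact0 ?divr1 ?mul0r.
rewrite !big_ord_recl; apply: eqmodX_trans (exp_truncD _ _).
by apply: eqmodXM => //; apply: IH.
Qed.

Lemma horner_nat_inj (p q : {poly R}) : (forall z, p.[z] = q.[z]) -> p = q.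
Proof.
move=> h; apply/eqP; rewrite -subr_eq0; apply/eqP; set r := p - q.
apply: (@roots_geq_poly_eq0 _ _ [seq k%:R | k <- iota 0 (size r)]).
- by apply/allP => z _; rewrite /root /r hornerD hornerN h subrr.
- rewrite map_inj_uniq ?iota_uniq // => i j /eqP.
  by rewrite eqr_nat => /eqP.
by rewrite size_map size_iota.
Qed.

End TruncatedExponential.

Section Tame.
Context {R : realType} d (T : measurableType d) (P : probability T R) (n : nat).
Variable x : {RV P >-> n.-tuple nat}.
Implicit Type H : n.-tuple nat -> R.

Hypothesis bounded : forall w : {poly R}, (forall y : nat, 0 <= w.[y%:R]) ->
  exists C, forall M, box_sum x (fun t => \prod_i w.[(tnth t i)%:R]) M <= C.

Definition tame H := exists2 C : R, 0 <= C & exists2 w : {poly R},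
  (forall y : nat, 1 <= w.[y%:R]) & forall t, `|H t| <= C * \prod_i w.[(tnth t i)%:R].

Lemma tame_cst c : tame (fun=> c).
Proof.
exists `|c| => //; exists 1 => [y|t]; first by rewrite hornerC.
by rewrite big1 ?mulr1 // => i _; rewrite hornerC.
Qed.

Lemma tameM H1 H2 : tame H1 -> tame H2 -> tame (fun t => H1 t * H2 t).
Proof.
move=> [C1 c1 [w1 hw1 h1]] [C2 c2 [w2 hw2 h2]].
exists (C1 * C2); first by rewrite mulr_ge0.
exists (w1 * w2) => [y|t]; first by rewrite hornerM mulr_ege1.
rewrite normrM (le_trans (ler_pM _ _ (h1 t) (h2 t))) //.
rewrite mulrACA -big_split /=; under [in leRHS]eq_bigr do rewrite hornerM.
by [].
Qed.

Lemma tameD H1 H2 : tame H1 -> tame H2 -> tame (fun t => H1 t + H2 t).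
Proof.
move=> [C1 c1 [w1 hw1 h1]] [C2 c2 [w2 hw2 h2]].
have p1 y : 0 <= w1.[y%:R] by apply: le_trans (hw1 y).
have p2 y : 0 <= w2.[y%:R] by apply: le_trans (hw2 y).
exists (C1 + C2); first by rewrite addr_ge0.
exists (w1 + w2) => [y|t]; first by rewrite hornerD ler_wpDr.
rewrite (le_trans (ler_normD _ _)) // mulrDl lerD //.
  rewrite (le_trans (h1 t)) // ler_wpM2l // ler_prod // => i _.
  by rewrite p1 hornerD lerDl p2.
rewrite (le_trans (h2 t)) // ler_wpM2l // ler_prod // => i _.
by rewrite p2 hornerD lerDr p1.
Qed.

Lemma tame_sum I (s : seq I) (H : I -> n.-tuple nat -> R) :
  (forall i, tame (H i)) -> tame (fun t => \sum_(i <- s) H i t).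
Proof.
move=> h; elim: s => [|i s IH].
  by under eq_fun do rewrite big_nil; apply: tame_cst.
by under eq_fun do rewrite big_cons; apply: tameD.
Qed.

Lemma tameX H k : tame H -> tame (fun t => H t ^+ k).
Proof.
move=> h; elim: k => [|k IH]; first by under eq_fun do rewrite expr0; apply: tame_cst.
by under eq_fun do rewrite exprS; apply: tameM.
Qed.

Lemma tame_horner (h : {poly R}) i : tame (fun t => h.[(tnth t i)%:R]).
Proof.
exists 1 => //; exists (1 + \poly_(l < size h) `|h`_l|).
  by move=> y; rewrite hornerD hornerC horner_poly lerDl sumr_ge0 // => l _; rewrite mulr_ge0.
move=> t; rewrite mul1r (bigD1 i) //=.
have h1 (y : nat) : 1 <= (1 + \poly_(l < size h) `|h`_l|).[y%:R] :> R.
  by rewrite hornerD hornerC horner_poly lerDl sumr_ge0 // => l _; rewrite mulr_ge0.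
rewrite -[leLHS]mulr1 ler_pM //; last first.
  by elim/big_ind: _ => // a b; exact: mulr_ege1.
rewrite hornerD hornerC horner_poly horner_coef ler_wpDl // (le_trans (ler_norm_sum _ _ _)) //.
by apply: ler_sum => l _; rewrite normrM normrX normr_nat.
Qed.

Lemma tame_limit H : tame H ->
  P.-integrable setT (fun w => (H (x w))%:E) /\ box_sum x H M @[M --> \oo] --> tmean x H.
Proof.
move=> [C c [w hw h]].
have [B hB] := bounded (fun y => le_trans ler01 (hw y)).
apply: (@box_limit _ _ _ _ _ _ _ (fun t => C * \prod_i w.[(tnth t i)%:R]) (C * B) h).
move=> M; apply: le_trans (ler_wpM2l c (hB M)).
by rewrite /box_sum mulr_sumr; apply: ler_sum => y _; rewrite mulrA.
Qed.

Lemma tame_integrable H : tame H -> P.-integrable setT (fun w => (H (x w))%:E).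
Proof. by case/tame_limit. Qed.

Lemma tmean_sum I (s : seq I) (c : I -> R) (H : I -> n.-tuple nat -> R) :
  (forall i, tame (H i)) ->
  tmean x (fun t => \sum_(i <- s) c i * H i t) = \sum_(i <- s) c i * tmean x (H i).
Proof.
move=> h.
have hs : tame (fun t => \sum_(i <- s) c i * H i t).
  by apply: tame_sum => i; apply: tameM => //; apply: tame_cst.
have [_ h1] := tame_limit hs.
apply: (cvg_unique _ h1) => //.
apply: (@cvg_eq_near _ (fun M => \sum_(i <- s) c i * box_sum x (H i) M) _ _ 0%N).
  move=> M _; rewrite /box_sum.
  under [RHS]eq_bigr do rewrite mulr_sumr.
  rewrite [RHS]exchange_big /=; apply: eq_bigr => y _; rewrite mulr_suml.
  by apply: eq_bigr => i _; rewrite mulrA.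
by apply: cvg_sumr => i _; apply: cvgMr; have [] := tame_limit (h i).
Qed.

(** The coefficients of the polynomial [Q] are the normalized moments of the
    linear statistic, since [Q] and the expectation of the product of the
    truncated exponentials agree at every real number. *)
Lemma moment_coef (h Q : {poly R}) K :
  (forall lam, tmean x (fun t =>
     \prod_i (\sum_(k < K.+1) (lam ^+ k / k`!%:R) *: h ^+ k).[(tnth t i)%:R]) = Q.[lam]) ->
  forall k, (k <= K)%N ->
  Q`_k = tmean x (fun t => (\sum_i h.[(tnth t i)%:R]) ^+ k / k`!%:R).
Proof.
move=> hQ k kK.
pose Gp (t : n.-tuple nat) := \prod_i exp_trunc K h.[(tnth t i)%:R].
pose N := (n * K).+1.
have sG t : (size (Gp t) <= N)%N.
  rewrite (leq_trans (size_poly_prod_leq _ _)) // /N card_ord leq_subLR addnS ltnS.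
  have -> : (n + n * K = \sum_(i < n) K.+1)%N by rewrite sum_nat_const card_ord mulnS.
  by apply: leq_sum => i _; apply: size_poly.
have tG l : tame (fun t => (Gp t)`_l).
  rewrite /Gp; elim: (index_enum _) l => [|i s IH] l.
    by under eq_fun do rewrite big_nil coef1; apply: tame_cst.
  under eq_fun do rewrite big_cons coefM.
  apply: tame_sum => j; apply: tameM; last exact: IH.
  under eq_fun do rewrite coef_poly; case: (j < K.+1)%N; last exact: tame_cst.
  by apply: tameM; [apply: tameX; apply: tame_horner | apply: tame_cst].
have E lam : Q.[lam] = \sum_(l < N) lam ^+ l * tmean x (fun t => (Gp t)`_l).
  rewrite -hQ -tmean_sum //; congr (tmean x _); apply/funext => t.
  transitivity (Gp t).[lam].
    rewrite /Gp horner_prod; apply: eq_bigr => i _; rewrite horner_poly horner_sum.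
    by apply: eq_bigr => l _; rewrite hornerZ horner_exp; ring.
  by rewrite (horner_coef_wide _ (sG t)); apply: eq_bigr => l _; rewrite mulrC.
have -> : Q = \poly_(l < N) tmean x (fun t => (Gp t)`_l).
  apply: horner_nat_inj => z; rewrite E horner_poly.
  by apply: eq_bigr => l _; rewrite mulrC.
rewrite coef_poly.
have -> : tmean x (fun t => (\sum_i h.[(tnth t i)%:R]) ^+ k / k`!%:R)
        = tmean x (fun t => (Gp t)`_k).
  congr (tmean x _); apply/funext => t.
  by rewrite (exp_trunc_sum (K := K)) // coef_poly ltnS kK.
case: ltnP => // Nk.
rewrite (_ : (fun t => (Gp t)`_k) = fun=> 0); last first.
  by apply/funext => t; rewrite nth_default // (leq_trans (sG t)).
by rewrite /tmean integral0_eq.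
Qed.

(** The normalized central moments. *)
Lemma centered_moment_coef (h Q : {poly R}) K :
  (forall lam, tmean x (fun t =>
     \prod_i (\sum_(k < K.+1) (lam ^+ k / k`!%:R) *: h ^+ k).[(tnth t i)%:R]) = Q.[lam]) ->
  let S t := \sum_i h.[(tnth t i)%:R] in
  Q`_0 = 1 /\ forall k, (k <= K)%N -> (0 < K)%N ->
  tmean x (fun t => (S t - tmean x S) ^+ k / k`!%:R) = centered_coef Q k.
Proof.
move=> hQ S.
have tS : tame S by apply: tame_sum => i; apply: tame_horner.
have mc := moment_coef hQ.
split.
  rewrite mc // /tmean (eq_integral (cst 1%E)); last first.
    by move=> w _; rewrite expr0 fact0 divr1.
  rewrite integral_cst // mul1e; transitivity (fine (1%E : \bar R)) => //.
  by congr fine; exact: probability_setT.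
move=> k kK K0; have Q1 : Q`_1 = tmean x S.
  by rewrite mc //; congr (tmean x _); apply/funext => t; rewrite expr1 divr1.
rewrite /centered_coef Q1; set e := tmean x S.
transitivity (\sum_(i < k.+1) ((- e) ^+ (k - i) / (k - i)`!%:R) *
    tmean x (fun t => S t ^+ i / i`!%:R)).
  rewrite -tmean_sum; last first.
    by move=> i; apply: tameM; [apply: tameX | apply: tame_cst].
  congr (tmean x _); apply/funext => t; rewrite [S t - e]addrC exprDn mulr_suml.
  apply: eq_bigr => i _; have ik : (i <= k)%N by have := ltn_ord i; lia.
  rewrite -[_ *+ 'C(k, i)]mulr_natl [LHS]mulrAC invf_fact_bin //.
  by ring.
apply: eq_bigr => i _; rewrite mulrC mc //.
by have := ltn_ord i; lia.
Qed.

End Tame.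

Lemma mope_functions_nth (R : realType) m (w : 'I_m -> nat -> R) (k : 'I_m -> nat) j :
  (j < \sum_s k s)%N -> exists s l, (l < k s)%N /\
    nth (fun=> 0) (mope_functions w k) j = fun y : nat => y%:R ^+ l * w s y.
Proof.
move=> jk.
have sz : size (mope_functions w k) = (\sum_s k s)%N.
  rewrite /mope_functions size_flatten /shape -map_comp sumnE big_map.
  rewrite -[RHS]big_enum /=; apply: eq_bigr => s _.
  by rewrite /= size_map size_iota.
pose Q (g : nat -> R) := `[< exists s l, (l < k s)%N /\ g = fun y : nat => y%:R ^+ l * w s y >].
suff h : all Q (mope_functions w k).
  by apply/asboolP; apply: (all_nthP (fun=> 0) h); rewrite sz.
rewrite /mope_functions; elim: (enum 'I_m) => //= s ss IH; rewrite all_cat IH andbT.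
rewrite all_map; apply/allP => l; rewrite mem_iota /= add0n => lk.
by apply/asboolP; exists s, l.
Qed.

Section MeixnerEnsemble.
Context {R : realType} d (T : measurableType d) (P : probability T R) (n m : nat).
Variable x : {RV P >-> n.-tuple nat}.
Variables (tau a : R) (gamma : 'I_m -> R) (k : 'I_m -> nat).
Hypotheses (n_gt0 : (0 < n)%N) (tau_ge1 : 1 <= tau) (a01 : 0 < a < 1).
Hypothesis gamma01 : forall j, 0 < gamma j <= 1.
Hypothesis mopeP : is_mope (fun j y => gamma j ^+ y)
  (meixner_mass n (n%:R * tau) a) k (distribution P x).

Definition meix_be : R := n%:R * tau - n%:R + 1.
Definition meix_tau : R := (meix_be + n%:R) / n%:R.
Definition meix_u j : R := a * gamma j / (1 - a * gamma j).
Definition meix_c := shift_const n meix_u k.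
Definition meix_pole := pole n meix_tau meix_u k.
Definition meix_q := node_poly meix_pole k.
Definition meix_T := diffop (meix_p1 meix_be n meix_tau meix_c) (meix_p2 n meix_tau meix_c).

Lemma agamma01 j : 0 < a * gamma j < 1.
Proof.
case/andP: a01 => a0 a1; case/andP: (gamma01 j) => g0 g1.
by rewrite mulr_gt0 //= (le_lt_trans _ a1) // ler_piMr // ltW.
Qed.

Lemma meix_be_gt0 : 0 < meix_be.
Proof.
rewrite /meix_be ltr_wpDl // subr_ge0 ler_peMr //.
Qed.

Lemma meix_tauE : meix_tau * n%:R = meix_be + n%:R.
Proof. by rewrite /meix_tau divfK // pnatr_eq0 -lt0n. Qed.

Lemma meix_sum_k : (\sum_j k j)%N = n. Proof. by case: mopeP. Qed.

Lemma meix_tau_neq0 : meix_tau != 0.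
Proof. exact: (tau_neq0 meix_be_gt0 meix_tauE). Qed.

Let q_monic : meix_q \is monic := node_poly_monic meix_pole k.
Lemma size_meix_q : size meix_q = n.+1.
Proof. by rewrite size_node_poly meix_sum_k. Qed.

Let g j : nat -> R := nth (fun=> 0) (mope_functions (fun j y => gamma j ^+ y) k) j.
Let mu : nat -> R := meixner_mass n (n%:R * tau) a.
Let PA : {poly R} -> {poly R} := Psi_aff meix_be meix_tau meix_c.

Lemma g_mu (j : 'I_n) : exists s l, (l < k s)%N /\
  forall y, g j y * mu y = y%:R ^+ l * nb_mass meix_be (a * gamma s) y.
Proof.
have [|s [l [lk e]]] := @mope_functions_nth R m (fun j y => gamma j ^+ y) k j.
  by rewrite meix_sum_k.
exists s, l; split => // y; rewrite /g e /mu /meixner_mass /nb_mass -/meix_be.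
by rewrite exprMn; ring.
Qed.

Lemma mu_ge0 y : 0 <= mu y.
Proof.
rewrite /mu /meixner_mass -/meix_be divr_ge0 // mulr_ge0 //.
  by rewrite ltW // pochhammer_gt0 // meix_be_gt0.
by rewrite exprn_ge0 //; case/andP: a01 => /ltW.
Qed.

Lemma g_ge0 (j : 'I_n) y : 0 <= g j y.
Proof.
have [|s [l [lk e]]] := @mope_functions_nth R m (fun j y => gamma j ^+ y) k j.
  by rewrite meix_sum_k.
rewrite /g e mulr_ge0 ?exprn_ge0 //.
by case/andP: (gamma01 s) => /ltW.
Qed.

Let ell (j : 'I_n) (p : {poly R}) : R :=
  limn (fun M => \sum_(y < M) p.[y%:R] * (g j y * mu y)).

Lemma ellP (j : 'I_n) (p : {poly R}) : has_sum (fun y => p.[y%:R] * (g j y * mu y)) (ell j p).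
Proof.
have [s [l [lk e]]] := g_mu j.
have [C hC] := Psi_aff_onto meix_c meix_be_gt0 meix_tau_neq0 ('X^l * p).
have h : has_sum (fun y => p.[y%:R] * (g j y * mu y))
    (C.[meix_tau * (a * gamma s / (1 - a * gamma s)) + meix_c] * nb_total meix_be (a * gamma s)).
  apply: has_sum_ext (has_sum_Psi_aff meix_be_gt0 (tau := meix_tau) (c := meix_c)
     (C := C) (agamma01 s)) => y.
  by rewrite -hC hornerM hornerXn e; ring.
by apply/cvg_ex; eexists; exact: h.
Qed.

Lemma ell_linear (j : 'I_n) c p p' : ell j (c *: p + p') = c * ell j p + ell j p'.
Proof.
apply: (has_sum_unique (@ellP j _)).
apply: has_sum_ext (has_sumD (has_sumZ (c := c) (@ellP j p)) (@ellP j p')) => y.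
by rewrite hornerD hornerZ; ring.
Qed.

Lemma ell_orthogonal (j : 'I_n) H : ell j (PA (meix_q * H)) = 0.
Proof.
have [s [l [lk e]]] := g_mu j.
apply: (has_sum_unique (@ellP j _)).
have := @meixner_orthogonal R m n meix_be meix_tau meix_u k meix_be_gt0 n_gt0
  meix_sum_k meix_tauE s (a * gamma s) l H (agamma01 s) (erefl _) lk.
by apply: has_sum_ext => y; rewrite e.
Qed.

Variables (f : {poly R}) (K : nat).
Let fs := f \Po (n%:R^-1 *: 'X).
Let F := hornerop f meix_T.
Let A b c : R := coord n meix_q c (F (adapted n meix_q b)).
Let D := (size f).-1.

Lemma size_F C : (size (F C) <= size C + D)%N.
Proof.
apply: size_hornerop => B; apply: size_diffop; first exact: size_meix_p1.
exact: size_meix_p2.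
Qed.

Lemma iter_F j C : fs ^+ j * PA C = PA (iter j F C).
Proof.
elim: j => [|j IH]; first by rewrite expr0 mul1r.
by rewrite exprS -mulrA IH (horner_hornerop meix_be_gt0 _ _ meix_tau_neq0).
Qed.

Lemma ell_iter (j : 'I_n) l (b : 'I_n) :
  ell j (PA (iter l F (adapted n meix_q b)))
  = \sum_(c < n) ipow D A l b c * ell j (PA (adapted n meix_q c)).
Proof.
set B := iter l F _.
have ell0 p : ell j (0 *: p) = 0.
  by have := ell_linear j (-1) (0 *: p) (0 *: p); rewrite !scale0r scaler0 addr0 mulN1r addNr.
have sB : (size B <= n + l * D)%N.
  rewrite /B; elim: l {B} => [|l IH] /=; first by rewrite addn0 size_adapted ?size_meix_q.
  by rewrite (leq_trans (size_F _)) // (leq_trans (leq_add IH (leqnn D))) // mulSn; lia.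
rewrite (coord_sum q_monic size_meix_q sB) /PA linear_sum /=.
have ell_sum (I : Type) (s : seq I) (c : I -> R) (Q : I -> {poly R}) :
    ell j (\sum_(i <- s) c i *: Q i) = \sum_(i <- s) c i * ell j (Q i).
  elim: s => [|i s IH]; first by rewrite !big_nil -(scale0r 0) ell0.
  by rewrite !big_cons ell_linear IH.
under eq_bigr do rewrite linearZ /=.
rewrite -/PA ell_sum big_split_ord /= [X in _ + X]big1 ?addr0 => [|i _].
  apply: eq_bigr => c _; congr (_ * _).
  by rewrite /B (coord_iter q_monic size_meix_q size_F).
have -> : adapted n meix_q (n + i) = meix_q * 'X^i.
  by rewrite /adapted addnC exprD mulrA drop_polyMXn_id.
by rewrite ell_orthogonal mulr0.
Qed.

Lemma meixner_mean_prod lam : tmean x (fun t =>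
     \prod_i (\sum_(j < K.+1) (lam ^+ j / j`!%:R) *: fs ^+ j).[(tnth t i)%:R])
  = (\det (mxgen K.+1 (power_mx n D A))).[lam].
Proof.
set G := \sum_(j < K.+1) _.
have [_ [Z Z0 hZ]] := mopeP.
have massP t : mass x t = Z^-1 * (\det (\matrix_(i < n, j < n) ((tnth t i)%:R ^+ j : R))
          * \det (\matrix_(i < n, j < n) g j (tnth t i)) * \prod_(j < n) mu (tnth t j)).
  by rewrite /mass hZ.
have mt := mean_tprod (fun j y => @g_ge0 j y) mu_ge0 massP ellP.
pose Mx : 'M[R]_n := \matrix_(b, c) \sum_(j < K.+1) lam ^+ j / j`!%:R * ipow D A j b c.
have hM (b : 'I_n) j : ell j (G * PA (adapted n meix_q b))
    = \sum_c Mx b c * ell j (PA (adapted n meix_q c)).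
  rewrite /G mulr_suml.
  have -> : \sum_(i < K.+1) (lam ^+ i / i`!%:R) *: fs ^+ i * PA (adapted n meix_q b)
    = \sum_(i < K.+1) (lam ^+ i / i`!%:R) *: PA (iter i F (adapted n meix_q b)).
    by apply: eq_bigr => i _; rewrite -scalerAl iter_F.
  have ell_sum (c : 'I_K.+1 -> R) (Q : 'I_K.+1 -> {poly R}) :
      ell j (\sum_i c i *: Q i) = \sum_i c i * ell j (Q i).
    have ell0 : ell j 0 = 0.
      by have := ell_linear j (-1) 0 0; rewrite scaler0 addr0 mulN1r addNr.
    elim: (index_enum _) => [|i s IH]; first by rewrite !big_nil ell0.
    by rewrite !big_cons ell_linear IH.
  rewrite ell_sum; under eq_bigr do rewrite ell_iter mulr_sumr.
  rewrite exchange_big /=; apply: eq_bigr => c _; rewrite mxE mulr_suml.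
  by apply: eq_bigr => i _; rewrite mulrA.
have sP b : (b < n)%N -> size (PA (adapted n meix_q b)) = b.+1.
  by move=> _; apply: size_Psi_aff; rewrite ?meix_be_gt0 ?meix_tau_neq0 ?size_adapted ?size_meix_q.
have det1 : Z^-1 * (n`!%:R * \det (\matrix_(i, j) ell j 'X^i)) = 1.
  have := mt 1; rewrite (_ : tmean x (tprod 1) = 1).
    by under eq_mx do rewrite mul1r.
  rewrite /tmean (eq_integral (cst 1%E)); last first.
    by move=> w _; rewrite /tprod big1 // => i _; rewrite hornerC.
  rewrite integral_cst // mul1e; transitivity (fine (1%E : \bar R)) => //.
  by congr fine; exact: probability_setT.
rewrite -/(tprod G) [LHS]mt (det_functionals ell_linear sP hM).
transitivity (\det Mx).
  transitivity (\det Mx * (Z^-1 * (n`!%:R * \det (\matrix_(i, j) ell j 'X^i)))).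
    by rewrite [n`!%:R * (_ * _)]mulrCA [LHS]mulrCA.
  by rewrite det1 mulr1.
rewrite -[RHS]/(horner_eval lam _) -det_map_mx; congr (\det _).
apply/matrixP => b c; rewrite !mxE /= /horner_eval horner_poly.
by apply: eq_bigr => j _; rewrite mxE; ring.
Qed.

End MeixnerEnsemble.

Lemma symbol_polyE (R : realType) m (a b : 'I_m -> R) (f : {poly R}) L L' d :
  (d < L)%N -> (L <= L')%N -> (symbol_poly L a b f)`_d = (symbol_poly L' a b f)`_d.
Proof.
move=> dL LL; suff h : eqmodX L (symbol_poly L a b f) (symbol_poly L' a b f) by apply: h.
apply: eqmodX_sum => k _; apply: eqmodXZ; apply: eqmodXM => //; apply: eqmodX_exp => i iL.
by rewrite !coef_poly iL (leq_trans iL LL).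
Qed.

Section MeixnerLimit.
Context {R : realType} (m : nat) (tau a : R) (gamma : 'I_m -> R).
Variables (k : nat -> 'I_m -> nat) (nu : 'I_m -> R).
Variables (d : nat -> measure_display) (T : forall n, measurableType (d n)).
Variables (P : forall n, probability (T n) R) (x : forall n, {RV (P n) >-> n.-tuple nat}).
Variable f : {poly R}.
Hypotheses (tau_ge1 : 1 <= tau) (a01 : 0 < a < 1).
Hypothesis gamma01 : forall j, 0 < gamma j <= 1.
Hypothesis k_sum : forall n, (\sum_(j < m) k n j)%N = n.
Hypothesis k_lim : forall j, (k n j)%:R / n%:R @[n --> \oo] --> nu j.
Hypothesis mopeP : forall n, is_mope (fun j y => gamma j ^+ y)
               (meixner_mass n (n%:R * tau) a) (k n) (distribution (P n) (x n)).

Definition lim_residue j := tau * nu j * (a * gamma j) / (1 - a * gamma j) ^+ 2.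
Definition lim_pole j := tau * (a * gamma j) / (1 - a * gamma j)
              + \sum_(i < m) nu i / (1 - a * gamma i).

Let u := meix_u a gamma.
Let tn n := meix_tau n tau.
Let cn n := meix_c n a gamma (k n).

Lemma cvg_natV : n%:R^-1 @[n --> \oo] --> (0 : R).
Proof. by rewrite -cvg_shiftS; exact: cvg_harmonic. Qed.

Lemma agamma_neq1 j : 1 - a * gamma j != 0.
Proof. by rewrite subr_eq0 eq_sym lt_eqF //; case/andP: (agamma01 a01 gamma01 j). Qed.

Lemma cvg_tn : tn n @[n --> \oo] --> tau.
Proof.
apply: (@cvg_eq_near _ (fun n => tau + n%:R^-1) _ _ 1%N) => [n n0|].
  rewrite /tn /meix_tau /meix_be; field.
  by rewrite pnatr_eq0 -lt0n.
rewrite -[X in _ --> X]addr0; apply: cvgD; [exact: cvg_cst | exact: cvg_natV].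
Qed.

Lemma cvg_cn : cn n @[n --> \oo] --> \sum_(i < m) nu i / (1 - a * gamma i).
Proof.
apply: cvg_sumr => i _.
have -> : nu i / (1 - a * gamma i) = nu i * (1 + u i).
  by rewrite /u /meix_u; field; apply: agamma_neq1.
by apply: cvgM; [exact: k_lim | exact: cvg_cst].
Qed.

Lemma cvg_residue j : residue n (tn n) u (k n) j @[n --> \oo] --> lim_residue j.
Proof.
have -> : lim_residue j = tau * nu j * (u j * (1 + u j)).
  by rewrite /lim_residue /u /meix_u; field; apply: agamma_neq1.
apply: cvgM; last exact: cvg_cst.
by apply: cvgM; [exact: cvg_tn | exact: k_lim].
Qed.

Lemma cvg_pole j : pole n (tn n) u (k n) j @[n --> \oo] --> lim_pole j.
Proof.
apply: cvgD; last exact: cvg_cn.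
rewrite -mulrA; apply: cvgM; [exact: cvg_tn | exact: cvg_cst].
Qed.

Lemma cvg_meix_p2 i : (meix_p2 n (tn n) (cn n))`_i @[n --> \oo] --> (0 : R).
Proof.
have ct : (tn n)^-1 @[n --> \oo] --> tau^-1.
  by apply: cvgV; [rewrite gt_eqF // (lt_le_trans ltr01) | exact: cvg_tn].
have ca (l : nat) : exists z : R, (affinv (tn n) (cn n))`_l @[n --> \oo] --> z.
  exists (tau^-1 * ((l == 1%N)%:R - (\sum_(i < m) nu i / (1 - a * gamma i)) * (l == 0%N)%:R)).
  apply: (@cvg_eq_near _ (fun n => (tn n)^-1 * ((l == 1%N)%:R
      - cn n * (l == 0%N)%:R)) _ _ 0%N) => [n _|].
    by rewrite /affinv coefZ coefB coefX coefC; case: (l == 0%N); rewrite ?mulr1 ?mulr0.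
  apply: cvgM; first exact: ct.
  apply: cvgB; first exact: cvg_cst.
  by apply: cvgM; [exact: cvg_cn | exact: cvg_cst].
have [z hz] := choice ca.
pose w := \sum_(l < i.+1) z l * (z (i - l)%N + (i - l == 0)%N%:R).
suff : (meix_p2 n (tn n) (cn n))`_i @[n --> \oo] --> tau * 0 * w by rewrite mulr0 mul0r.
apply: (@cvg_eq_near _ (fun n => tn n * n%:R^-1 * \sum_(l < i.+1) (affinv (tn n) (cn n))`_l
   * ((affinv (tn n) (cn n))`_(i - l) + (i - l == 0)%N%:R)) _ _ 0%N) => [n _|].
  rewrite /meix_p2 coefZ coefM; congr (_ * _); apply: eq_bigr => l _.
  by rewrite coefD coef1.
apply: cvgM; first by apply: cvgM; [exact: cvg_tn | exact: cvg_natV].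
apply: cvg_sumr => l _; apply: cvgM; first exact: hz.
by apply: cvgD; [exact: hz | exact: cvg_cst].
Qed.

Let D := (size f).-1.

Definition limit_variance : R :=
  let Phi := symbol_poly (2 * D).+1 lim_residue lim_pole f in
  \sum_(s < D.+1) s%:R * Phi`_(D - s) * Phi`_(D + s).

Let S n (t : n.-tuple nat) := linear_statistic f t.

Lemma meixner_bounded n : (0 < n)%N -> forall w : {poly R}, (forall y : nat, 0 <= w.[y%:R]) ->
  exists C, forall M, box_sum (x n) (fun t => \prod_i w.[(tnth t i)%:R]) M <= C.
Proof.
move=> n0 w hw; have [_ [Z Z0 hZ]] := mopeP n.
exact: (box_sum_bounded (fun i y => @g_ge0 R _ _ (P n) n m (x n) tau a gamma (k n)
  gamma01 (mopeP n) i y) (mu_ge0 n tau_ge1 a01)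
  (fun t => etrans (erefl _) (congr1 fine (hZ t)))
  (@ellP R _ _ (P n) n m (x n) tau a gamma (k n) n0 tau_ge1 a01 gamma01 (mopeP n)) hw).
Qed.

(** Central moments of the linear statistic, normalized by factorials. *)
Lemma cvg_central_moment j :
  tmean (x n) (fun t => (S t - tmean (x n) (@S n)) ^+ j / j`!%:R) @[n --> \oo]
    --> gauss_coef limit_variance j.
Proof.
pose K := j.+1; pose L := (D + 2 * (K * D + D).+1 + K * D).+1.
pose q n := meix_q n tau a gamma (k n).
pose p1 n := meix_p1 (meix_be n tau) n (tn n) (cn n).
pose p2 n := meix_p2 n (tn n) (cn n).
pose F n := statistic_entry q p1 p2 f n.
have qm n : q n \is monic by apply: node_poly_monic.
have sq n : size (q n) = n.+1 by rewrite /q /meix_q size_node_poly k_sum.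
have s1 n : (size (p1 n) <= 2)%N by apply: size_meix_p1.
have s2 n : (size (p2 n) <= 3)%N by apply: size_meix_p2.
pose al n := residue n (tn n) u (k n).
pose be n := pole n (tn n) u (k n).
pose qs n := node_quot (be n) (k n).
have sqs n s : (size (qs n.+1 s) <= n.+1)%N by rewrite (leq_trans (size_node_quot _ _ _)) // k_sum.
have hq n s : (0 < n)%N -> al n s *: q n = al n s *: (('X - (be n s)%:P) * qs n s).
  by move=> n0; apply: meixner_residueE.
have ld n : (0 < n)%N -> p1 n * q n + p2 n * (q n)^`() = 'X * q n + \sum_s al n s *: qs n s.
  move=> n0; apply: (meixner_logder u (meix_be_gt0 n tau_ge1) n0 (k_sum n)).
  exact: meix_tauE.
have bF n : banded D (F n) by exact: (statistic_entry_banded qm sq s1 s2).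
have lF : loclim L F D (symbol_poly L lim_residue lim_pole f).
  exact: (loclim_statistic qm sq s1 s2 sqs hq ld cvg_residue cvg_pole cvg_meix_p2).
pose Q n := \det (mxgen K.+1 (power_mx n D (F n))).
have hQ n : (0 < n)%N -> (Q n)`_0 = 1 /\ forall l, (l <= K)%N -> (0 < K)%N ->
  tmean (x n) (fun t => (S t - tmean (x n) (@S n)) ^+ l / l`!%:R) = centered_coef (Q n) l.
  move=> n0; pose fs := f \Po (n%:R^-1 *: 'X).
  have SE : @S n = (fun t => \sum_i fs.[(tnth t i)%:R]).
    apply/funext => t; apply: eq_bigr => i _.
    by rewrite /fs horner_comp !hornerE mulrC.
  rewrite SE; apply: centered_moment_coef.
    exact: meixner_bounded.
  by move=> lam; apply: (meixner_mean_prod n0 tau_ge1 a01 gamma01 (mopeP n)).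
have Q0 n : (Q n)`_0 = 1.
  case: (posnP n) => [n0|/hQ []//]; rewrite /Q; clear -n0.
  by move: (mxgen _ _); rewrite n0 => A; rewrite det_mx00 coef1.
have main := @cvg_centered_coef R F D K L _ Q bF lF (ltnSn _) Q0 (fun n l _ => erefl _) j (leqnSn j).
have -> : limit_variance = \sum_(s < D.+1) s%:R * (symbol_poly L lim_residue lim_pole f)`_(D - s)
    * (symbol_poly L lim_residue lim_pole f)`_(D + s).
  apply: eq_bigr => s _; have sD := ltn_ord s.
  by congr (_ * _ * _); apply: symbol_polyE; rewrite /L; lia.
apply: (cvg_eq_near (N := 1)) main => n n0.
by have [_ ->] := hQ n n0.
Qed.

End MeixnerLimit.

Section Weierstrass.
Context {R : realType}.

Lemma heine (G : R -> R) (a b e : R) : continuous G -> 0 < e ->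
  exists2 del : R, 0 < del & forall s t, s \in `[a, b] -> `|s - t| < del -> `|G s - G t| < e.
Proof.
move=> cG e0; have := @segment_compact R a b.
move/compact_near_coveringP => /(_ R (0 : R)^'+
  (fun del s => forall t, `|s - t| < del -> `|G s - G t| < e)) => h.
have /h : forall s, [set` `[a, b]] s -> \forall s' \near s & del \near (0 : R)^'+,
    forall t, `|s' - t| < del -> `|G s' - G t| < e.
  move=> s _; have e2 : 0 < e / 2 by rewrite divr_gt0.
  have /cvgrPdist_lt /(_ _ e2) /nbhs_ballP [r /= r0 hr] := cG s.
  have r2 : 0 < r / 2 by rewrite divr_gt0.
  exists (ball s (r / 2), [set del | del < r / 2]) => /=.
    by split; [exact: nbhsx_ballx | exact: nbhs_right_lt].
  move=> [s' del] /= [hs' hdel] t hst.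
  rewrite -ball_normE /= in hs'.
  have h1 : `|G s - G s'| < e / 2.
    apply: hr; rewrite -ball_normE /=; apply: lt_trans hs' _.
    by rewrite ltr_pdivrMr // mulr_natr mulr2n ltrDl.
  have h2 : `|G s - G t| < e / 2.
    apply: hr; rewrite -ball_normE /= -(subrK s' s) -addrA.
    apply: le_lt_trans (ler_normD _ _) _.
    by rewrite [r]splitr ltrD // (lt_trans hst).
  rewrite (_ : G s' - G t = - (G s - G s') + (G s - G t)); last by ring.
  by apply: le_lt_trans (ler_normD _ _) _; rewrite normrN [e]splitr ltrD.
move=> hn; near (0 : R)^'+ => del; exists del => //.
by move=> s t sab; apply: (near hn del) => //; near: del.
Unshelve. all: by end_near.
Qed.

Definition bernstein (G : R -> R) N : {poly R} :=
  \sum_(k < N.+1) (G (k%:R / N%:R) *+ 'C(N, k)) *: ('X^k * (1 - 'X) ^+ (N - k)).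

Definition bernw N (t : R) k := t ^+ k * (1 - t) ^+ (N - k) *+ 'C(N, k).

Lemma bernw_sum N t : \sum_(k < N.+1) bernw N t k = 1.
Proof.
have := exprDn (1 - t) t N; rewrite subrK expr1n => ->.
by apply: eq_bigr => k _; rewrite /bernw mulrC.
Qed.

Lemma bernw_mean N t : \sum_(k < N.+1) k%:R * bernw N t k = N%:R * t.
Proof.
case: N => [|N]; first by rewrite big_ord_recl big_ord0 !mul0r addr0.
rewrite big_ord_recl mul0r add0r.
transitivity (N.+1%:R * t * \sum_(k < N.+1) bernw N t k); last by rewrite bernw_sum mulr1.
rewrite mulr_sumr; apply: eq_bigr => k _; rewrite /bernw lift0 subSS exprS.
rewrite -[_ *+ 'C(N, k)]mulr_natr -[_ *+ 'C(N.+1, k.+1)]mulr_natr.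
have := mul_bin_diag N.+1 k => /(congr1 (fun z => z%:R : R)).
rewrite !natrM /= => e.
transitivity (t * t ^+ k * (1 - t) ^+ (N - k) * (k.+1%:R * 'C(N.+1, k.+1)%:R)); first by ring.
by rewrite -e; ring.
Qed.

Lemma bernw_var N t :
  \sum_(k < N.+1) (k%:R - N%:R * t) ^+ 2 * bernw N t k = N%:R * t * (1 - t).
Proof.
have m2 : \sum_(k < N.+1) k%:R * (k%:R - 1) * bernw N t k = N%:R * (N%:R - 1) * t ^+ 2.
  case: N => [|N]; first by rewrite big_ord_recl big_ord0 !mul0r addr0.
  rewrite big_ord_recl !mul0r add0r.
  transitivity (N.+1%:R * t * \sum_(k < N.+1) k%:R * bernw N t k).
    rewrite mulr_sumr; apply: eq_bigr => k _; rewrite /bernw lift0 subSS exprS.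
    rewrite -[_ *+ 'C(N, k)]mulr_natr -[_ *+ 'C(N.+1, k.+1)]mulr_natr.
    have := mul_bin_diag N.+1 k => /(congr1 (fun z => z%:R : R)).
    rewrite !natrM /= => e.
    transitivity (k%:R * t * t ^+ k * (1 - t) ^+ (N - k) * (k.+1%:R * 'C(N.+1, k.+1)%:R)).
      by rewrite -[k.+1%:R]natr1; ring.
    by rewrite -e; ring.
  by rewrite bernw_mean -[N.+1%:R]natr1; ring.
rewrite (eq_bigr (fun k : 'I_N.+1 => k%:R * (k%:R - 1) * bernw N t k
   + (1 - 2 * N%:R * t) * (k%:R * bernw N t k) + (N%:R * t) ^+ 2 * bernw N t k)).
  by rewrite !big_split /= -!mulr_sumr m2 bernw_mean bernw_sum; ring.
by move=> k _; ring.
Qed.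

Lemma bernw_ge0 N t k : 0 <= t <= 1 -> 0 <= bernw N t k.
Proof.
by case/andP=> t0 t1; rewrite /bernw mulrn_wge0 // mulr_ge0 ?exprn_ge0 // subr_ge0.
Qed.

Lemma horner_bernstein G N t :
  (bernstein G N).[t] = \sum_(k < N.+1) G (k%:R / N%:R) * bernw N t k.
Proof.
rewrite /bernstein horner_sum; apply: eq_bigr => k _.
by rewrite hornerZ hornerM !horner_exp hornerD hornerN hornerC !hornerX /bernw; ring.
Qed.

Lemma weierstrass01 (G : R -> R) (M e : R) : continuous G -> (forall y, `|G y| <= M) ->
  0 < e -> exists p : {poly R}, forall t, 0 <= t <= 1 -> `|G t - p.[t]| <= e.
Proof.
move=> cG GM e0; have e2 : 0 < e / 2 by rewrite divr_gt0.
have M0 : 0 <= M := le_trans (normr_ge0 _) (GM 0).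
have [del del0 hdel] := @heine G 0 1 (e / 2) cG e2.
pose c := 2 * M / del ^+ 2.
have c0 : 0 <= c by rewrite divr_ge0 ?mulr_ge0 ?exprn_ge0 // ltW.
pose N := (Num.bound (c / (e / 2))).+1.
have hN : c / N%:R <= e / 2.
  rewrite ler_pdivrMr ?ltr0n // mulrC -ler_pdivrMr //.
  have h : 0 <= c / (e / 2) by rewrite divr_ge0 // ltW.
  by rewrite (le_trans (ltW (archi_boundP h))) // ler_nat.
exists (bernstein G N) => t t01; have N0 : N%:R != 0 :> R by rewrite pnatr_eq0.
have ptw s : `|G t - G s| <= e / 2 + c * (s - t) ^+ 2.
  have [h|h] := ltP `|t - s| del.
    by rewrite ler_wpDr ?(ltW (hdel _ _ _ h)) // ?in_itv //= mulr_ge0 // sqr_ge0.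
  rewrite ler_wpDl ?(ltW e2) // (le_trans (ler_normB _ _)) //.
  rewrite (le_trans (lerD (GM _) (GM _))) // -mulr2n -mulr_natl /c.
  rewrite mulrAC ler_pdivlMr ?exprn_gt0 // ler_wpM2l ?mulr_ge0 //.
  by rewrite -[leRHS]real_normK ?num_real // -normrN opprB lerXn2r ?nnegrE // ltW.
have -> : G t = \sum_(k < N.+1) G t * bernw N t k by rewrite -mulr_sumr bernw_sum mulr1.
rewrite horner_bernstein -sumrB.
apply: le_trans (ler_norm_sum _ _ _) _.
apply: (@le_trans _ _ (\sum_(k < N.+1) (e / 2 * bernw N t k
     + c / N%:R ^+ 2 * ((k%:R - N%:R * t) ^+ 2 * bernw N t k)))).
  apply: ler_sum => k _; rewrite -mulrBl normrM (ger0_norm (bernw_ge0 _ _ t01)).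
  rewrite (le_trans (ler_wpM2r (bernw_ge0 N k t01) (ptw (k%:R / N%:R)))) //.
  by rewrite le_eqVlt; apply/orP; left; apply/eqP; field.
rewrite big_split /= -!mulr_sumr bernw_sum bernw_var mulr1 [leRHS]splitr lerD2l.
rewrite (le_trans _ hN) //.
have -> : c / N%:R ^+ 2 * (N%:R * t * (1 - t)) = c / N%:R * (t * (1 - t)) by field.
case/andP: t01 => t0 t1.
apply: ler_piMr; first by rewrite divr_ge0.
by rewrite -[leRHS]mulr1 ler_pM ?subr_ge0 // gerBl.
Qed.

Lemma weierstrass (G : R -> R) (M e : R) : continuous G -> (forall y, `|G y| <= M) ->
  0 < e -> exists p : {poly R}, forall y, -1 <= y <= 1 -> `|G y - p.[y]| <= e.
Proof.
move=> cG GM e0.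
have cG2 : continuous (fun t : R => G (2 * t - 1)).
  move=> t; apply: (@continuous_comp _ _ _ (fun t : R => 2 * t - 1) G); last exact: cG.
  apply: continuousB; last exact: cst_continuous.
  by apply: continuousM; [exact: cst_continuous | exact: cvg_id].
have [p hp] := weierstrass01 cG2 (fun t => GM (2 * t - 1)) e0.
exists (p \Po (2^-1 *: ('X + 1))) => y /andP[y0 y1].
have e1 : (p \Po (2^-1 *: ('X + 1))).[y] = p.[(y + 1) / 2].
  by rewrite horner_comp !hornerE mulrC.
have e2 : G y = G (2 * ((y + 1) / 2) - 1) by congr G; field.
by rewrite e1 e2; apply: hp; lra.
Qed.

End Weierstrass.

Section TaylorCosine.
Context {R : realType}.
Implicit Types be x y : R.

Definition cos_taylor N be : {poly R} :=
  \poly_(k < N) (cos (be + k%:R * (pi / 2)) / k`!%:R).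

Lemma is_derive_horner (p : {poly R}) x : is_derive x 1 (fun y => p.[y]) p^`().[x].
Proof.
elim/poly_ind: p => [|p c IH].
  rewrite derivC; under eq_fun do rewrite horner0; rewrite horner0.
  exact: is_derive_cst.
rewrite derivD derivM derivX derivC addr0 mulr1 !hornerE.
under eq_fun do rewrite hornerMXaddC.
by apply: is_derive_eq; rewrite /GRing.scale /=; ring.
Qed.

Lemma is_derive_cos_shift be x : is_derive x 1 (fun y => cos (y + be)) (cos (x + (be + pi / 2))).
Proof.
rewrite addrA cosDpihalf.
by apply: is_derive_eq; rewrite /GRing.scale /=; ring.
Qed.

Lemma deriv_cos_taylor N be : (cos_taylor N.+1 be)^`() = cos_taylor N (be + pi / 2).
Proof.
apply/polyP => k; rewrite coef_deriv !coef_poly ltnS; case: ifP => // _; rewrite ?mul0rn //.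
have -> : be + k.+1%:R * (pi / 2) = be + pi / 2 + k%:R * (pi / 2) by rewrite -natr1; ring.
rewrite factS natrM -[_ *+ k.+1]mulr_natr.
by field; rewrite nat1r !pnatr_eq0 -lt0n fact_gt0.
Qed.

Definition cos_rem N be x := cos (x + be) - (cos_taylor N be).[x].

Lemma is_derive_cos_rem N be x :
  is_derive x 1 (cos_rem N.+1 be) (cos_rem N (be + pi / 2) x).
Proof.
rewrite /cos_rem -deriv_cos_taylor.
have h1 := is_derive_cos_shift be x; have h2 := is_derive_horner (cos_taylor N.+1 be) x.
by apply: is_derive_eq.
Qed.

Lemma cos_rem0 N be : cos_rem N.+1 be 0 = 0.
Proof.
by rewrite /cos_rem add0r horner_coef0 coef_poly /= mul0r addr0 fact0 divr1 subrr.
Qed.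

Lemma cos_remN N be x : cos_rem N be (- x) = cos_rem N (- be) x.
Proof.
rewrite /cos_rem -[cos (- x + be)]cosN opprD opprK; congr (_ - _).
rewrite !horner_poly; apply: eq_bigr => k _; rewrite exprNn.
have hpi : forall z, (-1) ^+ k * cos z = cos (- z + k%:R * pi) :> R.
  elim: (nat_of_ord k) => [|j IH] z; first by rewrite expr0 mul1r mul0r addr0 cosN.
  rewrite exprS -mulrA mulN1r IH -natr1 mulrDl mul1r addrA cosDpi //.
have -> : cos (- be + k%:R * (pi / 2)) = (-1) ^+ k * cos (be + k%:R * (pi / 2)).
  by rewrite hpi; congr cos; field.
by ring.
Qed.

Lemma cos_rem_le N be x : 0 <= x -> `|cos_rem N be x| <= x ^+ N / N`!%:R.
Proof.
elim: N be x => [|N IH] be x x0.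
  by rewrite /cos_rem /cos_taylor poly_def big_ord0 horner0 subr0 expr0 fact0 divr1 cos_max.
pose w : {poly R} := (N.+1`!%:R)^-1 *: 'X^(N.+1).
have wE y : w.[y] = y ^+ N.+1 / N.+1`!%:R by rewrite hornerZ hornerXn mulrC.
have dw y : w^`().[y] = y ^+ N / N`!%:R.
  rewrite /w derivZ derivXn hornerZ hornerMn hornerXn /= -mulr_natr factS natrM.
  by field; rewrite nat1r !pnatr_eq0 -lt0n fact_gt0.
have key s : (s = 1 \/ s = -1) -> s * cos_rem N.+1 be x <= w.[x].
  move=> hs; pose h y := w.[y] - s * cos_rem N.+1 be y.
  have dh y : is_derive y 1 h (w^`().[y] - s * cos_rem N (be + pi / 2) y).
    have h1 := is_derive_cos_rem N be y; have h2 := is_derive_horner w y.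
    by apply: is_derive_eq; rewrite /GRing.scale /=; ring.
  have : h 0 <= h x.
    have dd y : derivable h y 1 := @ex_derive _ _ _ _ _ _ _ (dh y).
    apply: (@ger0_derive1_ndecr _ h 0 x) => [y _|y|||//|//]; first exact: dd.
    - rewrite in_itv /= => /andP[y0 _]; rewrite derive1E (@derive_val _ _ _ _ _ _ _ (dh y)).
      rewrite dw subr_ge0 (le_trans _ (IH (be + pi / 2) y (ltW y0))) //.
      by case: hs => ->; rewrite ?mul1r ?mulN1r; [exact: ler_norm | rewrite -normrN ler_norm].
    - by apply: derivable_within_continuous => y _; exact: dd.
    - exact: lexx.
  by rewrite /h cos_rem0 wE expr0n mul0r mulr0 subr0 subr_ge0.
rewrite -wE ler_norml; apply/andP; split.
  by have := key (-1) (or_intror erefl); rewrite mulN1r lerNl.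
by have := key 1 (or_introl erefl); rewrite mul1r.
Qed.

End TaylorCosine.

Section OneLaw.
Context {R : realType} d (T : measurableType d) (P : probability T R) (Y : T -> R).
Implicit Types g h w : R -> R.

Definition mean g : R := \int[P]_t g (Y t).
Definition summable g := P.-integrable setT (fun t => (g (Y t))%:E).

Lemma summableD g h : summable g -> summable h -> summable (fun y => g y + h y).
Proof.
move=> ig ih; have := integrableD measurableT ig ih.
by apply: eq_integrable => // t _; rewrite EFinD.
Qed.

Lemma summableZ c g : summable g -> summable (fun y => c * g y).
Proof.
move=> ig; have := integrableZl measurableT c ig.
by apply: eq_integrable => // t _; rewrite EFinM.
Qed.

Lemma summable_norm g : summable g -> summable (fun y => `|g y|).
Proof. by move=> ig; exact: (integrable_norm ig). Qed.

Lemma meanD g h : summable g -> summable h ->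
  mean (fun y => g y + h y) = mean g + mean h.
Proof. by move=> ig ih; rewrite /mean RintegralD. Qed.

Lemma meanZ c g : summable g -> mean (fun y => c * g y) = c * mean g.
Proof. by move=> ig; rewrite /mean RintegralZl. Qed.

Hypothesis mY : measurable_fun setT Y.

Lemma summable_dom g h : continuous g -> summable h ->
  (forall y, `|g y| <= h y) -> summable g.
Proof.
move=> cg ih gh; apply: (le_integrable measurableT _ _ ih).
  apply/measurable_EFinP; apply: measurableT_comp mY.
  exact: continuous_measurable_fun.
by move=> t _; rewrite /= lee_fin (le_trans (gh _)) // ler_norm.
Qed.

Lemma mean_dist g h w : summable g -> summable h -> summable w ->
  (forall y, `|g y - h y| <= w y) -> `|mean g - mean h| <= mean w.
Proof.
move=> ig ih iw gh; rewrite /mean -RintegralB //.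
have igh : P.-integrable setT (EFin \o (fun t => g (Y t) - h (Y t))).
  exact: (integrableB measurableT ig ih).
apply: le_trans (le_normr_Rintegral measurableT igh) _.
apply: le_Rintegral => //.
  exact: (integrable_norm igh).
Qed.

End OneLaw.

Section MethodOfMoments.
Context {R : realType} (d : nat -> measure_display) (T : forall n, measurableType (d n)).
Variables (P : forall n, probability (T n) R) (Y : forall n, T n -> R).
Variable L : probability (measurableTypeR R) R.
Hypothesis mY : forall n, measurable_fun setT (@Y n).
Implicit Types g h w : R -> R.

Let meanL g := mean L id g.

Definition convergent g := [/\ continuous g, forall n, summable (P n) (@Y n) g,
  summable L id g & mean (P n) (@Y n) g @[n --> \oo] --> meanL g].

Lemma convergentD g h : convergent g -> convergent h -> convergent (fun y => g y + h y).
Proof.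
move=> [cg ig jg lg] [ch ih jh lh]; split.
- by move=> y; apply: continuousD; [apply: cg | apply: ch].
- by move=> n; apply: summableD.
- exact: summableD.
rewrite /meanL meanD //; apply: (cvg_eq_near (N := 0%N) (u := fun n => mean (P n) (@Y n) g + mean (P n) (@Y n) h)).
  by move=> n _; rewrite meanD.
exact: cvgD.
Qed.

Lemma convergentZ (c : R) g : convergent g -> convergent (fun y => c * g y).
Proof.
move=> [cg ig jg lg]; split.
- by move=> y; apply: continuousM; [apply: cst_continuous | apply: cg].
- by move=> n; apply: summableZ.
- exact: summableZ.
rewrite /meanL meanZ //; apply: (cvg_eq_near (N := 0%N) (u := fun n => c * mean (P n) (@Y n) g)).
  by move=> n _; rewrite meanZ.
by apply: cvgM => //; apply: cvg_cst.
Qed.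

Lemma convergent_approx h : continuous h ->
  (forall e : R, 0 < e -> exists g w, [/\ convergent g, convergent w,
     forall y, `|h y - g y| <= w y & meanL w <= e]) -> convergent h.
Proof.
move=> ch H.
have [g0 [w0 [[_ ig0 jg0 _] [_ iw0 jw0 _] hw0 _]]] := H _ ltr01.
have hb y : `|h y| <= `|g0 y| + w0 y.
  rewrite -[h y](subrK (g0 y)) (le_trans (ler_normD _ _)) // addrC.
  by rewrite lerD2l.
have ih n : summable (P n) (@Y n) h.
  by apply: (summable_dom _ ch _ hb) => //; apply: summableD => //; apply: summable_norm.
have jh : summable L id h.
  by apply: (summable_dom _ ch _ hb) => //; apply: summableD => //; apply: summable_norm.
split => //; apply/cvgrPdist_le => e e0.
have e4 : 0 < e / 4 by rewrite divr_gt0.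
have [g [w [[_ ig jg lg] [_ iw jw lw] hw we]]] := H _ e4.
move/cvgrPdist_le: lg => /(_ _ e4) lg; move/cvgrPdist_le: lw => /(_ _ e4) lw.
near=> n.
have A : `|meanL g - mean (P n) (@Y n) g| <= e / 4 by near: n.
have B : `|meanL w - mean (P n) (@Y n) w| <= e / 4 by near: n.
have C := mean_dist (ih n) (ig n) (iw n) hw.
have D := mean_dist jh jg jw hw.
move: A B C D we; rewrite /meanL !ler_distl => /andP[? ?] /andP[? ?] /andP[? ?] /andP[? ?] ?.
by apply/andP; split; lra.
Unshelve. all: by end_near. Qed.

Hypothesis iY : forall n k, summable (P n) (@Y n) (fun y => y ^+ k).
Hypothesis iL : forall k, summable L id (fun y => y ^+ k).
Hypothesis lim_moments : forall k,
  mean (P n) (@Y n) (fun y => y ^+ k) @[n --> \oo] --> meanL (fun y => y ^+ k).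

Lemma convergent_monomial k : convergent (fun y => y ^+ k).
Proof. by split => // y; exact: exprn_continuous. Qed.

Lemma convergent_cst (c : R) : convergent (fun=> c).
Proof.
have -> : (fun=> c) = (fun y : R => c * y ^+ 0) by apply/funext => y; rewrite expr0 mulr1.
exact/convergentZ/convergent_monomial.
Qed.

Lemma convergent_comp_poly (s : R -> R) (p : {poly R}) :
  (forall k, convergent (fun y => s y ^+ k)) -> convergent (fun y => p.[s y]).
Proof.
move=> hs; have -> : (fun y => p.[s y]) =
    (fun y => \sum_(i <- index_enum 'I_(size p)) p`_i * s y ^+ i).
  by apply/funext => y; rewrite horner_coef.
elim: (index_enum _) => [|i r IH].
  by under eq_fun do rewrite big_nil; apply: convergent_cst.
under eq_fun do rewrite big_cons; apply: convergentD => //.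
by apply: convergentZ.
Qed.

Hypothesis small_moments : forall al : R,
  al ^+ (2 * K) / (2 * K)`!%:R * meanL (fun y => y ^+ (2 * K)) @[K --> \oo] --> (0 : R).

(** The Taylor polynomial of even degree bounds the error by an even monomial
    whose mean under the limit law tends to 0. *)
Lemma convergent_cos al be : convergent (fun y => cos (al * y + be)).
Proof.
apply: convergent_approx => [y|e e0].
  apply: (@continuous_comp _ _ _ (fun y => al * y + be) cos); last exact: continuous_cos.
  apply: continuousD; last exact: cst_continuous.
  by apply: continuousM; [exact: cst_continuous | exact: id].
move/cvgrPdist_le: (small_moments al) => /(_ _ e0) [K _ /(_ K (leqnn K))].
rewrite /= sub0r normrN => sK.
exists (fun y => (cos_taylor (2 * K) be \Po (al *: 'X)).[y]).
exists (fun y => al ^+ (2 * K) / (2 * K)`!%:R * y ^+ (2 * K)); split.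
- by apply: (convergent_comp_poly (s := id)) => k; apply: convergent_monomial.
- exact/convergentZ/convergent_monomial.
- move=> y; rewrite horner_comp hornerZ hornerX -/(cos_rem (2 * K) be (al * y)).
  rewrite mulrAC -exprMn.
  have [s0|s0] := leP 0 (al * y); first exact: cos_rem_le.
  rewrite -[al * y]opprK cos_remN [_ ^+ _]exprM sqrrN -exprM.
  by apply: cos_rem_le; rewrite oppr_ge0 ltW.
by rewrite /meanL meanZ // (le_trans (ler_norm _)).
Qed.

Lemma convergent_sinX_cos c k al be : convergent (fun y => sin (c * y) ^+ k * cos (al * y + be)).
Proof.
elim: k al be => [|k IH] al be.
  by under eq_fun do rewrite expr0 mul1r; apply: convergent_cos.
have -> : (fun y => sin (c * y) ^+ k.+1 * cos (al * y + be)) = (fun y =>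
    2^-1 * (sin (c * y) ^+ k * cos ((al + c) * y + (be - pi / 2))) +
    (- 2^-1) * (sin (c * y) ^+ k * cos ((al - c) * y + (be - pi / 2)))).
  apply/funext => y; rewrite !addrA.
  have cB (z : R) : cos (z - pi / 2) = sin z by rewrite cosB cos_pihalf sin_pihalf mulr0 add0r mulr1.
  rewrite !cB exprS.
  have -> : (al + c) * y + be = (al * y + be) + c * y by ring.
  have -> : (al - c) * y + be = (al * y + be) - c * y by ring.
  by rewrite sinD sinB; field.
by apply: convergentD; apply: convergentZ; apply: IH.
Qed.

Lemma convergent_sinX c k : convergent (fun y => sin (c * y) ^+ k).
Proof.
have := convergent_sinX_cos c k 0 0.
by under eq_fun do rewrite mul0r addr0 cos0 mulr1.
Qed.

(** On the interval of radius [A] a bounded continuous function is a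
    continuous function of the sine of a small multiple of the argument,
    hence uniformly close to a polynomial in that sine; outside this interval
    the error is bounded, and the second moment controls its contribution. *)
Lemma convergent_bounded g (M : R) : continuous g -> (forall y, `|g y| <= M) -> convergent g.
Proof.
move=> cg gM; apply: convergent_approx => // e e0.
have M0 : 0 <= M := le_trans (normr_ge0 _) (gM 0).
pose e2 := e / 2; have e20 : 0 < e2 by rewrite divr_gt0.
pose m2 := meanL (fun y => y ^+ 2).
have m20 : 0 <= m2 by apply: Rintegral_ge0 => y _; apply: sqr_ge0.
have [A A0 hA] : exists2 A, 0 < A & (2 * M + e2) / A ^+ 2 * m2 <= e2.
  pose B := (2 * M + e2) * m2 / e2.
  have Me0 : 0 <= 2 * M + e2 by rewrite addr_ge0 ?(ltW e20) // mulr_ge0.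
  have B0 : 0 <= B by apply: divr_ge0; [exact: mulr_ge0 | exact: ltW].
  exists (1 + B); first by rewrite ltr_wpDr.
  rewrite mulrAC ler_pdivrMr ?exprn_gt0 ?ltr_wpDr //.
  have -> : (2 * M + e2) * m2 = e2 * B by rewrite /B; field; rewrite gt_eqF.
  by rewrite ler_wpM2l ?(ltW e20) //; nra.
pose q : R := pi / 4; pose c := q / A.
have pi0 := @pi_gt0 R.
have q0 : 0 < q by rewrite divr_gt0.
have c0 : 0 < c by rewrite divr_gt0.
have qpi : q <= pi / 2 by rewrite /q; lra.
have qI : q \in `[- (pi / 2), (pi / 2)] by rewrite in_itv /= /q; apply/andP; split; lra.
have nqI : - q \in `[- (pi / 2), (pi / 2)] by rewrite in_itv /= /q; apply/andP; split; lra.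
have hpI : pi / 2 \in `[- (pi / 2), (pi / 2) : R] by rewrite in_itv /=; apply/andP; split; lra.
have nhI : - (pi / 2) \in `[- (pi / 2), (pi / 2) : R] by rewrite in_itv /=; apply/andP; split; lra.
pose s := sin q.
have s1 : s < 1 by rewrite -sin_pihalf ltr_sin //; rewrite /q; lra.
have s0 : 0 < s by rewrite -sin0 ltr_sin // ?in_itv /=; [apply/andP; split; lra].
pose clamp y := Num.max (- s) (Num.min s y).
have cl y : - s <= clamp y <= s.
  rewrite /clamp le_max lexx /= ge_max ge_min lexx /= andbT.
  by rewrite (le_trans _ (ltW s0)) // oppr_le0 ltW.
pose G y := g (asin (clamp y) / c).
have cG : continuous G.
  move=> y; apply: (@continuous_comp _ _ _ (fun y => asin (clamp y) / c) g); last exact: cg.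
  apply: continuousM; last exact: cst_continuous.
  apply: (@continuous_comp _ _ _ clamp asin).
    apply: continuous_max; first exact: cst_continuous.
    by apply: continuous_min; [exact: cst_continuous | exact: id].
  have /andP[l1 l2] := cl y.
  by apply: continuous_asin; rewrite ?(lt_le_trans _ l1) ?(le_lt_trans l2) // ltrN2.
have [p hp] := weierstrass cG (fun y => gM _) e20.
exists (fun y => p.[sin (c * y)]), (fun y => e2 + (2 * M + e2) / A ^+ 2 * y ^+ 2); split.
- by apply: convergent_comp_poly => k; apply: convergent_sinX.
- apply: convergentD; [exact: convergent_cst | exact/convergentZ/convergent_monomial].
- move=> y.
  have hpy : `|G (sin (c * y)) - p.[sin (c * y)]| <= e2 by apply: hp; rewrite sin_geN1 sin_le1.
  have [yA|yA] := lerP `|y| A.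
    have cyq : - q <= c * y <= q.
      rewrite -ler_norml normrM (gtr0_norm c0) /c mulrAC ler_pdivrMr //.
      by rewrite ler_wpM2l // ltW.
    have cyI : c * y \in `[- (pi / 2), (pi / 2)].
      by case/andP: cyq => ? ?; rewrite in_itv /=; apply/andP; split; lra.
    have -> : g y = G (sin (c * y)).
      rewrite /G /clamp min_r ?max_r.
      - by rewrite sinK // mulrC mulKf // gt_eqF.
      - by case/andP: cyq => ? ?; rewrite -sinN leNgt ltr_sin // -leNgt.
      - by case/andP: cyq => ? ?; rewrite leNgt ltr_sin // -leNgt.
    by rewrite (le_trans hpy) // lerDl mulr_ge0 ?sqr_ge0 // divr_ge0 ?sqr_ge0 // addr_ge0 ?(ltW e20) // mulr_ge0.
  have y2 : 1 <= y ^+ 2 / A ^+ 2.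
    by rewrite ler_pdivlMr ?exprn_gt0 // mul1r -[y ^+ 2]real_normK ?num_real // lerXn2r ?nnegrE // ltW.
  have -> : (2 * M + e2) / A ^+ 2 * y ^+ 2 = (2 * M + e2) * (y ^+ 2 / A ^+ 2) by ring.
  have h1 : 2 * M + e2 <= (2 * M + e2) * (y ^+ 2 / A ^+ 2).
    by rewrite ler_peMr // addr_ge0 ?(ltW e20) // mulr_ge0.
  have h2 : `|g y - p.[sin (c * y)]| <= 2 * M + e2.
    rewrite -(subrKA (G (sin (c * y)))); apply: le_trans (ler_normD _ _) _.
    apply: lerD => //; apply: le_trans (ler_normB _ _) _.
    have -> : 2 * M = M + M by ring.
    by apply: lerD; exact: gM.
  by lra.
rewrite /meanL meanD; last 2 first.
  by have [] := convergent_cst e2.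
  by have [] := convergentZ ((2 * M + e2) / A ^+ 2) (convergent_monomial 2).
have -> : mean L id (fun=> e2) = e2.
  by rewrite /mean Rintegral_cst //= [X in fine X]probability_setT /= mulr1.
rewrite meanZ //.
by move: hA; rewrite /m2 /meanL /e2; lra.
Qed.

End MethodOfMoments.

Section NormalMoments.
Context {R : realType} (s : R).
Hypothesis s0 : s != 0.
Local Notation mu := (@lebesgue_measure R).
Let N := normal_prob (0 : R) s.
Let pdf := normal_pdf 0 s.

Lemma integral_normal_density (f : R -> \bar R) : (forall x, 0 <= f x)%E ->
  measurable_fun setT f ->
  (\int[normal_prob (0 : R) s]_x f x = \int[mu]_x (f x * (normal_pdf 0 s x)%:E))%E.
Proof.
move=> f0 mf; have dom := normal_prob_dominates (0 : R) s.
rewrite -(Radon_Nikodym_SigmaFinite.change_of_variables dom f0 measurableT mf).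
have iRN := Radon_Nikodym_SigmaFinite.f_integrable dom.
have mpdf : measurable_fun setT (fun x => (normal_pdf 0 s x)%:E).
  by apply/measurable_EFinP; apply: measurable_normal_pdf.
apply: ae_eq_integral => //.
- by apply: emeasurable_funM => //; exact: (measurable_int _ iRN).
- exact: emeasurable_funM.
- apply: ae_eqe_mul2l; apply: integral_ae_eq => // E _ mE.
  by rewrite -(Radon_Nikodym_SigmaFinite.f_integral dom).
Qed.

Lemma exprn_le_expR (j : nat) (y : R) : 0 <= y -> y ^+ j <= j`!%:R * expR y.
Proof.
move=> y0; case: j => [|j].
  by rewrite expr0 fact0 mul1r (le_trans _ (expR_ge1Dx y)) // lerDl.
rewrite mulrC -ler_pdivrMr ?ltr0n ?fact_gt0 //.
by apply: le_trans (expR_ge1Dxn j y0); rewrite lerDr.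
Qed.

(** A Gaussian density absorbs every power at the price of doubling the
    standard deviation. *)
Lemma power_normal_pdf_le j : exists2 C, 0 <= C &
  forall x, x ^+ (2 * j) * normal_pdf 0 s x <= C * normal_pdf 0 (2 * s) x.
Proof.
have s20 : 2 * s != 0 by rewrite mulf_neq0.
have q0 : 0 < normal_peak (2 * s) by apply: normal_peak_gt0.
have p0 : 0 < normal_peak s by apply: normal_peak_gt0.
have ss : 0 < s ^+ 2 by rewrite exprn_even_gt0.
pose c := 8 * s ^+ 2 / 3; have c0 : 0 < c by rewrite divr_gt0 // mulr_gt0.
exists (c ^+ j * j`!%:R * (normal_peak s / normal_peak (2 * s))).
  by rewrite !mulr_ge0 ?exprn_ge0 ?invr_ge0 // ltW.
move=> x; rewrite !normal_pdfE // /normal_fun !subr0.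
pose y := x ^+ 2 / c.
have y0 : 0 <= y by rewrite divr_ge0 ?sqr_ge0 // ltW.
have -> : - x ^+ 2 / (s ^+ 2 *+ 2) = - y + - x ^+ 2 / ((2 * s) ^+ 2 *+ 2).
  by rewrite /y /c; field; rewrite s0.
rewrite expRD expRN; set E := expR (- x ^+ 2 / _).
have -> : x ^+ (2 * j) = c ^+ j * y ^+ j.
  by rewrite -exprMn /y mulrC divfK ?gt_eqF // exprM.
have E0 : 0 <= E by apply: expR_ge0.
have h : y ^+ j * (expR y)^-1 <= j`!%:R by rewrite ler_pdivrMr ?expR_gt0 //; apply: exprn_le_expR.
have -> : c ^+ j * y ^+ j * (normal_peak s * ((expR y)^-1 * E)) =
    (y ^+ j * (expR y)^-1) * (c ^+ j * normal_peak s * E) by ring.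
have -> : c ^+ j * j`!%:R * (normal_peak s / normal_peak (2 * s)) * (normal_peak (2 * s) * E)
   = j`!%:R * (c ^+ j * normal_peak s * E) by field; rewrite gt_eqF.
by apply: ler_wpM2r => //; rewrite !mulr_ge0 ?exprn_ge0 // ltW.
Qed.

Lemma integrable_power_pdf k : mu.-integrable setT (fun x => (x ^+ k * normal_pdf 0 s x)%:E).
Proof.
have [C C0 hC] := power_normal_pdf_le k.
have i1 := integrable_normal_pdf (0 : R) s.
have i2 := integrableZl measurableT C (integrable_normal_pdf (0 : R) (2 * s)).
have i3 := integrableD measurableT i1 i2.
apply: (le_integrable measurableT _ _ i3).
  apply/measurable_EFinP; apply: measurable_funM; last exact: measurable_normal_pdf.
  by apply: measurable_funX.
move=> x _; rewrite /= lee_fin normrM normrX (ger0_norm (normal_pdf_ge0 _ _ _)).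
apply: le_trans (ler_norm _).
have : `|x| ^+ k <= 1 + x ^+ (2 * k).
  have [x1|x1] := lerP `|x| 1.
    by rewrite ler_wpDr ?exprn_ile1 // exprM exprn_ge0 // sqr_ge0.
  have -> : x ^+ (2 * k) = `|x| ^+ (2 * k) by rewrite !exprM real_normK ?num_real.
  by rewrite ler_wpDl // ler_weXn2l ?ltW //; lia.
move/(ler_wpM2r (normal_pdf_ge0 0 s x)) => /le_trans; apply.
by rewrite mulrDl mul1r lerD2l.
Qed.

Definition normal_moment k : R := \int[mu]_x (x ^+ k * normal_pdf 0 s x).

Lemma is_derive_normal_pdf (x : R) : is_derive x 1 (normal_pdf 0 s) (- x / s ^+ 2 * normal_pdf 0 s x).
Proof.
rewrite normal_pdfE // /normal_fun.
have -> : (fun x : R => normal_peak s * expR (- (x - 0) ^+ 2 / (s ^+ 2 *+ 2)))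
        = (fun x : R => normal_peak s * expR ((- (2 * s ^+ 2)^-1) * x ^+ 2)).
  by apply/funext => z; rewrite subr0; congr (_ * expR _); field; rewrite s0.
have h : is_derive x 1 (fun x : R => - (2 * s ^+ 2)^-1 * x ^+ 2) (- x / s ^+ 2).
  by apply: is_derive_eq; rewrite /GRing.scale /=; field; rewrite s0.
have h2 := is_derive1_comp (is_derive_expR _) h.
have h3 := is_deriveZ (normal_peak s) h2.
apply: is_derive_eq; rewrite /GRing.scale /=.
rewrite subr0; have -> : - x ^+ 2 / (s ^+ 2 *+ 2) = - (2 * s ^+ 2)^-1 * x ^+ 2 by field; rewrite s0.
by ring.
Qed.

Lemma is_derive_power_pdf k (x : R) : is_derive x 1 (fun x => x ^+ k * normal_pdf 0 s x)
  (k%:R * (x ^+ k.-1 * normal_pdf 0 s x) - s ^- 2 * (x ^+ k.+1 * normal_pdf 0 s x)).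
Proof.
have h := is_derive_normal_pdf x.
have h2 : is_derive x 1 (fun x => x ^+ k) (k%:R * x ^+ k.-1).
  have := is_derive_horner 'X^k x; rewrite derivXn hornerMn hornerXn -mulr_natl.
    by under eq_fun do rewrite hornerXn.
by apply: is_derive_eq; rewrite /GRing.scale /= [x ^+ k.+1]exprS; ring.
Qed.


Lemma power_pdf_small k : exists2 C : R, 0 <= C & forall x : R, 1 <= `|x| ->
  `|x ^+ k * normal_pdf 0 s x| <= C / `|x|.
Proof.
have [C C0 hC] := power_normal_pdf_le k.+1.
have s20 : 2 * s != 0 by rewrite mulf_neq0.
exists (C * normal_peak (2 * s)); first by rewrite mulr_ge0 ?normal_peak_ge0.
move=> x x1; have x0 : 0 < `|x| by apply: lt_le_trans x1.
rewrite ler_pdivlMr //; apply: le_trans (ler_wpM2l C0 (normal_pdf_ub 0 x s20)).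
apply: le_trans (hC x); rewrite normrM normrX (ger0_norm (normal_pdf_ge0 _ _ _)) mulrAC -exprSr.
apply: ler_wpM2r; first exact: normal_pdf_ge0.
have -> : x ^+ (2 * k.+1) = `|x| ^+ (2 * k.+1) by rewrite !exprM real_normK ?num_real.
by rewrite ler_weXn2l //; lia.
Qed.

Lemma normal_momentS k : normal_moment k.+1 = s ^+ 2 * k%:R * normal_moment k.-1.
Proof.
pose F (x : R) := x ^+ k * normal_pdf 0 s x.
pose f (x : R) := k%:R * (x ^+ k.-1 * normal_pdf 0 s x) - s ^- 2 * (x ^+ k.+1 * normal_pdf 0 s x).
have i1 := integrableZl measurableT k%:R (integrable_power_pdf k.-1).
have i2 := integrableZl measurableT (s ^- 2) (integrable_power_pdf k.+1).
have fi : mu.-integrable setT (EFin \o f) by apply: (integrableB measurableT i1 i2).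
have dF x : derivable F x 1 := @ex_derive _ _ _ _ _ _ _ (is_derive_power_pdf k x).
have cF x : {for x, continuous F} by apply/differentiable_continuous/derivable1_diffP.
have cf : continuous f.
  have cp j : continuous (fun x : R => x ^+ j * normal_pdf 0 s x).
    move=> x; apply: cvgM; first exact: exprn_continuous.
    exact: continuous_normal_pdf.
  move=> x; apply: cvgB; (apply: cvgM; first exact: cvg_cst); exact: cp.
have FTC (n : nat) : (\int[mu]_(x in `[(- n.+1%:R)%R, n.+1%:R%R]) (f x)%:E)%E
    = (F n.+1%:R - F (- n.+1%:R))%:E.
  rewrite EFinB; apply: continuous_FTC2.
  - by rewrite gtrN.
  - exact: continuous_subspaceT.
  - split; first by move=> x _; exact: dF.
    + by apply: cvg_at_right_filter; exact: cF.
    + by apply: cvg_at_left_filter; exact: cF.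
  - move=> x _; rewrite derive1E.
    exact: (@derive_val _ _ _ _ _ _ _ (is_derive_power_pdf k x)).
pose fn n := (f \_ `[- n.+1%:R, n.+1%:R]).
have dc : (\int[mu]_x (fn n x)%:E)%E @[n --> \oo] --> (\int[mu]_x (f x)%:E)%E.
  apply: (@dominated_cvg _ _ _ mu setT measurableT (fun n x => (fn n x)%:E) _
    (fun x => `|(f x)%:E|%E)).
  - move=> n; apply/measurable_EFinP; apply/(measurable_restrictT _ _).1 => //.
    by apply: measurable_funTS; apply: continuous_measurable_fun.
  - move=> x _; apply: cvg_near_cst; near=> n.
    rewrite /fn patchE mem_set //= in_itv /= -ler_norml.
    have : `|x| <= n%:R by near: n; exact: nbhs_infty_ger.
    by move/le_trans; apply; rewrite ler_nat.
  - by [].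
  - exact: (integrable_abse fi).
  - move=> n x _ /=; rewrite /fn patchE lee_fin; case: ifP => // _.
    by rewrite normr0.
have dc2 : (F n.+1%:R - F (- n.+1%:R))%:E @[n --> \oo] --> (\int[mu]_x (f x)%:E)%E.
  suff -> : (fun n => (F n.+1%:R - F (- n.+1%:R))%:E) = (fun n => \int[mu]_x (fn n x)%:E)%E by [].
  apply/funext => n; rewrite -FTC [LHS]integral_mkcond; apply: eq_integral => x _.
  by rewrite restrict_EFin.
have [C C0 hC] := power_pdf_small k.
have F0 : F n.+1%:R - F (- n.+1%:R) @[n --> \oo] --> (0 : R).
  apply/cvgr0Pnorm_le => e e0.
  have := cvg_harmonic (R := R) => /cvgr0Pnorm_le /(_ (e / (2 * C + 1))).
  have C1 : 0 < 2 * C + 1 by rewrite ltr_wpDl // mulr_ge0.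
  move=> /(_ (divr_gt0 e0 C1)) hh; near=> n.
  have : `|n.+1%:R^-1| <= e / (2 * C + 1) by near: n.
  rewrite ger0_norm ?invr_ge0 // ler_pdivlMr // => hn.
  have n1 : 1 <= `|n.+1%:R : R| by rewrite normr_nat ler1n.
  have n2 : 1 <= `|- n.+1%:R : R| by rewrite normrN.
  apply: le_trans (ler_normB _ _) _; apply: le_trans (lerD (hC _ n1) (hC _ n2)) _.
  rewrite normrN normr_nat; apply: le_trans hn.
  have : 0 <= n.+1%:R^-1 :> R by rewrite invr_ge0.
  by rewrite -mulrDl mulrC => h; apply: ler_wpM2l => //; lra.
have intf : \int[mu]_x f x = 0.
  have fin : (\int[mu]_x (f x)%:E)%E \is a fin_num by apply: (integrable_fin_num measurableT fi).
  move: dc2; rewrite -(fineK fin) => /fine_cvg dc3.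
  exact: (cvg_unique _ dc3 F0).
move: intf; rewrite /f RintegralB ?RintegralZl //; [|exact: integrable_power_pdf|exact: integrable_power_pdf].
rewrite -/(normal_moment _) -/(normal_moment _) => /eqP; rewrite subr_eq0 => /eqP h.
by have := congr1 (fun z => s ^+ 2 * z) h; rewrite !mulrA mulfV ?expf_neq0 // mul1r => <-.
Unshelve. all: by end_near. Qed.

End NormalMoments.

Section NormalMean.
Context {R : realType} (s : R).
Hypothesis s0 : s != 0.
Local Notation mu := (@lebesgue_measure R).
Let N : probability (measurableTypeR R) R := normal_prob (0 : R) s.

Lemma normal_ge0_mean (g : R -> R) : (forall x, 0 <= g x) -> measurable_fun setT g ->
  mu.-integrable setT (fun x => (g x * normal_pdf 0 s x)%:E) ->
  summable N id g /\ mean N id g = \int[mu]_x (g x * normal_pdf 0 s x).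
Proof.
move=> g0 mg ig.
have E : (\int[N]_x (g x)%:E = \int[mu]_x (g x * normal_pdf 0 s x)%:E)%E.
  rewrite integral_normal_density => [|x|]; first by under eq_integral do rewrite -EFinM.
  - by rewrite lee_fin.
  - exact/measurable_EFinP.
split; last by rewrite /mean /Rintegral E.
apply/integrableP; split; first exact/measurable_EFinP.
under eq_integral do rewrite /= ger0_norm //.
by rewrite E ltey_eq (integrable_fin_num measurableT ig).
Qed.

Lemma normal_power k : summable N id (fun x => x ^+ k) /\
  mean N id (fun x => x ^+ k) = normal_moment s k.
Proof.
pose h1 (x : R) := 1 + x ^+ (2 * k); pose h2 (x : R) := x ^+ k + h1 x.
have h10 x : 0 <= h1 x by rewrite addr_ge0 // exprM exprn_ge0 // sqr_ge0.
have h20 x : 0 <= h2 x.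
  have : 0 <= (x ^+ k) ^+ 2 + 2 * x ^+ k + 2 by have := sqr_ge0 (x ^+ k + 1); nra.
  by rewrite /h2 /h1 mulnC exprM; have := sqr_ge0 (x ^+ k); lra.
have mX j : measurable_fun setT (fun x : R => x ^+ j) by apply: measurable_funX.
have mh1 : measurable_fun setT h1 by apply: measurable_funD.
have mh2 : measurable_fun setT h2 by apply: measurable_funD.
have iX j := integrable_power_pdf s0 j.
have ih1 : mu.-integrable setT (fun x => (h1 x * normal_pdf 0 s x)%:E).
  have := integrableD measurableT (integrable_normal_pdf (0 : R) s) (iX (2 * k)%N).
  by apply: eq_integrable => // x _; rewrite /h1 mulrDl mul1r EFinD.
have ih2 : mu.-integrable setT (fun x => (h2 x * normal_pdf 0 s x)%:E).
  have := integrableD measurableT (iX k) ih1.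
  by apply: eq_integrable => // x _; rewrite /= -EFinD -mulrDl.
have [sh1 e1] := normal_ge0_mean h10 mh1 ih1.
have [sh2 e2] := normal_ge0_mean h20 mh2 ih2.
have -> : (fun x : R => x ^+ k) = (fun x => h2 x + -1 * h1 x).
  by apply/funext => x; rewrite /h2 mulN1r addrK.
split; first by apply: summableD => //; exact: summableZ.
rewrite meanD // ?meanZ //; last exact: summableZ.
rewrite e1 e2 mulN1r -RintegralB //; apply: eq_Rintegral => x _.
by rewrite -mulrBl /h2 addrK.
Qed.

End NormalMean.

Section CenteredNormal.
Context {R : realType} (s2 : R).
Hypothesis s2_ge0 : 0 <= s2.
Local Notation L := (centered_normal s2).

Lemma normal_momentE (s : R) k : s != 0 -> normal_moment s k = k`!%:R * gauss_coef (s ^+ 2) k.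
Proof.
move=> s0; have H j : normal_moment s j = j`!%:R * gauss_coef (s ^+ 2) j /\
    normal_moment s j.+1 = j.+1`!%:R * gauss_coef (s ^+ 2) j.+1.
  elim: j => [|j [IH1 IH2]].
    rewrite [normal_moment s 1](normal_momentS s0 0) [0%:R]mulr0n mulr0 mul0r /gauss_coef /=.
    rewrite expr0 fact0 divr1 mulr1 mulr0; split => //.
    rewrite /normal_moment; under eq_Rintegral do rewrite expr0 mul1r.
    by rewrite /Rintegral integral_normal_pdf.
  split => //; rewrite (normal_momentS s0 j.+1) IH1 gauss_coefSS factS [in RHS]factS !natrM.
  by field; rewrite -natrD pnatr_eq0.
by have [] := H k.
Qed.

Lemma centered_normal_moment k : summable L id (fun x => x ^+ k) /\
  mean L id (fun x => x ^+ k) = k`!%:R * gauss_coef s2 k.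
Proof.
rewrite /centered_normal; case: eqVneq => [->|s20]; last first.
  have s0 : Num.sqrt s2 != 0 by rewrite sqrtr_eq0 -ltNge lt_def s20.
  split; first by have [] := normal_power s0 k.
  by rewrite (normal_power s0 k).2 normal_momentE // sqr_sqrtr.
split.
  apply/integrableP; split; first by apply/measurable_EFinP; exact: measurable_funX.
  rewrite integral_dirac //=; last by apply/measurable_EFinP/measurableT_comp => //; exact: measurable_funX.
  by rewrite diracT mul1e ltry.
rewrite /mean /Rintegral integral_dirac //=; last by apply/measurable_EFinP; exact: measurable_funX.
rewrite indicT mul1r /= expr0n /gauss_coef mul0r expr0n.
case: k => [|k]; first by rewrite /= fact0 divr1 mulr1.
case: ifP => [_|]; first by rewrite mulr0.
by case: k => [//|k] _ /=; rewrite mul0r mulr0.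
Qed.

Lemma centered_normal_small (al : R) :
  al ^+ (2 * K) / (2 * K)`!%:R * mean L id (fun y => y ^+ (2 * K)) @[K --> \oo] --> (0 : R).
Proof.
apply: (@cvg_eq_near _ (exp_coeff (al ^+ 2 * s2 / 2)) _ _ 0%N); last exact: cvg_series_cvg_0 (is_cvg_series_exp_coeff _).
move=> K _; have [_ ->] := centered_normal_moment (2 * K).
rewrite mulrA divfK; last by rewrite pnatr_eq0 -lt0n fact_gt0.
rewrite /gauss_coef mul2n odd_double doubleK /exp_coeff /= -mul2n exprM mulrA -exprMn.
by rewrite mulrA.
Qed.

End CenteredNormal.

Section Piecewise.
Context {R : realType}.
Implicit Types (a b c : R) (Q : R -> R -> Prop).

Inductive piecewise Q : R -> R -> Prop :=
| Piece a b : a < b -> Q a b -> piecewise Q a b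
| Join a c b : piecewise Q a c -> piecewise Q c b -> piecewise Q a b.

Lemma piecewise_lt Q a b : piecewise Q a b -> a < b.
Proof. by elim=> // {}a c {}b _ ac _ cb; exact: lt_trans cb. Qed.

Definition hereditary Q := forall a b c d, a <= c -> d <= b -> Q a b -> Q c d.

Lemma piecewise_restrict Q a b c d : hereditary Q -> piecewise Q a b ->
  a <= c -> c < d -> d <= b -> piecewise Q c d.
Proof.
move=> hQ h; elim: h c d => {a b} [a b ab Qab|a e b h1 IH1 h2 IH2] c d ac cd db.
  by apply: Piece => //; apply: hQ Qab.
have [de|ed] := leP d e; first exact: IH1.
have [ec|ce] := leP e c; first exact: IH2.
by apply: (@Join _ _ e); [apply: IH1 | apply: IH2]; rewrite ?lexx.
Qed.

(** The common refinement of two subdivisions. *)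
Lemma piecewise_and Q1 Q2 a b : hereditary Q1 -> hereditary Q2 ->
  piecewise Q1 a b -> piecewise Q2 a b -> piecewise (fun c d => Q1 c d /\ Q2 c d) a b.
Proof.
move=> h1 h2; elim=> {a b} [a b ab Q1ab|a e b p1 IH1 p2 IH2] h.
  elim: h Q1ab => {a b ab} [a b ab Q2ab|a e b q1 IH1 q2 IH2] Q1ab; first exact: Piece.
  have ae := piecewise_lt q1; have eb := piecewise_lt q2.
  by apply: (@Join _ _ e); [apply: IH1 | apply: IH2]; apply: h1 Q1ab; rewrite // ltW.
have ae := piecewise_lt p1; have eb := piecewise_lt p2.
by apply: (@Join _ _ e); [apply: IH1 | apply: IH2]; apply: (piecewise_restrict h2 h); rewrite // ltW.
Qed.

Lemma C1_on_hereditary (u : R -> R) : hereditary (fun a b => C1_on a b u).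
Proof.
move=> a b c d ac db [du cdu hdu]; exists du.
  by apply: continuous_subspaceW cdu; apply: subset_itv; rewrite ?bnd_simp.
move=> t; rewrite in_itv /= => /andP[ct td]; apply: hdu; rewrite in_itv /=.
by rewrite (le_lt_trans ac) //= (lt_le_trans td).
Qed.

Lemma piecewise_C1_pieces (u : R -> R) : piecewise_C1 u -> piecewise (fun a b => C1_on a b u) 0 1.
Proof.
move=> [_ [N [p [p0 pN hp]]]]; have N0 : (0 < N)%N.
  by case: N pN {hp} => // pN; move: pN; rewrite p0 => /esym/eqP; rewrite oner_eq0.
rewrite -p0 -pN.
have h k : (k < N)%N -> piecewise (fun a b => C1_on a b u) (p 0%N) (p k.+1).
  elim: k => [|k IH] kN; have [lt C] := hp _ kN; first exact: Piece.
  by apply: (@Join _ _ (p k.+1)); [apply: IH; exact: ltnW | apply: Piece].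
by rewrite -(prednK N0); apply: h; rewrite prednK.
Qed.

Local Notation mu := (@lebesgue_measure R).
Let has_int a b (f : R -> R) r := mu.-integrable `[a, b] (EFin \o f) /\ \int[mu]_(t in `[a, b]) f t = r.

Lemma int_join a c b f r1 r2 : a < c -> c < b -> has_int a c f r1 -> has_int c b f r2 ->
  has_int a b f (r1 + r2).
Proof.
move=> ac cb [i1 e1] [i2 e2].
have i3 : mu.-integrable `]c, b] (EFin \o f).
  by apply: integrableS i2 => //; apply: subset_itvr; rewrite bnd_simp.
have iab : mu.-integrable `[a, b] (EFin \o f).
  apply/(integrable_mkcond _ _).2 => //.
  move/integrable_mkcond: i1 => /(_ (measurable_itv _)) j1.
  move/integrable_mkcond: i3 => /(_ (measurable_itv _)) j3.
  have := integrableD measurableT j1 j3.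
  apply: eq_integrable => // t _; rewrite /= !patchE !mem_setE !in_itv /=.
  have [tc|ct] := leP t c; first by rewrite (le_trans tc (ltW cb)) !andbT adde0.
  by rewrite andbF add0e (le_trans (ltW ac) (ltW ct)).
split => //; have := @Rintegral_itvB R f (BLeft a) (BRight b) c iab.
rewrite !bnd_simp => /(_ (ltW ac) (ltW cb)) /eqP; rewrite subr_eq => /eqP ->.
rewrite e1 addrC -e2; congr (_ + _); apply: Rintegral_itv_obnd_cbnd.
by apply: integrableS iab => //; apply: subset_itvScc; rewrite ?bnd_simp // ltW.
Qed.

Lemma int_piece a b f g r : a < b -> {within `[a, b], continuous g} ->
  (forall t, t \in `]a, b[ -> f t = g t) -> \int[mu]_(t in `[a, b]) g t = r -> has_int a b f r.
Proof.
move=> ab cg fg <-.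
have ig : mu.-integrable `[a, b] (EFin \o g).
  by apply: continuous_compact_integrable => //; exact: segment_compact.
have mg : measurable_fun `[a, b] g by apply/measurable_EFinP; exact: (measurable_int _ ig).
have mfo : measurable_fun `]a, b[ f.
  apply: (eq_measurable_fun g) => [t /[!inE] tab|]; first by rewrite fg.
  by apply: measurable_funS mg => //; apply: subset_itv_oo_cc.
have mf : measurable_fun `[a, b] f := measurable_fun_itv_cc mfo.
have N0 : mu ([set a] `|` [set b]) = 0%E.
  have : (mu ([set a] `|` [set b]) <= mu [set a] + mu [set b])%E by apply: measureU2.
  by rewrite !lebesgue_measure_set1 adde0 measure_le0 => /eqP.
have Eo : [set` `[a, b]] `\` ([set a] `|` [set b]) = [set` `]a, b[].
  apply/seteqP; split => t /=; rewrite !in_itv /=.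
    move=> [/andP[at' tb] h]; rewrite !lt_neqAle at' tb !andbT; apply/andP; split.
      by apply/eqP => e; apply: h; left.
    by apply/eqP => e; apply: h; right.
  move=> /andP[at' tb]; rewrite !ltW //; split => // -[e|e]; first by rewrite e ltxx in at'.
  by rewrite e ltxx in tb.
split.
  apply/(negligible_integrable _ _ _ N0) => //; first exact: measurableU.
    exact/measurable_EFinP.
  rewrite Eo; apply: (@eq_integrable _ _ _ mu _ _ (EFin \o g)) => //.
    by move=> t /[!inE] tab; rewrite /= fg.
  by apply: integrableS ig => //; apply: subset_itv_oo_cc.
rewrite /Rintegral; congr fine.
rewrite integral_itv_bndoo; last exact/measurable_EFinP.
rewrite [RHS]integral_itv_bndoo; last first.
  by apply/measurable_EFinP; apply: measurable_funS mg => //; apply: subset_itv_oo_cc.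
by apply: eq_integral => t /[!inE] tab; rewrite fg.
Qed.

Lemma within_continuousM a b (f g : R -> R) : {within `[a, b], continuous f} ->
  {within `[a, b], continuous g} -> {within `[a, b], continuous (fun t => f t * g t)}.
Proof. by move=> cf cg t; apply: continuousM; [apply: cf | apply: cg]. Qed.

Lemma within_continuous_sub a b c d (f : R -> R) : a <= c -> d <= b ->
  {within `[a, b], continuous f} -> {within `[c, d], continuous f}.
Proof. by move=> ac db; apply: continuous_subspaceW; apply: subset_itv; rewrite bnd_simp. Qed.

Lemma integrable_derive1 a b (x u : R -> R) : piecewise (fun a b => C1_on a b u) a b ->
  {within `[a, b], continuous x} -> mu.-integrable `[a, b] (fun t => (x t * derive1 u t)%:E).
Proof.
move=> h cx; suff [r []] : exists r, has_int a b (fun t => x t * derive1 u t) r by [].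
elim: h cx => {a b} [a b ab [du cdu hdu]|a c b p1 IH1 p2 IH2] cx.
  exists (\int[mu]_(t in `[a, b]) (x t * du t)).
  apply: (int_piece ab _ _ erefl); first exact: within_continuousM.
  by move=> t tab; rewrite derive1E (@derive_val _ _ _ _ _ _ _ (hdu t tab)).
have ac := piecewise_lt p1; have cb := piecewise_lt p2.
have [|r1 h1] := IH1; first exact: (within_continuous_sub (lexx a) (ltW cb) cx).
have [|r2 h2] := IH2; first exact: (within_continuous_sub (ltW ac) (lexx b) cx).
by exists (r1 + r2); apply: int_join h1 h2.
Qed.

(** The fundamental theorem of calculus along a piecewise smooth path. *)
Lemma path_FTC a b (x y u v W : R -> R) :
  piecewise (fun a b => C1_on a b u /\ C1_on a b v) a b ->
  {within `[a, b], continuous x} -> {within `[a, b], continuous y} ->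
  {within `[a, b], continuous W} ->
  (forall t a1 b1, t \in `]a, b[ -> is_derive t 1 u a1 -> is_derive t 1 v b1 ->
     is_derive t 1 W (x t * a1 + y t * b1)) ->
  \int[mu]_(t in `[a, b]) (x t * derive1 u t + y t * derive1 v t) = W b - W a.
Proof.
move=> h cx cy cW dW.
suff [] : has_int a b (fun t => x t * derive1 u t + y t * derive1 v t) (W b - W a) by [].
elim: h cx cy cW dW => {a b} [a b ab [[du cdu hdu] [dv cdv hdv]]|a c b p1 IH1 p2 IH2] cx cy cW dW.
  pose g t := x t * du t + y t * dv t.
  have cg : {within `[a, b], continuous g}.
    by apply: within_continuousD; apply: within_continuousM.
  apply: (int_piece ab cg) => [t tab|].
    rewrite !derive1E (@derive_val _ _ _ _ _ _ _ (hdu t tab)).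
    by rewrite (@derive_val _ _ _ _ _ _ _ (hdv t tab)).
  have dWt t (tab : t \in `]a, b[) := dW t _ _ tab (hdu t tab) (hdv t tab).
  rewrite /Rintegral (@continuous_FTC2 _ g W) //.
  - split; first by move=> t tab; exact: (@ex_derive _ _ _ _ _ _ _ (dWt t tab)).
    + by have [] := (continuous_within_itvP _ ab).1 cW.
    + by have [] := (continuous_within_itvP _ ab).1 cW.
  - by move=> t tab; rewrite derive1E (@derive_val _ _ _ _ _ _ _ (dWt t tab)).
have ac := piecewise_lt p1; have cb := piecewise_lt p2.
have -> : W b - W a = (W c - W a) + (W b - W c) by ring.
have sub1 f := @within_continuous_sub a b a c f (lexx a) (ltW cb).
have sub2 f := @within_continuous_sub a b c b f (ltW ac) (lexx b).
have d1 t a1 b1 : t \in `]a, c[ -> is_derive t 1 u a1 -> is_derive t 1 v b1 ->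
    is_derive t 1 W (x t * a1 + y t * b1).
  rewrite in_itv /= => /andP[t1 t2]; apply: dW.
  by rewrite in_itv /= t1 (lt_trans t2).
have d2 t a1 b1 : t \in `]c, b[ -> is_derive t 1 u a1 -> is_derive t 1 v b1 ->
    is_derive t 1 W (x t * a1 + y t * b1).
  rewrite in_itv /= => /andP[t1 t2]; apply: dW.
  by rewrite in_itv /= t2 (lt_trans ac).
have i1 := IH1 (sub1 x cx) (sub1 y cy) (sub1 W cW) d1.
have i2 := IH2 (sub2 x cx) (sub2 y cy) (sub2 W cW) d2.
exact (int_join ac cb i1 i2).
Qed.

End Piecewise.

Local Open Scope complex_scope.

Section ComplexPaths.
Context {R : realType}.
Implicit Types (Z W : R -> R[i]) (t : R) (d e x y z : R[i]).
Local Notation re := complex.Re.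
Local Notation im := complex.Im.

Lemma reM x y : re (x * y) = re x * re y - im x * im y. Proof. by case: x y => ? ? []. Qed.
Lemma imM x y : im (x * y) = re x * im y + im x * re y.
Proof. by case: x y => a b [c e] /=; rewrite [b * c]mulrC addrC mulrC. Qed.
Lemma reD x y : re (x + y) = re x + re y. Proof. by case: x y => ? ? []. Qed.
Lemma imD x y : im (x + y) = im x + im y. Proof. by case: x y => ? ? []. Qed.
Lemma reV x : re x^-1 = re x / (re x ^+ 2 + im x ^+ 2). Proof. by case: x. Qed.
Lemma imV x : im x^-1 = - (im x / (re x ^+ 2 + im x ^+ 2)). Proof. by case: x. Qed.

Lemma sqnorm_neq0 x : x != 0 -> re x ^+ 2 + im x ^+ 2 != 0.
Proof.
case: x => a b h; apply: contra h => /=; rewrite paddr_eq0 ?sqr_ge0 // !sqrf_eq0.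
by move=> /andP[/eqP -> /eqP ->].
Qed.

Definition cder Z t d := is_derive t 1 (fun s => re (Z s)) (re d) /\
  is_derive t 1 (fun s => im (Z s)) (im d).

Lemma cderD Z W t d e : cder Z t d -> cder W t e -> cder (fun s => Z s + W s) t (d + e).
Proof.
move=> [h1 h2] [h3 h4]; rewrite /cder reD imD; split.
  by under eq_fun do rewrite reD; apply: is_deriveD.
by under eq_fun do rewrite imD; apply: is_deriveD.
Qed.

Lemma cderM Z W t d e : cder Z t d -> cder W t e -> cder (fun s => Z s * W s) t (d * W t + Z t * e).
Proof.
move=> [h1 h2] [h3 h4]; rewrite /cder reD imD !reM !imM; split.
  under eq_fun do rewrite reM.
  by apply: is_derive_eq; rewrite /GRing.scale /=; ring.
under eq_fun do rewrite imM.
by apply: is_derive_eq; rewrite /GRing.scale /=; ring.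
Qed.

Lemma cder_cst z t : cder (fun=> z) t 0.
Proof. by split; apply: is_derive_cst. Qed.

Lemma cderX Z t d k : cder Z t d -> cder (fun s => Z s ^+ k.+1) t (k.+1%:R * Z t ^+ k * d).
Proof.
move=> h; elim: k => [|k IH].
  by under eq_fun do rewrite expr1; rewrite expr0 !mul1r.
under eq_fun do rewrite exprS.
have := cderM h IH; suff -> : d * Z t ^+ k.+1 + Z t * (k.+1%:R * Z t ^+ k * d) =
  k.+2%:R * Z t ^+ k.+1 * d by [].
by rewrite exprS -[k.+2%:R]natr1; ring.
Qed.

Lemma cderV Z t d : Z t != 0 -> cder Z t d -> cder (fun s => (Z s)^-1) t (- (Z t ^- 2) * d).
Proof.
move=> z0 [h1 h2]; have n0 := sqnorm_neq0 z0.
have hn : is_derive t 1 (fun s => (re (Z s) ^+ 2 + im (Z s) ^+ 2)^-1)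
   (- (re (Z t) ^+ 2 + im (Z t) ^+ 2) ^- 2 * (2 * re (Z t) * re d + 2 * im (Z t) * im d)).
  have h3 : is_derive t 1 (fun s => re (Z s) ^+ 2 + im (Z s) ^+ 2)
     (2 * re (Z t) * re d + 2 * im (Z t) * im d).
    by apply: is_derive_eq; rewrite /GRing.scale /=; ring.
  exact: is_deriveV.
rewrite /cder; split.
  under eq_fun do rewrite reV.
  apply: is_derive_eq; rewrite /GRing.scale /= mulNr.
  move: n0; rewrite reM /=; case: (Z t) => a b; case: d {h1 h2 hn} => c e /= n0; rewrite expr2.
  rewrite /=; have -> : (a * a - b * b) ^+ 2 + (a * b + b * a) ^+ 2 = (a ^+ 2 + b ^+ 2) ^+ 2 by ring.
  by field.
under eq_fun do rewrite imV.
apply: is_derive_eq; rewrite /GRing.scale /= mulNr.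
move: n0; rewrite imM /=; case: (Z t) => a b; case: d {h1 h2 hn} => c e /= n0; rewrite expr2.
rewrite /=; have -> : (a * a - b * b) ^+ 2 + (a * b + b * a) ^+ 2 = (a ^+ 2 + b ^+ 2) ^+ 2 by ring.
by field.
Qed.

Definition ccont Z := {within `[0, 1], continuous (fun s => re (Z s))} /\
  {within `[0, 1], continuous (fun s => im (Z s))}.

Lemma ccont_eq Z W : (forall t, t \in `[0, 1] -> Z t = W t) -> ccont Z -> ccont W.
Proof.
move=> e [h1 h2]; split.
  by apply: subspace_eq_continuous h1 => t /[!inE] tI; congr (re _); apply: e.
by apply: subspace_eq_continuous h2 => t /[!inE] tI; congr (im _); apply: e.
Qed.

Lemma ccont_cst z : ccont (fun=> z).
Proof. by split => t; apply: cst_continuous. Qed.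

Lemma ccontD Z W : ccont Z -> ccont W -> ccont (fun s => Z s + W s).
Proof.
move=> [h1 h2] [h3 h4]; split.
  rewrite (funext (fun s => reD (Z s) (W s))); exact: (within_continuousD h1 h3).
rewrite (funext (fun s => imD (Z s) (W s))); exact: (within_continuousD h2 h4).
Qed.

Lemma ccontM Z W : ccont Z -> ccont W -> ccont (fun s => Z s * W s).
Proof.
move=> [h1 h2] [h3 h4]; split.
  rewrite (funext (fun s => reM (Z s) (W s))).
  exact: (within_continuousB (within_continuousM h1 h3) (within_continuousM h2 h4)).
rewrite (funext (fun s => imM (Z s) (W s))).
exact: (within_continuousD (within_continuousM h1 h4) (within_continuousM h2 h3)).
Qed.

Lemma ccontX Z k : ccont Z -> ccont (fun s => Z s ^+ k).
Proof.
move=> h; elim: k => [|k IH]; first exact: ccont_cst.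
by rewrite (funext (fun s => exprS (Z s) k)); apply: ccontM.
Qed.

Lemma ccontV Z : (forall t, t \in `[0, 1] -> Z t != 0) -> ccont Z -> ccont (fun s => (Z s)^-1).
Proof.
move=> nz [h1 h2].
have hn : {within `[0, 1], continuous (fun s => (re (Z s) ^+ 2 + im (Z s) ^+ 2)^-1)}.
  have hc : {within `[0, 1], continuous (fun s => re (Z s) ^+ 2 + im (Z s) ^+ 2)}.
    exact: (within_continuousD (within_continuousM h1 h1) (within_continuousM h2 h2)).
  apply/subspace_continuousP => t tI; move/subspace_continuousP: hc => /(_ t tI) hc.
  apply: cvgV => //; exact/sqnorm_neq0/nz.
split.
  rewrite (funext (fun s => reV (Z s))); exact: within_continuousM.
have -> : (fun s => im (Z s)^-1) = (fun s => - im (Z s) * (re (Z s) ^+ 2 + im (Z s) ^+ 2)^-1).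
  by apply/funext => s; rewrite imV mulNr.
by apply: within_continuousM => // t; apply: continuousN; apply: h2.
Qed.

End ComplexPaths.

Section ContourIntegrals.
Context {R : realType} (G : R -> R[i]).
Implicit Types (F H : R[i] -> R[i]).
Local Notation re := complex.Re.
Local Notation im := complex.Im.
Local Notation mu := (@lebesgue_measure R).
Hypothesis C1re : piecewise_C1 (fun t => re (G t)).
Hypothesis C1im : piecewise_C1 (fun t => im (G t)).
Hypothesis closed : G 0 = G 1.

Lemma ccont_path : ccont G. Proof. by split; [case: C1re | case: C1im]. Qed.

Let pre := piecewise_C1_pieces C1re.
Let pim := piecewise_C1_pieces C1im.
Let pboth := piecewise_and (@C1_on_hereditary _ _) (@C1_on_hereditary _ _) pre pim.

Let u' := derive1 (fun t => re (G t)).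
Let v' := derive1 (fun t => im (G t)).

Lemma contour_integralE F : contour_integral G F =
  (\int[mu]_(t in `[0, 1]) (re (F (G t)) * u' t + - im (F (G t)) * v' t))
  +i* (\int[mu]_(t in `[0, 1]) (im (F (G t)) * u' t + re (F (G t)) * v' t)).
Proof.
rewrite /contour_integral; congr (_ +i* _); apply: eq_Rintegral => t _.
  by rewrite reM /contour_derivative /= mulNr.
by rewrite imM /contour_derivative /= addrC.
Qed.

Lemma eq_contour_integral F H : (forall t, t \in `[0, 1] -> F (G t) = H (G t)) ->
  contour_integral G F = contour_integral G H.
Proof.
by move=> e; congr (_ +i* _); apply: eq_Rintegral => t /[!inE] tI; rewrite e.
Qed.

Let integrable2 (x y : R -> R) : {within `[0, 1], continuous x} -> {within `[0, 1], continuous y} ->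
  mu.-integrable `[0, 1] (EFin \o (fun t => x t * u' t + y t * v' t)).
Proof.
move=> cx cy; have := integrableD _ (integrable_derive1 pre cx) (integrable_derive1 pim cy).
by move=> /(_ (measurable_itv _)); apply: eq_integrable => // t _; rewrite /= EFinD.
Qed.

Lemma contour_integralD F H : ccont (F \o G) -> ccont (H \o G) ->
  contour_integral G (fun z => F z + H z) = contour_integral G F + contour_integral G H.
Proof.
move=> [f1 f2] [h1 h2].
have nf2 : {within `[0, 1], continuous (fun t => - im (F (G t)))} by move=> t; apply: continuousN; apply: f2.
have nh2 : {within `[0, 1], continuous (fun t => - im (H (G t)))} by move=> t; apply: continuousN; apply: h2.
rewrite !contour_integralE /=; congr (_ +i* _); rewrite -RintegralD //;
  try exact: integrable2; apply: eq_Rintegral => t _; rewrite reD imD; ring.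
Qed.

Lemma contour_integralZ (c : R) F : ccont (F \o G) ->
  contour_integral G (fun z => c%:C * F z) = c%:C * contour_integral G F.
Proof.
move=> [f1 f2].
have nf2 : {within `[0, 1], continuous (fun t => - im (F (G t)))} by move=> t; apply: continuousN; apply: f2.
have cE A B : c%:C * (A +i* B) = (c * A) +i* (c * B) by congr (_ +i* _) => /=; ring.
rewrite !contour_integralE cE; congr (_ +i* _);
  rewrite -RintegralZl //; try exact: integrable2; apply: eq_Rintegral => t _; rewrite reM imM /=; ring.
Qed.

Lemma contour_primitive F H : ccont (F \o G) -> ccont (H \o G) ->
  (forall t d, t \in `]0, 1[ -> cder G t d -> cder (H \o G) t (F (G t) * d)) ->
  contour_integral G F = 0.
Proof.
move=> [f1 f2] [h1 h2] dH.
have nf2 : {within `[0, 1], continuous (fun t => - im (F (G t)))} by move=> t; apply: continuousN; apply: f2.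
have E1 : \int[mu]_(t in `[0, 1]) (re (F (G t)) * u' t + - im (F (G t)) * v' t)
    = re (H (G 1)) - re (H (G 0)).
  apply: (path_FTC (W := fun t => re (H (G t))) pboth f1 nf2 h1) => t a1 b1 tI d1 d2.
  by have [] := dH t (a1 +i* b1) tI (conj d1 d2); rewrite reM /= mulNr.
have E2 : \int[mu]_(t in `[0, 1]) (im (F (G t)) * u' t + re (F (G t)) * v' t)
    = im (H (G 1)) - im (H (G 0)).
  apply: (path_FTC (W := fun t => im (H (G t))) pboth f2 f1 h2) => t a1 b1 tI d1 d2.
  by have [_] := dH t (a1 +i* b1) tI (conj d1 d2); rewrite imM /= addrC.
by rewrite contour_integralE E1 E2 closed !subrr.
Qed.

End ContourIntegrals.

Section LaurentAtInfinity.
Context {R : realType} (is_pole : R -> Prop) (L : nat).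
Implicit Types (F H : R[i] -> R[i]) (P Q : {poly R}).

Definition geom_series (p : R) : {poly R} := \poly_(i < L) p ^+ i.
Definition pole_series (p : R) : {poly R} := 'X * geom_series p.

Let defect p := 1 - geom_series p * (1 - p *: 'X).

Lemma eqmodX_subr P Q : eqmodX L (P - Q) 0 -> eqmodX L P Q.
Proof. by move=> h i iL; apply/eqP; rewrite -subr_eq0 -coefB h ?coef0. Qed.

Lemma eqmodX_defect P p : eqmodX L (P * defect p) 0.
Proof.
rewrite -(mulr0 P); apply: eqmodXM => // i iL.
rewrite /defect coefB coef1 coef0 mulrBr mulr1 -scalerAr coefB coefZ coefMX !coef_poly iL.
case: i iL => [|i] iL /=; first by rewrite expr0 mulr0 subr0 subrr.
by rewrite (ltnW iL) exprS subrr subr0.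
Qed.

Inductive laurent : nat -> {poly R} -> (R[i] -> R[i]) -> Prop :=
| Lmonomial k : laurent k 1 (fun z => z ^+ k)
| Lpole p k : is_pole p -> laurent 0 (pole_series p ^+ k) (fun z => (z - p%:C)^-1 ^+ k)
| Ladd N P Q F H : laurent N P F -> laurent N Q H -> laurent N (P + Q) (fun z => F z + H z)
| Lscale c N P F : laurent N P F -> laurent N (c *: P) (fun z => c%:C * F z)
| Lshift N P F : laurent N P F -> laurent N.+1 (P * 'X) F
| Leq N P Q F H : laurent N P F -> eqmodX L P Q ->
    (forall z, (forall p, is_pole p -> z != p%:C) -> F z = H z) -> laurent N Q H.

Lemma laurent_mulz N P F : laurent N P F -> laurent N.+1 P (fun z => z * F z).
Proof.
elim=> {N P F} [k|p k pp|N P Q F H _ IH1 _ IH2|c N P F _ IH|N P F _ IH|N P Q F H _ IH e1 e2].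
- by apply: Leq (Lmonomial k.+1) _ _ => // z _; rewrite exprS.
- case: k => [|k]; first by apply: Leq (Lmonomial 1) _ _ => // z _; rewrite expr0 mulr1 expr1.
  have h := Ladd (Lshift (Lpole k pp)) (Lscale p (Lshift (Lpole k.+1 pp))).
  apply: Leq h _ _ => [|z hz].
    apply: eqmodX_subr; have := @eqmodX_defect (pole_series p ^+ k * 'X) p.
    suff -> : pole_series p ^+ k * 'X * defect p =
      pole_series p ^+ k * 'X + p *: (pole_series p ^+ k.+1 * 'X) - pole_series p ^+ k.+1 by [].
    by rewrite exprS; move: (pole_series p ^+ k) => A; rewrite /pole_series /defect -!mul_polyC; ring.
  rewrite exprS; have : z - p%:C != 0 by rewrite subr_eq0 hz.
  by move: (_ ^+ k) => A z0; field.
- by apply: Leq (Ladd IH1 IH2) _ _ => // z _; rewrite mulrDr.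
- by apply: Leq (Lscale c IH) _ _ => // z _; rewrite mulrCA.
- exact: Lshift.
- by apply: Leq IH e1 _ => z hz; rewrite e2.
Qed.

Lemma laurent_div N P F p : is_pole p -> laurent N P F ->
  laurent N (P * pole_series p) (fun z => F z / (z - p%:C)).
Proof.
move=> pp; elim=> {N P F} [k|q k qp|N P Q F H _ IH1 _ IH2|c N P F _ IH|N P F _ IH|N P Q F H _ IH e1 e2].
- elim: k => [|k IH].
    by apply: Leq (Lpole 1 pp) _ _ => [|z _]; rewrite expr1 ?expr0 mul1r.
  by apply: Leq (laurent_mulz IH) _ _ => // z _; rewrite exprS mulrA.
- elim: k => [|k IH].
    by apply: Leq (Lpole 1 pp) _ _ => [|z _]; rewrite expr1 ?expr0 mul1r.
  have [->|qNp] := eqVneq p q.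
    by apply: Leq (Lpole k.+2 qp) _ _ => [|z _]; rewrite [_ ^+ k.+2]exprSr.
  have h := Lscale (q - p)^-1 (Ladd (Lpole k.+1 qp) (Lscale (-1) IH)).
  have qp0 : q - p != 0 by rewrite subr_eq0 eq_sym.
  apply: Leq h _ _ => [|z hz].
    apply: eqmodX_subr.
    have := eqmodXZ (q - p)^-1 (eqmodXD (@eqmodX_defect (pole_series q ^+ k * 'X * geom_series q) p)
      (eqmodXZ (-1) (@eqmodX_defect (pole_series q ^+ k * 'X * geom_series p) q))).
    rewrite scaler0 addr0 scaler0; congr (eqmodX L _ 0).
    apply: (scalerI qp0); rewrite scalerBr !scalerA mulfV // !scale1r exprSr.
    move: (pole_series q ^+ k) => A; rewrite /pole_series /defect -!mul_polyC rmorphB /= polyCN polyC1; ring.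
  have z1 : z - p%:C != 0 by rewrite subr_eq0 hz.
  have z2 : z - q%:C != 0 by rewrite subr_eq0 hz.
  have z3 : q%:C - p%:C != 0 :> R[i] by rewrite -rmorphB fmorph_eq0.
  rewrite exprSr fmorphV rmorphB rmorphN rmorph1 /=; move: (_ ^+ k) => A.
  by field; rewrite z1 z2 z3.
- by apply: Leq (Ladd IH1 IH2) _ _ => [|z _]; rewrite mulrDl.
- by apply: Leq (Lscale c IH) _ _ => [|z _]; rewrite ?scalerAl ?mulrA.
- by apply: Leq (Lshift IH) _ _ => // i iL; rewrite mulrAC.
- by apply: Leq IH (eqmodXM e1 _) _ => // z hz; rewrite e2.
Qed.

Section Residue.
Variable G : R -> R[i].
Hypothesis C1re : piecewise_C1 (fun t => complex.Re (G t)).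
Hypothesis C1im : piecewise_C1 (fun t => complex.Im (G t)).
Hypothesis closed : G 0 = G 1.
Hypothesis winds : forall p, is_pole p -> winds_once_around G p%:C.

Let G_avoids t : t \in `[0, 1] -> forall p, is_pole p -> G t != p%:C.
Proof. by move=> tI p /winds [h _]; apply: h. Qed.

Lemma two_pi_i_neq0 : two_pi_i != 0 :> R[i].
Proof.
apply/eqP => /(congr1 (@complex.Im R)) /= /eqP.
by rewrite mulf_eq0 pnatr_eq0 /= gt_eqF // pi_gt0.
Qed.

Lemma contour_pole p : is_pole p ->
  contour_integral G (fun z => (z - p%:C)^-1) = two_pi_i.
Proof.
move=> /winds [_ /(congr1 (fun z => two_pi_i * z))].
by rewrite mulrA mulfV ?two_pi_i_neq0 // mul1r mulr1.
Qed.

Let cG := ccont_path C1re C1im.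

Let cder_inv p t d : is_pole p -> t \in `]0, 1[ -> cder G t d ->
  cder (fun s => (G s - p%:C)^-1) t (- ((G t - p%:C) ^- 2) * d).
Proof.
move=> pp tI h; apply: cderV.
  by rewrite subr_eq0 G_avoids //; apply: subset_itv_oo_cc tI.
by have := cderD h (cder_cst (- p%:C) t); rewrite addr0.
Qed.

Let ccont_inv p : is_pole p -> ccont (fun s => (G s - p%:C)^-1).
Proof.
move=> pp; apply: ccontV => [t tI|]; first by rewrite subr_eq0 G_avoids.
exact: (ccontD cG (ccont_cst _)).
Qed.

Lemma contour_monomial k : contour_integral G (fun z => z ^+ k) = 0.
Proof.
apply: (contour_primitive (H := fun z => k.+1%:R^-1 * z ^+ k.+1) C1re C1im closed).
- exact: ccontX.
- by apply: ccontM; [exact: ccont_cst | exact: ccontX].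
move=> t d _ h; have := cderM (cder_cst k.+1%:R^-1 t) (cderX k h).
suff -> : 0 * G t ^+ k.+1 + k.+1%:R^-1 * (k.+1%:R * G t ^+ k * d) = G t ^+ k * d by [].
by rewrite mul0r add0r !mulrA mulVf ?mul1r // pnatr_eq0.
Qed.

Lemma contour_multiple_pole p k : is_pole p ->
  contour_integral G (fun z => (z - p%:C)^-1 ^+ k.+2) = 0.
Proof.
move=> pp; apply: (contour_primitive (H := fun z => - k.+1%:R^-1 * (z - p%:C)^-1 ^+ k.+1) C1re C1im closed).
- exact/ccontX/ccont_inv.
- by apply: ccontM; [exact: ccont_cst | exact/ccontX/ccont_inv].
move=> t d tI h; have := cderM (cder_cst (- k.+1%:R^-1) t) (cderX k (cder_inv pp tI h)).
set A := _ + _; suff -> : A = (G t - p%:C)^-1 ^+ k.+2 * d by [].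
rewrite /A !exprS exprVn mul0r add0r.
have : k.+1%:R != 0 :> R[i] by rewrite pnatr_eq0.
have gp : G t - p%:C != 0 by rewrite subr_eq0 G_avoids //; apply: subset_itv_oo_cc tI.
move: gp; rewrite -exprVn; move: (G t - p%:C) (k.+1%:R) => y B y0 B0.
move: (y^-1 ^+ k) => D; field; by rewrite ?B0 ?y0.
Qed.

(** Only the term in [1 / z] of the expansion at infinity contributes. *)
Lemma contour_laurent N P F : laurent N P F -> (N.+1 < L)%N ->
  ccont (F \o G) /\ contour_integral G F = two_pi_i * (P`_N.+1)%:C.
Proof.
elim=> {N P F} [k|p k pp|N P Q F H _ IH1 _ IH2|c N P F _ IH|N P F _ IH|N P Q F H _ IH e1 e2] NL.
- by split; [exact: ccontX | rewrite contour_monomial coef1 mulr0].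
- split; first exact/ccontX/ccont_inv.
  case: k => [|[|k]].
  + by rewrite (contour_monomial 0) expr0 coef1 mulr0.
  + rewrite (@eq_contour_integral _ _ _ (fun z => (z - p%:C)^-1)); last by move=> t _; rewrite expr1.
    rewrite contour_pole // expr1 /pole_series coefXM coef_poly /= (ltnW NL).
    by rewrite expr0 mulr1.
  + by rewrite contour_multiple_pole // !exprS /pole_series -!mulrA !coefXM /= mulrCA coefXM mulr0.
- have [c1 i1] := IH1 NL; have [c2 i2] := IH2 NL; split; first exact: (ccontD c1 c2).
  by rewrite contour_integralD // i1 i2 coefD rmorphD mulrDr.
- have [c1 i1] := IH NL; split; first exact: (ccontM (ccont_cst c%:C) c1).
  by rewrite contour_integralZ // i1 coefZ rmorphM mulrCA.
- by have [c1 i1] := IH (ltnW NL); split => //; rewrite i1 coefMX.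
- have [c1 i1] := IH NL; split.
    by apply: ccont_eq c1 => t tI; apply/e2/G_avoids.
  rewrite -e1 // -i1; apply: eq_contour_integral => t tI.
  by rewrite e2 //; apply: G_avoids.
Qed.

End Residue.

End LaurentAtInfinity.

Section Fourier.
Context {R : realType} (m : nat) (a b : 'I_m -> R) (f : {poly R}).

Definition symbol_pole (p : R) := p = 0 \/ exists j, p = b j.

Let phi (z : R[i]) := z + \sum_(j < m) (a j)%:C / (z - (b j)%:C).
Let D := (size f).-1.

Lemma laurent_mul_symbol L N P F : laurent symbol_pole L N P F ->
  laurent symbol_pole L N.+1 (P * symbol_series L a b) (fun z => phi z * F z).
Proof.
move=> h.
have hs (r : seq 'I_m) : laurent symbol_pole L N (\sum_(j <- r) a j *: (P * pole_series L (b j)))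
    (fun z => \sum_(j <- r) (a j)%:C * (F z / (z - (b j)%:C))).
  elim: r => [|j r IH].
    apply: Leq (Lscale 0 h) _ _ => [|z _]; first by rewrite big_nil scale0r.
    by rewrite big_nil mul0r.
  have hj := Lscale (a j) (laurent_div (or_intror (ex_intro _ j erefl) : symbol_pole (b j)) h).
  apply: Leq (Ladd hj IH) _ _ => [|z _]; first by rewrite big_cons.
  by rewrite big_cons.
apply: Leq (Ladd (laurent_mulz h) (Lshift (hs (index_enum _)))) _ _ => [|z _]; last first.
  rewrite /phi mulrDl mulr_suml; congr (_ + _); apply: eq_bigr => j _.
  by rewrite -!mulrA; congr (_ * _); rewrite mulrC.
have -> : P + (\sum_j a j *: (P * pole_series L (b j))) * 'X =
    P * (1 + \sum_j a j *: ('X * pole_series L (b j))).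
  rewrite mulrDr mulr1 mulr_sumr mulr_suml; congr (_ + _); apply: eq_bigr => j _.
  by rewrite -scalerAl -scalerAr -mulrA ['X * _]mulrC.
apply: eqmodXM => // i iL; rewrite coefD coef1 coef_sum /symbol_series coef_poly iL.
under eq_bigr do rewrite coefZ coefXM /pole_series.
case: i iL => [|[|i]] iL /=.
- by rewrite big1 ?addr0 // => j _; rewrite mulr0.
- by rewrite add0r big1 // => j _; rewrite coefXM mulr0.
- by rewrite add0r; apply: eq_bigr => j _; rewrite coefXM /= coef_poly (ltnW (ltnW iL)).
Qed.

Lemma laurent_shifts L N P F e : laurent symbol_pole L N P F ->
  laurent symbol_pole L (N + e) (P * 'X^e) F.
Proof.
move=> h; elim: e => [|e IH]; first by rewrite addn0 expr0 mulr1.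
by rewrite addnS exprSr mulrA; apply: Lshift.
Qed.

Lemma laurent_symbol_poly L : laurent symbol_pole L D (symbol_poly L a b f)
  (fun z => (map_poly (fun r : R => r%:C) f).[phi z]).
Proof.
have hk k : (k <= D)%N ->
    laurent symbol_pole L D (symbol_series L a b ^+ k * 'X^(D - k)) (fun z => phi z ^+ k).
  move=> kD; rewrite -[X in laurent _ _ X](subnKC kD); apply: laurent_shifts.
  elim: k {kD} => [|k IH].
    by apply: Leq (Lmonomial _ _ 0) _ _ => // z _; rewrite !expr0.
  by apply: Leq (laurent_mul_symbol IH) _ _ => [|z _]; rewrite exprSr // mulrC.
have hs (r : seq 'I_(size f)) :
    laurent symbol_pole L D (\sum_(k <- r) f`_k *: (symbol_series L a b ^+ k * 'X^(D - k)))
      (fun z => \sum_(k <- r) (f`_k)%:C * phi z ^+ k).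
  elim: r => [|k r IH].
    apply: Leq (Lscale 0 (hk 0%N isT)) _ _ => [|z _]; first by rewrite big_nil scale0r.
    by rewrite big_nil mul0r.
  have kD : (k <= D)%N by rewrite -ltnS (leq_trans (ltn_ord k)) // leqSpred.
  apply: Leq (Ladd (Lscale _ (hk k kD)) IH) _ _ => [|z _]; first by rewrite big_cons.
  by rewrite big_cons.
apply: Leq (hs (index_enum _)) _ _ => // z _.
rewrite horner_coef (size_map_poly (real_complex R)); apply: eq_bigr => k _.
by rewrite (coef_map (real_complex R)).
Qed.

Section Coefficients.
Variable G : R -> R[i].
Hypothesis C1re : piecewise_C1 (fun t => complex.Re (G t)).
Hypothesis C1im : piecewise_C1 (fun t => complex.Im (G t)).
Hypothesis closed : G 0 = G 1.
Hypothesis winds0 : winds_once_around G 0.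
Hypothesis winds : forall j, winds_once_around G (b j)%:C.

Let windsP p : symbol_pole p -> winds_once_around G p%:C.
Proof. by move=> [->|[j ->]]. Qed.

Let coef_residue L N P F := @contour_laurent R symbol_pole L G C1re C1im closed windsP N P F.

Lemma fourier_coef_ge0 M (l : nat) : (D < M)%N ->
  fourier_coef G a b f l%:Z = (if (l <= D)%N then (symbol_poly M a b f)`_(D - l) else 0)%:C.
Proof.
move=> DM; pose L := (D + M).+3.
have h n : laurent symbol_pole L D (symbol_poly L a b f * 'X^n)
    (fun z => (map_poly (fun r : R => r%:C) f).[phi z] / z ^+ n).
  elim: n => [|n IH].
    by apply: Leq (laurent_symbol_poly L) _ _ => [|z _]; rewrite expr0 ?mulr1 ?divr1.
  apply: Leq (laurent_div (or_introl erefl : symbol_pole 0) IH) _ _ => [|z _]; last first.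
    by rewrite subr0 exprSr invfM mulrA.
  rewrite exprSr mulrA; apply: eqmodXM => // i iL; rewrite /pole_series coefXM coefX coef_poly.
  by case: i iL => [|[|i]] iL //=; rewrite ?expr0n ?(ltnW (ltnW iL)) ?(ltnW iL).
have [_] := coef_residue (h l.+1) (ltac:(rewrite /L; lia) : (D.+1 < L)%N).
move=> E; rewrite /fourier_coef -PoszD addn1 [contour_integral _ _]E.
rewrite mulrA mulVf ?two_pi_i_neq0 // mul1r coefMXn; congr (_%:C).
rewrite ltnS ltnNge; case: leqP => //= lD; rewrite subSS.
by rewrite (@symbol_polyE _ _ _ _ _ M L) // /L; lia.
Qed.

Lemma fourier_coef_le0 M (l : nat) : (D + l < M)%N ->
  fourier_coef G a b f (- l%:Z) = ((symbol_poly M a b f)`_(D + l))%:C.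
Proof.
case: l => [|l] DM.
  rewrite oppr0 (@fourier_coef_ge0 M 0) /= ?subn0 ?addn0 //; lia.
have h n : laurent symbol_pole M.+2 (D + n) (symbol_poly M.+2 a b f)
    (fun z => (map_poly (fun r : R => r%:C) f).[phi z] * z ^+ n).
  elim: n => [|n IH].
    by rewrite addn0; apply: Leq (laurent_symbol_poly _) _ _ => // z _; rewrite expr0 mulr1.
  rewrite addnS; apply: Leq (laurent_mulz IH) _ _ => // z _.
  by rewrite exprS mulrCA.
have [_] := coef_residue (h l) (ltac:(lia) : ((D + l).+1 < M.+2)%N).
rewrite /fourier_coef.
have -> : - l.+1%:Z + 1 = - l%:Z by rewrite -addn1 PoszD opprD addrNK.
have <- : (fun z : R[i] => (map_poly (fun r : R => r%:C) f).[phi z] * z ^+ l) =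
    (fun z => (map_poly (fun r : R => r%:C) f).[phi z] / z ^ (- l%:Z)).
  by apply/funext => z; rewrite -exprnN invrK.
move=> ->; rewrite mulrA mulVf ?two_pi_i_neq0 // mul1r; congr (_%:C).
by rewrite addnS (@symbol_polyE _ _ _ _ _ M M.+2) //; lia.
Qed.

End Coefficients.

End Fourier.

Lemma method_of_moments_normal (R : realType) (d : nat -> measure_display)
    (T : forall n, measurableType (d n)) (P : forall n, probability (T n) R)
    (Y : forall n, T n -> R) (s2 : R) : 0 <= s2 ->
  (forall n k, summable (P n) (@Y n) (fun y => y ^+ k)) ->
  (forall k, mean (P n) (@Y n) (fun y => y ^+ k / k`!%:R) @[n --> \oo] --> gauss_coef s2 k) ->
  cvg_in_distribution P Y (centered_normal s2).
Proof.
move=> s20 iY lm g cg [M gM].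
have mY n : measurable_fun setT (@Y n).
  by apply/measurable_EFinP; have := measurable_int _ (iY n 1%N); under eq_fun do rewrite expr1.
have kf k : k`!%:R != 0 :> R by rewrite pnatr_eq0 -lt0n fact_gt0.
have lm' k : mean (P n) (@Y n) (fun y => y ^+ k) @[n --> \oo]
    --> mean (centered_normal s2) id (fun y => y ^+ k).
  have [_ ->] := centered_normal_moment s20 k.
  apply: (@cvg_eq_near _ (fun n => k`!%:R * mean (P n) (@Y n) (fun y => y ^+ k / k`!%:R)) _ _ 0%N).
    move=> n _; rewrite -meanZ.
      by congr (mean _ _ _); apply/funext => y; rewrite mulrCA mulfV ?mulr1.
    under eq_fun do rewrite mulrC; exact: summableZ.
  by apply: cvgM; [exact: cvg_cst | exact: lm].
have [_ ig jg lg] := convergent_bounded mY iY (fun k => (centered_normal_moment s20 k).1) lm'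
  (centered_normal_small s20) cg gM.
have E n : 'E_(P n)[fun w => g (@Y n w)]%E = (mean (P n) (@Y n) g)%:E.
  by rewrite expectation.unlock /mean /Rintegral fineK // (integrable_fin_num measurableT (ig n)).
have EL : (\int[centered_normal s2]_x (g x)%:E)%E = (mean (centered_normal s2) id g)%:E.
  by rewrite /mean /Rintegral fineK // (integrable_fin_num measurableT jg).
by rewrite (funext E) EL; apply: cvg_EFin => //; exact: nearW.
Qed.

Theorem mainTheorem10 (R : realType) (m : nat) (tau a : R) (gamma : 'I_m -> R)
    (k : nat -> 'I_m -> nat) (nu : 'I_m -> R)
    (d : nat -> measure_display) (T : forall n, measurableType (d n))
    (P : forall n, probability (T n) R)
    (x : forall n, {RV (P n) >-> n.-tuple nat})
    (f : {poly R}) (Gamma : R -> R[i]) :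
  let aa j := tau * nu j * (a * gamma j) / (1 - a * gamma j) ^+ 2 in
  let bb j := tau * (a * gamma j) / (1 - a * gamma j)
              + \sum_(i < m) nu i / (1 - a * gamma i) in
  let fc := fourier_coef Gamma aa bb f in
  let X n omega := linear_statistic f (x n omega) in
  1 <= tau -> 0 < a < 1 ->
  (forall j, 0 < gamma j <= 1) -> injective gamma ->
  (forall n, (\sum_(j < m) k n j)%N = n) ->
  (forall n, exists j, forall i, k n.+1 i = (k n i + (i == j))%N) ->
  (forall j, 0 <= nu j <= 1) -> \sum_(j < m) nu j = 1 ->
  (forall j, (k n j)%:R / n%:R @[n --> \oo] --> nu j) ->
  (forall n, is_mope (fun j y => gamma j ^+ y)
               (meixner_mass n (n%:R * tau) a) (k n)
               (distribution (P n) (x n))) ->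
  simple_closed_contour Gamma ->
  winds_once_around Gamma 0 ->
  (forall j, winds_once_around Gamma (bb j)%:C) ->
  exists sigma2 : R,
    [/\ 0 <= sigma2,
        (\sum_(1 <= l < N) l%:R * fc l%:Z * fc (- l%:Z) : R[i]^o) @[N --> \oo]
          --> (sigma2%:C : R[i]^o),
        forall n, (P n).-integrable setT (EFin \o X n) &
        cvg_in_distribution P
          (fun n omega => X n omega - fine 'E_(P n)[X n])
          (centered_normal sigma2)].
Proof.
move=> aa bb fc X tau1 a01 gamma01 _ ksum _ _ _ klim mope [C1re C1im closed _] w0 w.
pose S n (t : n.-tuple nat) := linear_statistic f t.
pose s2 := limit_variance tau a gamma nu f.
pose Y n omega := X n omega - fine 'E_(P n)[X n].
have lm := @cvg_central_moment R m tau a gamma k nu d T P x f tau1 a01 gamma01 ksum klim mope.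
have int n (H : n.-tuple nat -> R) : ((0 < n)%N -> tame H) ->
    (P n).-integrable setT (fun w => (H (x n w))%:E).
  case: (posnP n) => [n0 _|n0 /(_ isT) tH]; last first.
    by apply: tame_integrable tH; apply: (meixner_bounded tau1 a01 gamma01 mope).
  have hc (t : n.-tuple nat) : H t = H (x n point).
    have nilE (t' : n.-tuple nat) : tval t' = [::] by apply: size0nil; rewrite size_tuple.
    by congr (H _); apply: val_inj; rewrite /= !nilE.
  have -> : (fun w => (H (x n w))%:E) = cst (H (x n point))%:E by apply/funext => z /=; rewrite hc.
  exact: finite_measure_integrable_cst.
have tS n : tame (@S n).
  pose fs := f \Po (n%:R^-1 *: 'X).
  have -> : @S n = (fun t => \sum_i fs.[(tnth t i)%:R]).
    apply/funext => t; apply: eq_bigr => i _.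
    by rewrite /fs horner_comp !hornerE mulrC.
  by apply: tame_sum => i; apply: tame_horner.
have EX n : fine 'E_(P n)[X n] = tmean (x n) (@S n) by rewrite expectation.unlock.
have iY n j : summable (P n) (@Y n) (fun y => y ^+ j).
  rewrite /summable /Y EX; apply: (int n (fun t => (S n t - tmean (x n) (@S n)) ^+ j)) => _.
  by apply: tameX; apply: tameD => //; apply: tame_cst.
have lmY j : mean (P n) (@Y n) (fun y => y ^+ j / j`!%:R) @[n --> \oo] --> gauss_coef s2 j.
  by apply: (cvg_eq_near (N := 0%N)) (lm j) => n _; rewrite /mean /Rintegral /Y EX.
have s20 : 0 <= s2.
  have -> : s2 = 2 * gauss_coef s2 2 by rewrite /gauss_coef /= (_ : 1`! = 1%N) // expr1 divr1 mulrC divfK.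
  rewrite mulr_ge0 //; apply: (cvgr_to_ge (lmY 2%N)).
  by apply: nearW => n; apply: Rintegral_ge0 => z _; rewrite divr_ge0 // sqr_ge0.
exists s2; split => //.
- pose D := (size f).-1.
  pose Phi := symbol_poly (2 * D).+1 aa bb f.
  have pos l := @fourier_coef_ge0 R m aa bb f Gamma C1re C1im closed w0 w (2 * D).+1 l.
  have neg l := @fourier_coef_le0 R m aa bb f Gamma C1re C1im closed w0 w (2 * D).+1 l.
  apply: cvg_near_cst; exists D.+1 => // N /= DN.
  have DD : (D < (2 * D).+1)%N by lia.
  rewrite (big_cat_nat (n := D.+1)) //= [X in _ + X]big1_seq ?addr0; last first.
    move=> l /andP[_]; rewrite mem_index_iota => /andP[Dl _].
    by rewrite /fc (pos l DD) leqNgt Dl mulr0 mul0r.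
  rewrite /s2 /limit_variance big_ord_recl mulr0n !mul0r add0r rmorph_sum big_add1 big_mkord /=.
  apply: eq_bigr => l _; rewrite !rmorphM rmorph_nat /= /fc (pos _ DD) neg; last by have := ltn_ord l; rewrite -/D; lia.
  by rewrite -/D ltn_ord.
- by move=> n; apply: (int n (@S n)).
- exact: method_of_moments_normal.
Qed.
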